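(* Let $C$ be the plane affine curve over $\mathbb{R}$ with equation $x_1^2+x_2^2=1$, so $\mathbb{R}[C]=\mathbb{R}[x_1,x_2]/(x_1^2+x_2^2-1)$, and let $V=C\times\mathbb{A}^1$, so $\mathbb{R}[V]=\mathbb{R}[C][y]$ and $V(\mathbb{R})=C(\mathbb{R})\times\mathbb{R}$. Then every $f\in\mathbb{R}[V]$ with $f\ge0$ on $V(\mathbb{R})$ is a sum of squares in $\mathbb{R}[V]$. *)

(* Defs.v *)
From HB Require Import structures.
From mathcomp Require Import all_boot all_order all_algebra.
From mathcomp Require Import reals.
From mathcomp Require Import mpoly.
Set Implicit Arguments. Unset Strict Implicit. Unset Printing Implicit Defensive.
Import Order.TTheory GRing.Theory Num.Theory.
Local Open Scope ring_scope.

(* Ambient polynomial ring R[x1,x2,y] = {mpoly R[3]} with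
   x1 = 'X_0, x2 = 'X_1, y = 'X_2. *)

Definition circ_eq (R : realType) : {mpoly R[3]} :=
  'X_(0 : 'I_3) ^+ 2 + 'X_(1 : 'I_3) ^+ 2 - 1.

Definition V_real_point (R : realType) (v : 'I_3 -> R) : Prop :=
  v 0 ^+ 2 + v 1 ^+ 2 = 1.

Definition nonneg_on_V (R : realType) (f : {mpoly R[3]}) : Prop :=
  forall v : 'I_3 -> R, V_real_point v -> 0 <= f.@[v].

(* The class of f in R[V] = R[x1,x2,y]/(x1^2+x2^2-1) is a sum of squares:
   f = sum_i g_i^2 + h * (x1^2+x2^2-1) for some polynomials g_i, h. *)
Definition sos_in_RV (R : realType) (f : {mpoly R[3]}) : Prop :=
  exists (s : seq {mpoly R[3]}) (h : {mpoly R[3]}),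
    f = \sum_(g <- s) g ^+ 2 + h * circ_eq R.

(* Main.v *)
Require Import Defs.
From HB Require Import structures.
From mathcomp Require Import all_boot all_order all_algebra.
From mathcomp Require Import reals.
From mathcomp Require Import mpoly.
From mathcomp Require Import separable cyclotomic.
From mathcomp Require Import boolp complex polyrcf.
From mathcomp Require Import zify ring lra.
(** Put [z = x1 + i x2]: a polynomial on [V] is a Laurent polynomial in [z] on the
    unit circle, with coefficients polynomial in [y], and a sum of squared moduli of
    such polynomials is a sum of squares in the real coordinate ring.  The proof is
    by induction on the degree in [y].

    If [f] vanishes on a whole line [z = P], one divides by [|z - P|^2]; if [f] has a
    repeated factor [p], one divides by [|p|^2].  A substitution [y -> c + 1/y] then
    makes the leading coefficient in [y] a unit on the circle, and the discriminant
    gives a lower bound [f >= E W], where [W = (1 + y^2)^d] and [E = |e(z)|^2].  Near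
    each zero of [e], [f - E W / 2] is a squared modulus over the ring of power series,
    by Puiseux's theorem.  By the Chinese remainder theorem there is a [g] with
    [f - E W / 2 = |g|^2] modulo [E^2].  With [tau] a high even power of [1 - b E],
    this yields [f = tau |g|^2 + E h], where [h] is bounded below by [W / 4]: near the
    zeros of [E] because [|g|^2] has a nonnegative coefficient, and elsewhere because
    [tau] is small.  Such a strictly positive [h] is a sum of squared moduli, by
    convolution with Fejer kernels in [z] and factorization in [y] at roots of unity. *)

Set Implicit Arguments. Unset Strict Implicit. Unset Printing Implicit Defensive.
Import Order.TTheory GRing.Theory Num.Theory.
Local Open Scope ring_scope.

(** * Formal power series *)

(** The obstacle is the zeros of [f]: Fejer averaging needs strict positivity. When the resultant of
    [f] and its [y]-derivative is nonzero, the zeros of [f] lie over finitely many points of the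
    circle, the zeros of [E]; when it is zero, there is a repeated factor to divide out. Holding
    back [E W / 2] leaves [h] a margin. The congruence is taken modulo [E^2], not [E]: the remainder
    [E^2 kappa] then contributes only [E kappa] to [h], and the margin dominates it where [E] is
    small. The exponent of [1 - b E] is even so that [tau] is a square, and [1 - tau] is divisible
    by [E], so that [h] is again a Laurent polynomial. The line in [y] is not compact; comparison
    with [W], which has the full degree [2d], makes up for this and needs a leading coefficient
    without zeros on the circle. Throughout, the squares keep at most half the degree bound of [f]
    in [y]: without this they could not be carried back through [y -> c + 1/y]. *)

Record fps (K : Type) := Fps { fcoef : nat -> K }.

HB.instance Definition _ (K : Type) := gen_eqMixin (fps K).
HB.instance Definition _ (K : Type) := gen_choiceMixin (fps K).

Lemma fps_ext (K : Type) (x y : fps K) :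
  (forall k, fcoef x k = fcoef y k) -> x = y.
Proof. by case: x y => [x] [y] /= /funext ->. Qed.

Section FpsRing.
Variable K : fieldType.
Implicit Types x y z : fps K.

Definition ftrunc n x : {poly K} := \poly_(i < n) fcoef x i.

Lemma coef_ftrunc n x k : (k < n)%N -> (ftrunc n x)`_k = fcoef x k.
Proof. by rewrite coef_poly => ->. Qed.

Definition fps0 : fps K := Fps (fun=> 0).
Definition fps1 : fps K := Fps (fun k => (k == 0)%:R).
Definition fpsD x y := Fps (fun k => fcoef x k + fcoef y k).
Definition fpsN x := Fps (fun k => - fcoef x k).
(** Each coefficient is read off a product of truncations, so that the ring axioms reduce to those
    of [{poly K}]; by [fpsME] any longer truncation gives the same value. *)
Definition fpsM x y := Fps (fun k => (ftrunc k.+1 x * ftrunc k.+1 y)`_k).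

Lemma coefM_low (p p' q q' : {poly K}) n :
  (forall k, (k <= n)%N -> p`_k = p'`_k) ->
  (forall k, (k <= n)%N -> q`_k = q'`_k) -> (p * q)`_n = (p' * q')`_n.
Proof.
move=> Hp Hq; rewrite !coefM; apply: eq_bigr => i _.
by rewrite Hp ?Hq ?leq_subr // -ltnS.
Qed.

Lemma fpsME n x y k : (k < n)%N ->
  fcoef (fpsM x y) k = (ftrunc n x * ftrunc n y)`_k.
Proof.
move=> lt_kn; apply: coefM_low => j le_jk; rewrite !coef_ftrunc //;
  exact: leq_ltn_trans lt_kn.
Qed.

Lemma fpsDA : associative fpsD.
Proof. by move=> x y z; apply: fps_ext => k /=; rewrite addrA. Qed.
Lemma fpsDC : commutative fpsD.
Proof. by move=> x y; apply: fps_ext => k /=; rewrite addrC. Qed.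
Lemma fps0D : left_id fps0 fpsD.
Proof. by move=> x; apply: fps_ext => k /=; rewrite add0r. Qed.
Lemma fpsND : left_inverse fps0 fpsN fpsD.
Proof. by move=> x; apply: fps_ext => k /=; rewrite addNr. Qed.

HB.instance Definition _ := GRing.isZmodule.Build (fps K) fpsDA fpsDC fps0D fpsND.

Lemma fpsMA : associative fpsM.
Proof.
move=> x y z; apply: fps_ext => k.
rewrite (@fpsME k.+1) // [RHS](@fpsME k.+1) //.
pose w := ftrunc k.+1 x * ftrunc k.+1 y * ftrunc k.+1 z.
transitivity w`_k.
  rewrite /w -mulrA; apply: coefM_low => // j le_jk.
  by rewrite coef_ftrunc // (@fpsME k.+1).
apply: coefM_low => // j le_jk.
by rewrite coef_ftrunc // (@fpsME k.+1).
Qed.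
Lemma fpsMC : commutative fpsM.
Proof. by move=> x y; apply: fps_ext => k /=; rewrite mulrC. Qed.
Lemma fps1M : left_id fps1 fpsM.
Proof.
move=> x; apply: fps_ext => k /=.
have -> : ftrunc k.+1 fps1 = 1.
  by apply/polyP => i; rewrite coef_poly coef1; case: i => //= i; rewrite if_same.
by rewrite mul1r coef_ftrunc.
Qed.
Lemma fpsMDl : left_distributive fpsM fpsD.
Proof.
move=> x y z; apply: fps_ext => k /=.
suff -> : ftrunc k.+1 (fpsD x y) = ftrunc k.+1 x + ftrunc k.+1 y.
  by rewrite mulrDl coefD.
by apply/polyP => i; rewrite coefD !coef_poly; case: ifP => // _; rewrite addr0.
Qed.
Lemma fps1_neq0 : fps1 != 0 :> fps K.
Proof. by apply/eqP => /(congr1 (fun x => fcoef x 0)) /=/eqP; rewrite oner_eq0. Qed.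

HB.instance Definition _ :=
  GRing.Zmodule_isComNzRing.Build (fps K) fpsMA fpsMC fps1M fpsMDl fps1_neq0.

Definition fps_unit : pred (fps K) := fun x => `[< exists y, y * x = 1 >].
Definition fps_inv x : fps K :=
  if pselect (exists y, y * x = 1) is left e then projT1 (cid e) else x.
Lemma fps_mulVr : {in fps_unit, left_inverse 1 fps_inv *%R}.
Proof.
move=> x /asboolP Hx; rewrite /fps_inv; case: pselect => // e.
exact: (projT2 (cid e)).
Qed.
Lemma fps_unitP x y : y * x = 1 -> fps_unit x.
Proof. by move=> xy1; apply/asboolP; exists y. Qed.
Lemma fps_inv_out : {in [predC fps_unit], fps_inv =1 id}.
Proof.
move=> x /negP nx; rewrite /fps_inv; case: pselect => // e; case: nx.
exact/asboolP.
Qed.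

HB.instance Definition _ :=
  GRing.ComNzRing_hasMulInverse.Build (fps K) fps_mulVr fps_unitP fps_inv_out.

Lemma fcoefB x y k : fcoef (x - y) k = fcoef x k - fcoef y k. Proof. by []. Qed.
Lemma fcoef0 k : fcoef (0 : fps K) k = 0. Proof. by []. Qed.
Lemma fcoef1 k : fcoef (1 : fps K) k = (k == 0)%:R. Proof. by []. Qed.
Lemma fcoefM_trunc n x y k : (k < n)%N ->
  fcoef (x * y) k = (ftrunc n x * ftrunc n y)`_k.
Proof. exact: fpsME. Qed.
Lemma fcoefM x y k :
  fcoef (x * y) k = \sum_(i < k.+1) fcoef x i * fcoef y (k - i).
Proof.
rewrite (@fcoefM_trunc k.+1) // coefM; apply: eq_bigr => i _.
by rewrite !coef_ftrunc // ltnS leq_subr.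
Qed.
Lemma fcoef_sum I (r : seq I) (P : pred I) (F : I -> fps K) k :
  fcoef (\sum_(i <- r | P i) F i) k = \sum_(i <- r | P i) fcoef (F i) k.
Proof. by elim/big_rec2: _ => // i y x _ <-. Qed.

Lemma fps_neq0P x :
  x != 0 -> exists n, fcoef x n != 0 /\ forall k, (k < n)%N -> fcoef x k = 0.
Proof.
move=> x0; have ex : exists n, fcoef x n != 0.
  apply: contrapT => nex; case/eqP: x0; apply: fps_ext => k.
  by apply/eqP; apply: contrapT => /negP h; apply: nex; exists k.
case: (ex_minnP ex) => n xn min_n; exists n; split=> // k lt_kn.
by apply/eqP; apply: contraTT lt_kn => /min_n; rewrite -leqNgt.
Qed.

Lemma fcoefM_lead x y m n :
  (forall k, (k < m)%N -> fcoef x k = 0) -> (forall k, (k < n)%N -> fcoef y k = 0) ->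
  fcoef (x * y) (m + n)%N = fcoef x m * fcoef y n.
Proof.
move=> x0 y0; rewrite fcoefM.
have lt_m : (m < (m + n).+1)%N by rewrite ltnS leq_addr.
rewrite (bigD1 (Ordinal lt_m)) //= addKn big1 ?addr0 // => i /negP ne_im.
have [lt_im|le_mi] := ltnP i m; first by rewrite x0 // mul0r.
rewrite y0 ?mulr0 // ltn_subLR; last by rewrite -ltnS.
rewrite ltn_add2r ltn_neqAle le_mi andbT.
by apply/eqP => e; apply: ne_im; apply/eqP/val_inj/esym.
Qed.

Lemma fps_integral x y : x * y = 0 -> (x == 0) || (y == 0).
Proof.
move=> xy0; apply: contrapT => /negP; rewrite negb_or => /andP[].
move=> /fps_neq0P[m [xm mx]] /fps_neq0P[n [yn ny]].
have /esym/eqP := fcoefM_lead mx ny; rewrite xy0 fcoef0 mulf_eq0.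
by rewrite (negPf xm) (negPf yn).
Qed.

HB.instance Definition _ :=
  GRing.ComUnitRing_isIntegral.Build (fps K) fps_integral.

End FpsRing.

(** * Monomials, shifts and substitutions of power series *)

Section Morphisms.
Variable K : fieldType.
Implicit Types x y z : fps K.

Definition fconst (a : K) : fps K := Fps (fun k => a *+ (k == 0)).
Definition fX n : fps K := Fps (fun k => (k == n)%:R).

Lemma ftrunc_fX n m : (n < m)%N -> ftrunc m (fX n) = 'X^n.
Proof.
move=> lt_nm; apply/polyP => i; rewrite coef_poly coefXn.
by case: ltnP => //= le_mi; case: eqP => // e; rewrite e leqNgt lt_nm in le_mi.
Qed.

Lemma fcoefXM n x k :
  fcoef (fX n * x) k = if (k < n)%N then 0 else fcoef x (k - n).
Proof.
rewrite (@fcoefM_trunc _ (n + k).+1) ?ltnS ?leq_addl //.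
rewrite ftrunc_fX ?ltnS ?leq_addr // coefXnM; case: ltnP => // le_nk.
by rewrite coef_ftrunc // ltnS (leq_trans (leq_subr _ _)) ?leq_addl.
Qed.

Lemma fX0 : fX 0 = 1. Proof. exact: fps_ext. Qed.
Lemma fXD m n : fX (m + n)%N = fX m * fX n.
Proof.
apply: fps_ext => k; rewrite fcoefXM /=; case: ltnP => h.
  by case: eqP => // e; move: h; rewrite e ltnNge leq_addr.
by rewrite -(eqn_add2l m (k - m)%N) subnKC.
Qed.

Lemma fXX m n : fX m ^+ n = fX (m * n)%N.
Proof.
elim: n => [|n IH]; first by rewrite muln0 fX0 expr0.
by rewrite exprS IH mulnS fXD.
Qed.

Definition fshift n x : fps K := Fps (fun k => fcoef x (k + n)%N).
Lemma fshiftK n x : (forall k, (k < n)%N -> fcoef x k = 0) -> fX n * fshift n x = x.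
Proof.
move=> x0; apply: fps_ext => k; rewrite fcoefXM /=.
by case: ltnP => [/x0-> //|/subnK ->].
Qed.

Lemma fconst_is_additive : zmod_morphism fconst.
Proof. by move=> a b; apply: fps_ext => k /=; rewrite mulrnBl. Qed.
Lemma fcoef_constM a x k : fcoef (fconst a * x) k = a * fcoef x k.
Proof.
rewrite fcoefM big_ord_recl /= subn0 big1 ?addr0 // => i _.
by rewrite mulr0n mul0r.
Qed.
Lemma fconst_is_multiplicative : monoid_morphism fconst.
Proof.
split=> [|a b]; first by apply: fps_ext.
by apply: fps_ext => k; rewrite fcoef_constM /= mulrnAr.
Qed.
HB.instance Definition _ := GRing.isZmodMorphism.Build _ _ fconst fconst_is_additive.
HB.instance Definition _ := GRing.isMonoidMorphism.Build _ _ fconst fconst_is_multiplicative.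

Definition fcst x := fcoef x 0.
Lemma fcst_is_additive : zmod_morphism fcst.
Proof. by []. Qed.
Lemma fcst_is_multiplicative : monoid_morphism fcst.
Proof. by split=> // x y; rewrite /fcst fcoefM big_ord_recl big_ord0 addr0. Qed.
HB.instance Definition _ := GRing.isZmodMorphism.Build _ _ fcst fcst_is_additive.
HB.instance Definition _ := GRing.isMonoidMorphism.Build _ _ fcst fcst_is_multiplicative.

(* the substitution [s |-> c * s ^ e.+1]; the shift in the index keeps it a
   ring morphism for every [e] *)
Definition fsub (c : K) (e : nat) x : fps K :=
  Fps (fun k => if (e.+1 %| k)%N then c ^+ (k %/ e.+1) * fcoef x (k %/ e.+1) else 0).

Lemma fcoef_sub c e x k : fcoef (fsub c e x) k =
  if (e.+1 %| k)%N then c ^+ (k %/ e.+1) * fcoef x (k %/ e.+1) else 0.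
Proof. by []. Qed.

Lemma fsub_is_additive c e : zmod_morphism (fsub c e).
Proof.
by move=> x y; apply: fps_ext => k /=; case: ifP => _; rewrite ?subrr // mulrBr.
Qed.

Definition fsubp (c : K) e (p : {poly K}) := (p \Po (c *: 'X)) \Po 'X^(e.+1).
Lemma coef_scaleX (p : {poly K}) (c : K) i : (p \Po (c *: 'X))`_i = c ^+ i * p`_i.
Proof.
have -> : p \Po (c *: 'X) = \poly_(i < size p) (c ^+ i * p`_i).
  rewrite comp_polyE poly_def; apply: eq_bigr => j _.
  by rewrite exprZn scalerA mulrC.
rewrite coef_poly; case: ltnP => // h; by rewrite nth_default ?mulr0.
Qed.
Lemma coef_fsubp c e x n k : (k < n)%N ->
  (fsubp c e (ftrunc n x))`_k = fcoef (fsub c e x) k.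
Proof.
move=> lt_kn; rewrite coef_comp_poly_Xn //= coef_scaleX.
case: ifP => // _; rewrite coef_ftrunc //.
exact: leq_ltn_trans (leq_div _ _) lt_kn.
Qed.

Lemma fsub_is_multiplicative c e : monoid_morphism (fsub c e).
Proof.
split=> [|x y]; apply: fps_ext => k.
  rewrite fcoef_sub !fcoef1.
  case: k => [|k]; first by rewrite dvdn0 div0n expr0 mul1r.
  case: ifP => // /dvdnP[[//|q] ->]; by rewrite mulnK //= mulr0.
rewrite fcoef_sub.
rewrite [RHS](@fcoefM_trunc _ k.+1) // (@coefM_low _ _ (fsubp c e (ftrunc k.+1 x))
   _ (fsubp c e (ftrunc k.+1 y))); last 2 first.
- by move=> j h; rewrite coef_ftrunc // coef_fsubp.
- by move=> j h; rewrite coef_ftrunc // coef_fsubp.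
rewrite /fsubp -!comp_polyM coef_comp_poly_Xn // coef_scaleX.
case: ifP => // _; rewrite (@fcoefM_trunc _ k.+1) //.
by rewrite ltnS leq_div.
Qed.
HB.instance Definition _ c e :=
  GRing.isZmodMorphism.Build _ _ (fsub c e) (fsub_is_additive c e).
HB.instance Definition _ c e :=
  GRing.isMonoidMorphism.Build _ _ (fsub c e) (fsub_is_multiplicative c e).

End Morphisms.
Arguments fX K n%_nat_scope.
Arguments fcst : simpl never.

Section MapFps.
Variables (K L : fieldType) (h : {rmorphism K -> L}).
Definition fmap (x : fps K) : fps L := Fps (fun k => h (fcoef x k)).
Lemma fcoef_map x k : fcoef (fmap x) k = h (fcoef x k). Proof. by []. Qed.
Lemma fmap_is_additive : zmod_morphism fmap.
Proof. by move=> x y; apply: fps_ext => k /=; rewrite rmorphB. Qed.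
Lemma fmap_is_multiplicative : monoid_morphism fmap.
Proof.
split=> [|x y]; apply: fps_ext => k; first by rewrite /= rmorph_nat.
rewrite fcoef_map !fcoefM rmorph_sum; apply: eq_bigr => i _; exact: rmorphM.
Qed.
HB.instance Definition _ := GRing.isZmodMorphism.Build _ _ fmap fmap_is_additive.
HB.instance Definition _ := GRing.isMonoidMorphism.Build _ _ fmap fmap_is_multiplicative.
End MapFps.

(** Course-of-values recursion: [hist n] lists the first [n] values, and the hypothesis on [G] says
    that entries beyond the list, where [nth] returns the default [t0], do not matter. *)
Lemma strong_recursion (T : Type) (t0 : T) (G : nat -> (nat -> T) -> T) :
  (forall k u v, (forall j, (j < k)%N -> u j = v j) -> G k u = G k v) ->
  exists u, forall k, u k = G k u.
Proof.
move=> Gext.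
pose hist := fix hist n := if n is n'.+1 then
  let h := hist n' in rcons h (G n' (nth t0 h)) else [::].
have sz n : size (hist n) = n by elim: n => //= n IH; rewrite size_rcons IH.
have hist_nth n k : (k < n)%N -> nth t0 (hist n) k = G k (nth t0 (hist k)).
  elim: n => // n IH; rewrite ltnS leq_eqVlt /= nth_rcons sz.
  by case: eqVneq => [-> _|_ /= lt_kn]; rewrite ?ltnn // lt_kn IH.
exists (fun k => nth t0 (hist k.+1) k) => k.
rewrite hist_nth //; apply: Gext => j lt_jk.
by rewrite !hist_nth.
Qed.

(** * Hensel's lemma and Puiseux's theorem *)

Section Hensel.
Variable K : fieldType.
Implicit Types (x y : fps K) (F A B : {poly fps K}).

Lemma fps_unit_cst x : fcst x != 0 -> exists y, y * x = 1.
Proof.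
move=> x0.
pose G k (u : nat -> K) := if k is 0 then (fcst x)^-1 else
  - (fcst x)^-1 * \sum_(i < k) u i * fcoef x (k - i).
have [k u v uv|u Hu] := @strong_recursion K 0 G.
  by case: k uv => //= k uv; congr (_ * _); apply: eq_bigr => i _; rewrite uv.
exists (Fps u); apply: fps_ext => k; rewrite fcoefM /= big_ord_recr /= subnn.
have -> : u k = G k u by [].
case: k => [|k] /=; first by rewrite big_ord0 add0r mulVf.
set S := \sum_(i < k.+1) _.
rewrite -/(fcst x) mulNr mulNr mulrAC mulVf // mul1r; exact: subrr.
Qed.

(* the coefficient of [s ^ k] *)
Definition slice k F : {poly K} := \poly_(i < size F) fcoef F`_i k.
Lemma coef_slice k F i : (slice k F)`_i = fcoef F`_i k.
Proof. by rewrite coef_poly; case: ltnP => // h; rewrite nth_default. Qed.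

Lemma slice_inj F A : (forall k, slice k F = slice k A) -> F = A.
Proof.
move=> e; apply/polyP => i; apply: fps_ext => k.
by rewrite -!coef_slice e.
Qed.

Lemma slice0 F : slice 0 F = map_poly (@fcst K) F.
Proof. by apply/polyP => i; rewrite coef_slice. Qed.

Lemma sliceM k A B : slice k (A * B) = \sum_(i < k.+1) slice i A * slice (k - i) B.
Proof.
apply/polyP => j; rewrite coef_slice coefM coef_sum fcoef_sum.
under eq_bigr => i _ do rewrite fcoefM.
rewrite exchange_big /=; apply: eq_bigr => i _; rewrite coefM.
by apply: eq_bigr => l _; rewrite !coef_slice.
Qed.

Lemma slice_polyE m (u : nat -> {poly K}) k :
  (forall i, (size (u i) <= m)%N) ->
  slice k (\poly_(i < m) Fps (fun k => (u k)`_i)) = u k.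
Proof.
move=> um; apply/polyP => i; rewrite coef_slice coef_poly.
by case: ltnP => //= h; rewrite nth_default // (leq_trans (um k)).
Qed.

(** At order [k] the unknown coefficients enter linearly, as [a * B0 + A0 * b = r] with [r] known
    from lower orders; coprimality solves this, and reducing [a] modulo [A0] fixes the degrees. *)
Lemma hensel F (A0 B0 : {poly K}) :
  F \is monic -> A0 \is monic -> B0 \is monic -> coprimep A0 B0 ->
  slice 0 F = A0 * B0 ->
  exists A B, [/\ A \is monic, B \is monic, size A = size A0, F = A * B
    & slice 0 A = A0 /\ slice 0 B = B0].
Proof.
move=> Fm A0m B0m /Bezout_eq1_coprimepP[[u0 v0] /= uv1] F0.
have A0n0 := monic_neq0 A0m; have B0n0 := monic_neq0 B0m.
have [m sA0] : exists m, size A0 = m.+1.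
  by exists (size A0).-1; rewrite prednK // lt0n size_poly_eq0.
have [l sB0] : exists l, size B0 = l.+1.
  by exists (size B0).-1; rewrite prednK // lt0n size_poly_eq0.
have sF : size F = (m + l).+1.
  have : size (slice 0 F) = size F.
    rewrite slice0 size_map_poly_id0 // (monicP Fm) rmorph1; exact: oner_neq0.
  by rewrite F0 size_monicM // sA0 sB0 addSn addnS => <-.
pose rr k (u : nat -> {poly K} * {poly K}) :=
  slice k F - \sum_(i < k | (0 < i)%N) (u i).1 * (u (k - i)%N).2.
pose G k u := if k == 0%N then (A0, B0) else
  let a := (v0 * rr k u) %% A0 in (a, (rr k u - a * B0) %/ A0).
have [k u v uv|u Hu] := @strong_recursion _ (0, 0) G.
  rewrite /G; case: k uv => //= k uv; suff -> : rr k.+1 u = rr k.+1 v by [].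
  congr (_ - _); apply: eq_bigr => i i0; rewrite !uv //.
  by rewrite ltn_subrL i0.
have u0E : u 0%N = (A0, B0) by rewrite Hu.
have ukE k : (0 < k)%N -> u k = ((v0 * rr k u) %% A0,
   (rr k u - ((v0 * rr k u) %% A0) * B0) %/ A0).
  by case: k => // k _; rewrite {1}Hu /G /=.
have eqk k : (0 < k)%N -> (u k).1 * B0 + A0 * (u k).2 = rr k u.
  move=> k0; rewrite ukE //=; set r := rr k u; set a := _ %% _.
  suff dv : A0 %| r - a * B0 by rewrite [A0 * _]mulrC divpK // addrC subrK.
  have -> : r - a * B0 = A0 * (u0 * r + (v0 * r %/ A0) * B0).
    have e : v0 * r = (v0 * r %/ A0) * A0 + a by exact: divp_eq.
    rewrite -[r in LHS]mul1r -uv1.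
    have -> : a = v0 * r - (v0 * r %/ A0) * A0 by rewrite {1}e; ring.
    ring.
  exact: dvdp_mulr.
(* Since [F] is monic of degree [m + l], its slices of positive order have smaller degree; this
   bounds the right-hand side [rr k u], and then the quotient [(u k).2]. *)
have sz k : (0 < k)%N -> (size (u k).1 <= m)%N /\ (size (u k).2 <= l)%N.
  elim/ltn_ind: k => k IH k0.
  have s1 : (size (u k).1 <= m)%N.
    by rewrite ukE //= -ltnS -sA0 ltn_modp.
  split=> //; have sr : (size (rr k u) <= m + l)%N.
    apply: (leq_trans (size_polyD _ _)); rewrite size_polyN geq_max; apply/andP; split.
      apply/leq_sizeP => j; rewrite leq_eqVlt => /orP[/eqP<-|lt_j].
        have := monicP Fm; rewrite lead_coefE sF /= coef_slice => ->.
        by rewrite fcoef1 eqn0Ngt k0.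
      by rewrite coef_slice nth_default // sF.
    apply: (leq_trans (size_sum _ _ _)); apply/bigmax_leqP => i i0.
    have [a1 _] := IH i (ltn_ord i) i0.
    have [_ b2] : (size (u (k - i)%N).1 <= m)%N /\ (size (u (k - i)%N).2 <= l)%N.
      by apply: IH; rewrite ?subn_gt0 ?ltn_ord // ltn_subrL i0 k0.
    apply: (leq_trans (size_polyMleq _ _)); apply: (@leq_trans (m + l).-1); last exact: leq_pred.
    by rewrite -!subn1 leq_sub2r // leq_add.
  have := eqk _ k0 => /(canRL (addKr _)) e.
  have sA0b : (size (A0 * (u k).2)%R <= m + l)%N.
    rewrite e; apply: (leq_trans (size_polyD _ _)); rewrite geq_max sr andbT.
    rewrite size_polyN; apply: (leq_trans (size_polyMleq _ _)).
    by rewrite sB0 addnS /= leq_add2r.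
  have [->|nz] := eqVneq (u k).2 0; first by rewrite size_poly0.
  by move: sA0b; rewrite size_mul // sA0 addSn /= leq_add2l.
pose A := \poly_(i < m.+1) Fps (fun k => (u k).1`_i).
pose B := \poly_(i < l.+1) Fps (fun k => (u k).2`_i).
have szA k : (size (u k).1 <= m.+1)%N.
  case: k => [|k]; first by rewrite u0E /= sA0.
  by have [//|h _] := sz k.+1; apply: leqW.
have szB k : (size (u k).2 <= l.+1)%N.
  case: k => [|k]; first by rewrite u0E /= sB0.
  by have [//|_ h] := sz k.+1; apply: leqW.
have slA k : slice k A = (u k).1 by apply: slice_polyE.
have slB k : slice k B = (u k).2 by apply: slice_polyE.
have Alead : A`_m = 1.
  rewrite coef_poly ltnSn; apply: fps_ext => k /=.
  case: k => [|k] /=; first by rewrite u0E /=; move/monicP: A0m; rewrite lead_coefE sA0.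
  by rewrite nth_default //; have [] := sz k.+1.
have Blead : B`_l = 1.
  rewrite coef_poly ltnSn; apply: fps_ext => k /=.
  case: k => [|k] /=; first by rewrite u0E /=; move/monicP: B0m; rewrite lead_coefE sB0.
  by rewrite nth_default //; have [] := sz k.+1.
have sA : size A = m.+1.
  by rewrite size_poly_eq //; move: Alead; rewrite coef_poly ltnSn => ->; apply: oner_neq0.
have sB : size B = l.+1.
  by rewrite size_poly_eq //; move: Blead; rewrite coef_poly ltnSn => ->; apply: oner_neq0.
exists A, B; split=> //; last by rewrite slA slB u0E.
- by apply/monicP; rewrite lead_coefE sA.
- by apply/monicP; rewrite lead_coefE sB.
- by rewrite sA sA0.
apply: slice_inj => k; rewrite sliceM.
under eq_bigr => i _ do rewrite slA slB.
case: (posnP k) => [->|k0]; first by rewrite big_ord_recl big_ord0 addr0 u0E F0.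
have /eqP := eqk _ k0; rewrite /rr eq_sym subr_eq => /eqP ->.
rewrite big_ord_recr /= subnn u0E /=.
case: k k0 => // k _; rewrite big_ord_recl /= subn0 u0E /=.
rewrite [X in _ + X = _](_ : _ = \sum_(i < k) (u i.+1).1 * (u (k.+1 - i.+1)%N).2).
  by rewrite addrC [A0 * _ + _]addrC; ring.
rewrite big_mkcond big_ord_recl /= add0r.
exact: eq_bigr.
Qed.

End Hensel.

Lemma coef_exp_XsubC (R : comNzRingType) (a : R) n :
  (('X - a%:P) ^+ n.+1)`_n = - (a *+ n.+1).
Proof.
have := @coefPn_prod_XsubC R (nseq n.+1 a) isT.
by rewrite !big_nseq iter_mulr_1 iter_addr_0 size_nseq.
Qed.

Section Puiseux.
Variable C : numClosedFieldType.
Implicit Types (x : fps C) (f : {poly fps C}).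

Lemma fsub_comp (c c' : C) e e' x :
  fsub c e (fsub c' e' x) = fsub (c' * c ^+ e'.+1) (e.+1 * e'.+1).-1 x.
Proof.
apply: fps_ext => k; rewrite !fcoef_sub prednK ?muln_gt0 //.
have [/dvdnP[q ->]|ndv] := boolP (e.+1 %| k)%N; last first.
  case: ifP => // h; case/negP: ndv; exact: dvdn_trans (dvdn_mulr _ _) h.
rewrite mulnK // [(q * _)%N]mulnC dvdn_pmul2l // divnMl //.
case: ifP => [/dvdnP[r ->]|_]; last by rewrite mulr0.
by rewrite mulnK // exprMn -exprM [(r * _)%N]mulnC mulrA [c ^+ _ * _]mulrC.
Qed.

Lemma fsub1 x : fsub 1 0 x = x.
Proof. by apply: fps_ext => k; rewrite fcoef_sub dvd1n divn1 expr1n mul1r. Qed.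

Lemma fsub_fX e n : fsub 1 e (fX C n) = fX C (n * e.+1)%N.
Proof.
apply: fps_ext => k; rewrite fcoef_sub expr1n mul1r /=.
case: ifP => [/dvdnP[q ->]|ndv]; first by rewrite mulnK // eqn_pmul2r.
by case: eqP => // e0; rewrite e0 dvdn_mull in ndv.
Qed.

(** Newton's method by induction on the degree: after rescaling the unknown by the least slope of
    the Newton polygon, Hensel's lemma splits off a factor of smaller degree, which has a root. *)
Lemma puiseux f : f \is monic -> (1 < size f)%N ->
  exists e a, root (map_poly (fsub 1 e) f) a.
Proof.
have [N] := ubnP (size f); elim: N f => // N IH f; rewrite ltnS => sfN fm sf.
have fn0 := monic_neq0 fm.
have [n sfE] : exists n, size f = n.+2 by exists (size f).-2; lia.
have dn0 : n.+1%:R != 0 :> C by rewrite pnatr_eq0.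
(* killing the subleading coefficient makes [g0] below a polynomial that is not
   the power of a linear factor, so that Hensel's lemma splits [g] *)
pose c : fps C := - (fconst (n.+1%:R)^-1 * f`_n).
pose f1 := f \Po ('X + c%:P).
have XcE : 'X + c%:P = 'X - (- c)%:P by rewrite polyCN opprK.
suff [e [a ra]] : exists e a, root (map_poly (fsub 1 e) f1) a.
  exists e, (a + fsub 1 e c); move: ra.
  rewrite /f1 map_comp_poly /root horner_comp rmorphD /= map_polyX map_polyC /=.
  by rewrite !hornerE.
have sXc : size ('X + c%:P) = 2 by rewrite XcE size_XsubC.
have sf1 : size f1 = n.+2 by rewrite size_comp_poly2.
have f1m : f1 \is monic.
  rewrite monicE /f1 lead_coef_comp ?sXc // XcE lead_coefXsubC expr1n mulr1.
  by rewrite (monicP fm).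
have f1n : f1`_n = 0.
  pose low := f - 'X^(n.+1) - f`_n *: 'X^n.
  have slow : (size low <= n)%N.
    apply/leq_sizeP => j le_nj; rewrite !coefB coefZ !coefXn.
    have [->|ne1] := eqVneq j n; first by rewrite ltn_eqF // subr0 mulr1 subrr.
    rewrite mulr0 subr0; have [->|ne2] := eqVneq j n.+1.
      by move/monicP: fm; rewrite lead_coefE sfE /= => ->; rewrite subrr.
    by rewrite nth_default ?subr0 // sfE; lia.
  have -> : f1 = ('X + c%:P) ^+ n.+1 + f`_n *: ('X + c%:P) ^+ n + (low \Po ('X + c%:P)).
    have fE : f = 'X^(n.+1) + f`_n *: 'X^n + low by rewrite /low; ring.
    rewrite /f1 {1}fE !comp_polyD comp_polyZ !comp_Xn_poly.
    by [].
  rewrite !coefD coefZ [X in _ + X](_ : _ = 0) ?addr0; last first.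
    by rewrite nth_default // size_comp_poly2.
  rewrite XcE coef_exp_XsubC.
  have -> : (('X - (- c)%:P) ^+ n)`_n = 1.
    have := monicP (monic_exp n (monicXsubC (- c))).
    by rewrite lead_coefE size_exp_XsubC.
  have k1 : n.+1%:R^-1 *+ n.+1 = 1 :> C by rewrite -[LHS]mulr_natr mulVf.
  rewrite mulr1 mulNrn opprK /c mulNrn -mulrnAl -raddfMn /= k1.
  by rewrite rmorph1 mul1r addNr.
have [f1X|nX] := boolP [forall i : 'I_n.+1, f1`_i == 0].
  exists 0%N, 0; have -> : f1 = 'X^(n.+1).
    apply/polyP => i; rewrite coefXn; have [lt_i|] := ltnP i n.+1.
      by rewrite (eqP (forallP f1X (Ordinal lt_i))) ltn_eqF.
    rewrite leq_eqVlt => /orP[/eqP<-|lt_i].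
      by rewrite eqxx; move/monicP: f1m; rewrite lead_coefE sf1.
    by rewrite nth_default ?sf1 // gtn_eqF.
  by rewrite /root rmorphXn /= map_polyX hornerXn expr0n.
(* the smallest slope [p / (n.+1 - i0)] of the Newton polygon, with the
   denominators cleared by [M] *)
pose M := (n.+1)`!.
pose w (i k : nat) := (k * (M %/ (n.+1 - i)))%N.
have exw : exists W, `[< exists i k, [/\ (i < n.+1)%N, fcoef f1`_i k != 0 & W = w i k] >].
  move: nX; rewrite negb_forall => /existsP[i /fps_neq0P[k [fk _]]].
  by exists (w i k); apply/asboolP; exists i, k; split.
case: (ex_minnP exw) => W /asboolP[i0 [p [lt_i0 f1p ->]]] minW {exw W nX}.
have Mdvd i : (i < n.+1)%N -> (M = M %/ (n.+1 - i) * (n.+1 - i))%N.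
  move=> lt_i; rewrite divnK //; apply: dvdn_fact; lia.
(* The least slope is [p / q.+1]; substituting [s ^ q.+1] for [s] makes it the integer [p]. *)
pose q := (n - i0)%N; have qE : (q.+1 = n.+1 - i0)%N by rewrite /q; lia.
have ordmin i k : (i < n.+1)%N -> fcoef f1`_i k != 0 -> (p * (n.+1 - i) <= q.+1 * k)%N.
  move=> lt_i fik; have /minW : `[< exists i' k', [/\ (i' < n.+1)%N, fcoef f1`_i' k' != 0
     & w i k = w i' k'] >] by apply/asboolP; exists i, k.
  rewrite /w -qE => h.
  have M0 : (0 < M)%N by apply: fact_gt0.
  have := Mdvd _ lt_i; have := Mdvd _ lt_i0; rewrite -qE.
  set a := (M %/ q.+1)%N in h *; set b := (M %/ _)%N in h * => Ma Mb.
  rewrite -(leq_pmul2r M0) {1}Ma {1}Mb.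
  set r := (n.+1 - i)%N in Mb *.
  have -> : (p * r * (a * q.+1) = (p * a) * (r * q.+1))%N by ring.
  have -> : (q.+1 * k * (b * r) = (k * b) * (r * q.+1))%N by ring.
  by rewrite leq_mul2r h orbT.
(* [g] is [f1] after [s |-> s ^ q.+1] and [Y |-> s ^ p * Y], divided by [s ^ (p * n.+1)]; minimality
   of the slope keeps its coefficients power series. *)
pose g := 'X^(n.+1) + \poly_(i < n.+1) fshift (p * (n.+1 - i)) (fsub 1 q f1`_i).
have gE i : (i < n.+1)%N -> g`_i = fshift (p * (n.+1 - i)) (fsub 1 q f1`_i).
  by move=> lt_i; rewrite coefD coefXn ltn_eqF // add0r coef_poly lt_i.
have gK i : (i < n.+1)%N -> fX C (p * (n.+1 - i)) * g`_i = fsub 1 q f1`_i.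
  move=> lt_i; rewrite gE // fshiftK // => k lt_k; rewrite fcoef_sub.
  case: ifP => // /dvdnP[j ke]; rewrite ke mulnK // expr1n mul1r.
  apply/eqP; apply: contraTT lt_k => /(ordmin _ _ lt_i); rewrite -leqNgt ke.
  by rewrite [(j * _)%N]mulnC.
have glead : g`_n.+1 = 1.
  by rewrite coefD coefXn eqxx coef_poly ltnn addr0.
have sg : size g = n.+2.
  rewrite size_polyDl ?size_polyXn // ltnS; exact: size_poly.
have gm : g \is monic by apply/monicP; rewrite lead_coefE sg.
pose g0 := slice 0 g.
have sg0 : size g0 = n.+2.
  rewrite /g0 slice0 size_map_poly_id0 ?sg // (monicP gm) rmorph1; exact: oner_neq0.
have g0m : g0 \is monic.
  by apply/monicP; rewrite lead_coefE sg0 coef_slice glead.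
have g0n : g0`_n = 0.
  by rewrite coef_slice gE // f1n rmorph0.
have g0i : g0`_i0 != 0.
  rewrite coef_slice gE // -[fcoef _ 0]/(fcoef (fsub 1 q f1`_i0) (p * (n.+1 - i0))).
  rewrite fcoef_sub -qE dvdn_mull // mulnK // expr1n mul1r.
  exact: f1p.
have [a ra] : exists a, root g0 a by apply/closed_rootP; rewrite sg0.
have g0n0 := monic_neq0 g0m.
have [m [B nrB g0E]] := multiplicity_XsubC g0 a.
rewrite g0n0 /= in nrB.
have Am : ('X - a%:P) ^+ m \is monic by rewrite monic_exp // monicXsubC.
have Bm : B \is monic by move: g0m; rewrite g0E monicMr.
have m0 : (0 < m)%N.
  case: m g0E {Am} => // g0E; move: ra; rewrite g0E expr0 mulr1.
  by rewrite (negPf nrB).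
have cop : coprimep (('X - a%:P) ^+ m) B.
  by rewrite coprimep_expl // coprimep_sym coprimep_XsubC.
have sl : slice 0 g = ('X - a%:P) ^+ m * B by rewrite mulrC -g0E.
have [A' [B' [A'm B'm sA' gAB _]]] := hensel gm Am Bm cop sl.
(* If [g0] were the power [('X - a) ^ n.+1], its vanishing subleading coefficient would force
   [a = 0] in characteristic zero, against the nonzero coefficient of index [i0]. *)
have mn : (m < n.+1)%N.
  have := congr1 (size \o val) g0E; rewrite /= sg0.
  rewrite size_Mmonic ?(monic_neq0 Bm) // size_exp_XsubC addnS /= => e.
  rewrite ltnNge; apply/negP => ge_m.
  have sB1 : (size B <= 1)%N by rewrite -(leq_add2r m) -e add1n ltnS.
  have B1 : B = 1.
    move/monicP: Bm; rewrite (size1_polyC sB1) lead_coefC => ->.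
    by rewrite polyC1.
  move: e; rewrite B1 size_poly1 add1n => -[em].
  move: g0E; rewrite B1 mul1r -em => g0E.
  move: g0n; rewrite g0E coef_exp_XsubC => /eqP; rewrite oppr_eq0 mulrn_eq0 /= => /eqP a0.
  by move: g0i; rewrite g0E a0 subr0 coefXn ltn_eqF // eqxx.
have sA1 : size A' = m.+1 by rewrite sA' size_exp_XsubC.
have sA2 : (size A' < N)%N.
  by rewrite sA1 (leq_trans _ sfN) // sfE !ltnS.
have sA3 : (1 < size A')%N by rewrite sA1 ltnS.
have [e [b rb]] := IH A' sA2 A'm sA3.
have {}rb : root (map_poly (fsub 1 e) g) b.
  by rewrite gAB rmorphM /= rootM rb.
exists (e.+1 * q.+1).-1, (fX C (p * e.+1) * b).
apply/rootP; rewrite horner_coef size_map_poly_id0; last first.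
  by rewrite (monicP f1m) rmorph1 oner_neq0.
rewrite sf1; move/rootP: rb; rewrite horner_coef size_map_poly_id0; last first.
  by rewrite (monicP gm) rmorph1 oner_neq0.
rewrite sg => gb.
rewrite -[RHS](mulr0 (fX C (p * n.+1 * e.+1))) -[in RHS]gb mulr_sumr.
apply: eq_bigr => i _; rewrite !coef_map /= exprMn fXX.
have := fsub_comp 1 1 e q f1`_i; rewrite expr1n mulr1 => <-.
have [lt_i|ge_i] := ltnP i n.+1.
  rewrite -gK // rmorphM /= fsub_fX.
  have -> : (p * n.+1 * e.+1 = p * (n.+1 - i) * e.+1 + p * e.+1 * i)%N.
    by rewrite mulnAC -[in LHS](subnK (ltnW lt_i)) mulnDr mulnAC.
  rewrite fXD; ring.
have -> : nat_of_ord i = n.+1 by apply/anti_leq; rewrite ge_i -ltnS ltn_ord.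
have -> : f1`_n.+1 = 1 by move/monicP: f1m; rewrite lead_coefE sf1.
rewrite glead !rmorph1 !mul1r; congr (_ * _); congr (fX _ _); exact: mulnAC.
Qed.
End Puiseux.

(** * Roots of unity *)

Section UnityRoots.
Variable C : numClosedFieldType.

Lemma unity_roots_seq n : (0 < n)%N -> exists mu : seq C,
  [/\ uniq mu, size mu = n & forall w, (w \in mu) = (w ^+ n == 1)].
Proof.
move=> n0; have [mu muE] := closed_field_poly_normal ('X^n - 1 : {poly C}).
have lc : lead_coef ('X^n - 1 : {poly C}) = 1 by rewrite lead_coefXnsubC.
rewrite lc scale1r in muE; exists mu; split.
- rewrite -separable_prod_XsubC -muE separable_Xn_sub_1 //.
  by rewrite pnatr_eq0 -lt0n.
- have := congr1 (size \o val) muE.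
  by rewrite /= size_XnsubC // size_prod_XsubC => -[].
- move=> w; rewrite -root_prod_XsubC -muE /root !hornerE.
  by rewrite subr_eq0.
Qed.

(** Otherwise ['X^r - 1], with [r] the remainder of [k] by [n], would have more roots than its
    degree. *)
Lemma unity_roots_dvd (mu : seq C) n k :
  uniq mu -> size mu = n -> (forall w, (w \in mu) = (w ^+ n == 1)) -> (0 < n)%N ->
  (forall w, w \in mu -> w ^+ k = 1) -> (n %| k)%N.
Proof.
move=> mu_uniq mu_size muP n0 muk; rewrite /dvdn; set r := (k %% n)%N.
apply: contraT => r0; have r_gt0 : (0 < r)%N by rewrite lt0n.
have pn0 : 'X^r - 1 != 0 :> {poly C} by rewrite -size_poly_eq0 size_XnsubC.
have rts : all (root ('X^r - 1)) mu.
  apply/allP => w wmu; rewrite /root !hornerE subr_eq0.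
  have := muk w wmu; rewrite {1}(divn_eq k n) exprD mulnC exprM.
  by move: wmu; rewrite muP => /eqP->; rewrite expr1n mul1r => ->.
have := max_poly_roots pn0 rts mu_uniq.
by rewrite mu_size size_XnsubC // ltnS leqNgt ltn_pmod.
Qed.
End UnityRoots.

Lemma dvdp_uniq_roots (A : idomainType) (F : {poly A}) rs :
  uniq rs -> all (root F) rs -> exists Q, F = Q * \prod_(a <- rs) ('X - a%:P).
Proof.
elim: rs => [|a rs IH] /=; first by exists F; rewrite big_nil mulr1.
case/andP => nars urs /andP[ra rrs]; have [Q FQ] := IH urs rrs.
move: ra; rewrite FQ rootM root_prod_XsubC (negPf nars) orbF => /factor_theorem[Q' QE].
by exists Q'; rewrite QE big_cons mulrA.
Qed.

(** * Nonnegative polynomials over the ring of power series *)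

Section LocalFactor.
Variable C : numClosedFieldType.
Implicit Types (x y : fps C) (f p : {poly fps C}).

Notation fcj := (fmap (@Num.conj C)).
Notation pcj := (map_poly fcj).

Lemma fcjK : involutive (fcj : fps C -> fps C).
Proof. by move=> x; apply: fps_ext => k /=; rewrite conjCK. Qed.

Lemma pcjK : involutive (pcj : {poly fps C} -> {poly fps C}).
Proof. by move=> p; apply/polyP => i; rewrite !coef_map /= fcjK. Qed.

Lemma size_pcj p : size (pcj p) = size p.
Proof. by rewrite size_map_inj_poly ?rmorph0 //; apply: can_inj fcjK. Qed.

Lemma fcj_sub c e x : fcj (fsub c e x) = fsub c^* e (fcj x).
Proof.
apply: fps_ext => k; rewrite fcoef_map !fcoef_sub; case: ifP => _; last by rewrite rmorph0.
by rewrite rmorphM rmorphXn.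
Qed.

Lemma fsub_inj (c : C) e : c != 0 -> injective (fsub c e).
Proof.
move=> c0 x y /(congr1 (fun z => fcoef z (_ * e.+1))) exy; apply: fps_ext => k.
have := exy k; rewrite !fcoef_sub dvdn_mull // mulnK //.
by apply: mulfI; rewrite expf_neq0.
Qed.

(* the order of the series in which [s] is a positive infinitesimal *)
Definition fnonneg x :=
  x = 0 \/ exists n, 0 < fcoef x n /\ forall k, (k < n)%N -> fcoef x k = 0.

(* [f] is nonnegative along every real branch [z = sg * s ^ e.+1, y = g(s)] *)
Definition fpsd f := forall e (sg : C) g, sg = 1 \/ sg = -1 -> fcj g = g ->
  fnonneg (map_poly (fsub sg e) f).[g].

Lemma fnonneg_lead x n : fnonneg x -> fcoef x n != 0 ->
  (forall k, (k < n)%N -> fcoef x k = 0) -> 0 < fcoef x n.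
Proof.
case=> [->|[m [xm mx]]] xn nx; first by rewrite fcoef0 eqxx in xn.
have -> // : n = m.
case: (ltngtP n m) => // [/mx e|/nx e]; first by rewrite e eqxx in xn.
by rewrite e ltxx in xm.
Qed.

Lemma horner_perturb p x y N : (forall k, (k < N)%N -> fcoef (y - x) k = 0) ->
  forall k, (k < N)%N -> fcoef p.[y] k = fcoef p.[x] k.
Proof.
move=> yx k lt_kN; have : root (p - p.[x]%:P) x by rewrite /root !hornerE subrr.
case/factor_theorem => q /(congr1 (fun u => u.[y])); rewrite !hornerE => pyx.
apply/eqP; rewrite -subr_eq0 -fcoefB pyx fcoefM big1 // => i _.
by rewrite yx ?mulr0 // (leq_ltn_trans (leq_subr _ _)).
Qed.

Lemma fcj_const (a : C) : a^* = a -> fcj (fconst a) = fconst a.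
Proof. by move=> ra; apply: fps_ext => k; rewrite fcoef_map /= rmorphMn /= ra. Qed.
Lemma fcj_fX n : fcj (fX C n) = fX C n.
Proof. by apply: fps_ext => k; rewrite fcoef_map /= rmorph_nat. Qed.

(** A real root of a nonnegative polynomial is at least double: along [b + c * s ^ L.+1] the leading
    coefficient is [c] times that of [k.[b]], and it cannot be positive for both [c = 1] and
    [c = -1]. *)
Lemma fpsd_real_root f e (sg : C) b k : fpsd f -> sg = 1 \/ sg = -1 -> fcj b = b ->
  map_poly (fsub sg e) f = ('X - b%:P) * k -> k.[b] = 0.
Proof.
move=> fp sg1 rb fk; apply: contrapT => /eqP /fps_neq0P[L [kL Lk]].
have key (c : C) : c^* = c -> c != 0 -> 0 < c * fcoef k.[b] L.
  move=> rc c0; pose d := fconst c * fX C L.+1.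
  have dE j : fcoef d j = c *+ (j == L.+1) by rewrite fcoef_constM /= mulr_natr.
  have dlow j : (j < L.+1)%N -> fcoef (b + d - b) j = 0.
    by move=> lt_j; rewrite addrAC subrr add0r dE ltn_eqF.
  have rbd : fcj (b + d) = b + d.
    by rewrite rmorphD rmorphM /= rb fcj_const // fcj_fX.
  have := fp e sg _ sg1 rbd; rewrite fk hornerM !hornerE.
  have -> : b + d - b = d by rewrite addrAC subrr add0r.
  have kbd j : (j < L.+1)%N -> fcoef k.[b + d] j = fcoef k.[b] j.
    by apply: horner_perturb.
  move=> /(@fnonneg_lead _ (L.+1 + L)%N).
  have lead : fcoef (d * k.[b + d]) (L.+1 + L)%N = c * fcoef k.[b] L.
    rewrite fcoefM_lead ?kbd // ?dE ?eqxx //; first by move=> j h; rewrite dE ltn_eqF.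
    by move=> j lt_j; rewrite kbd ?Lk // ltnW.
  rewrite lead; apply.
  - by rewrite mulf_neq0.
  - move=> j lt_j; rewrite fcoefM big1 // => i _; rewrite dE.
    case: eqP => [iE|_]; last by rewrite mul0r.
    rewrite kbd iE; first by rewrite Lk ?mulr0 // ltn_subLR // -iE -ltnS.
    by rewrite ltn_subLR ?(leq_trans lt_j) ?leq_add2l // -iE -ltnS.
have := key 1 (rmorph1 _) (oner_neq0 _); have := key (-1).
rewrite rmorphN1 oppr_eq0 oner_eq0 => /(_ erefl isT).
by rewrite mulN1r mul1r oppr_gt0 => /lt_trans h /h; rewrite ltxx.
Qed.

Lemma fcj_horner (sg : C) e p x : sg^* = sg -> fcj x = x ->
  (map_poly (fsub sg e) (pcj p)).[x] = fcj (map_poly (fsub sg e) p).[x].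
Proof.
move=> rs rx; rewrite -{1}rx -[in RHS]horner_map; congr (_.[_]).
by apply/polyP => i; rewrite !coef_map /= fcj_sub rs.
Qed.

(** [p] may vanish along [g]. Moving [g] at an order [N > L], beyond the leading term of the value
    of [h], makes [p] nonzero and keeps that term; the value of [p * pcj p] then leads with a
    positive squared modulus. *)
Lemma fpsd_quotient p h : p != 0 -> fpsd (p * pcj p * h) -> fpsd h.
Proof.
move=> p0 fp e sg g sg1 rg; set q := map_poly (fsub sg e) h.
have sg0 : sg != 0 by case: sg1 => ->; rewrite ?oppr_eq0 oner_eq0.
have rsg : sg^* = sg by case: sg1 => ->; rewrite ?rmorphN1 ?rmorph1.
have [->|] := eqVneq q.[g] 0; first by left.
move=> /fps_neq0P[L [qL Lq]]; right; exists L; split=> //.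
pose ps := map_poly (fsub sg e) p.
have ps0 : ps != 0.
  by rewrite -size_poly_eq0 size_map_inj_poly ?rmorph0 ?size_poly_eq0 //; apply: fsub_inj.
have [N lt_LN pN] : exists2 N, (L < N)%N & ps.[g + fX C N] != 0.
  apply: contrapT => nex.
  pose rs := [seq g + fX C (L + i.+1) | i <- iota 0 (size ps)].
  have urs : uniq rs.
    rewrite map_inj_uniq ?iota_uniq // => i j /addrI.
    move/(congr1 (fun z => fcoef z (L + i.+1))) => /=; rewrite eqxx eqn_add2l eqSS.
    by case: eqP => // _ /eqP; rewrite oner_eq0.
  have rrs : all (root ps) rs.
    apply/allP => _ /mapP[i _ ->]; apply/eqP; apply: contrapT => /eqP nz; apply: nex.
    by exists (L + i.+1)%N => //; rewrite addnS ltnS leq_addr.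
  by have := max_poly_roots ps0 rrs urs; rewrite size_map size_iota ltnn.
have rgN : fcj (g + fX C N) = g + fX C N by rewrite rmorphD /= rg fcj_fX.
have := fp e sg _ sg1 rgN; rewrite !rmorphM /= !hornerM fcj_horner // -/ps -/q.
set a := ps.[_] in pN *; move/fps_neq0P: pN => [m [am ma]].
have qN j : (j < N)%N -> fcoef q.[g + fX C N] j = fcoef q.[g] j.
  apply: horner_perturb => k lt_kN.
  by rewrite addrAC subrr add0r /= ltn_eqF.
have aa : fcoef (a * fcj a) (m + m) = `|fcoef a m| ^+ 2.
  rewrite fcoefM_lead // ?fcoef_map ?normCK // => j lt_j.
  by rewrite fcoef_map ma // rmorph0.
have aa0 j : (j < m + m)%N -> fcoef (a * fcj a) j = 0.
  move=> lt_j; rewrite fcoefM big1 // => i _; have [lt_im|le_mi] := ltnP i m.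
    by rewrite ma // mul0r.
  have lt_ji : (j - i < m)%N.
    by rewrite ltn_subLR ?(leq_trans lt_j) ?leq_add2r // -ltnS.
  by rewrite fcoef_map [fcoef a (_ - _)]ma // rmorph0 mulr0.
move=> /(@fnonneg_lead _ (m + m + L)%N).
rewrite fcoefM_lead // ?aa ?qN //; last first.
  by move=> j lt_j; rewrite qN ?Lq // (ltn_trans lt_j).
have am2 : 0 < `|fcoef a m| ^+ 2 by rewrite exprn_gt0 // normr_gt0.
rewrite pmulr_rgt0 //; apply; first by rewrite mulf_neq0 // gt_eqF.
move=> j lt_j; rewrite fcoefM big1 // => i _; have [lt_im|le_mi] := ltnP i (m + m).
  by rewrite aa0 // mul0r.
have lt_jL : (j - i < L)%N.
  by rewrite ltn_subLR; [rewrite (leq_trans lt_j) // leq_add2r | rewrite -ltnS].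
by rewrite qN ?Lq ?mulr0 // (ltn_trans lt_jL).
Qed.

End LocalFactor.

Lemma map_prod_XsubC (A B : nzRingType) (g : {rmorphism A -> B}) rs :
  map_poly g (\prod_(a <- rs) ('X - a%:P)) = \prod_(a <- map g rs) ('X - a%:P).
Proof.
rewrite rmorph_prod big_map; apply: eq_bigr => a _.
by rewrite rmorphB /= map_polyX map_polyC.
Qed.

Lemma perm_eq_map_sub (T : eqType) (g : T -> T) (s : seq T) :
  injective g -> uniq s -> {subset map g s <= s} -> perm_eq (map g s) s.
Proof.
move=> gi us sub; have um : uniq (map g s) by rewrite map_inj_uniq.
apply: uniq_perm => //.
by have [] := uniq_min_size um sub; rewrite ?size_map.
Qed.

Section Factor.
Variable C : numClosedFieldType.
Implicit Types (x : fps C) (f p : {poly fps C}).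
Notation fcj := (fmap (@Num.conj C)).
Notation pcj := (map_poly fcj).
Notation ram e := (map_poly (fsub (1 : C) e)).

Lemma ram_inj e : injective (ram e : {poly fps C} -> {poly fps C}).
Proof. by apply: map_inj_poly; rewrite ?rmorph0 //; apply/fsub_inj/oner_neq0. Qed.

Lemma size_ram e f : size (ram e f) = size f.
Proof. by rewrite size_map_inj_poly ?rmorph0 //; apply/fsub_inj/oner_neq0. Qed.

Lemma fsub_ram (w : C) e x : fsub w 0 (fsub 1 e x) = fsub (w ^+ e.+1) e x.
Proof. by rewrite fsub_comp mul1r mul1n. Qed.

Lemma map_fsub_ram (w : C) e f : map_poly (fsub w 0) (ram e f) = map_poly (fsub (w ^+ e.+1) e) f.
Proof. by apply/polyP => i; rewrite !coef_map /= fsub_ram. Qed.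

(** Invariance under all [w] with [w ^ e.+1 = 1] leaves only exponents divisible by [e.+1], by
    [unity_roots_dvd]. *)
Lemma ram_descent e (mu : seq C) p :
  uniq mu -> size mu = e.+1 -> (forall w, (w \in mu) = (w ^+ e.+1 == 1)) ->
  (forall w, w \in mu -> map_poly (fsub w 0) p = p) -> exists p', p = ram e p'.
Proof.
move=> mu_uniq mu_size muP inv.
exists (\poly_(i < size p) Fps (fun k => fcoef p`_i (k * e.+1))).
apply/polyP => i; rewrite coef_map /= coef_poly.
case: ltnP => [_|/(nth_default 0) ->]; last by rewrite rmorph0.
apply: fps_ext => k; rewrite fcoef_sub expr1n mul1r /=.
case: ifP => [/divnK -> //|ndvd].
apply: contraFeq ndvd => pk0.
apply: (unity_roots_dvd mu_uniq mu_size muP) => // w /inv.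
move/(congr1 (fun q : {poly fps C} => fcoef q`_i k)).
rewrite coef_map fcoef_sub dvd1n divn1 => e1.
by apply: (mulIf pk0); rewrite mul1r.
Qed.

(** Division by a monic polynomial commutes with ramification: the ramified remainder is a multiple
    of [ram e p] of smaller degree, hence zero. *)
Lemma ram_dvd e p f Q : p \is monic -> ram e f = Q * ram e p -> exists h, f = h * p.
Proof.
move=> pm fE; exists (Pdiv.Ring.rdivp f p).
have fd := Pdiv.RingMonic.rdivp_eq pm f.
rewrite [LHS]fd; suff -> : Pdiv.Ring.rmodp f p = 0 by rewrite addr0.
set r := Pdiv.Ring.rmodp f p in fd *; set q := Pdiv.Ring.rdivp f p in fd *.
have sr : (size r < size p)%N by rewrite Pdiv.Ring.ltn_rmodp monic_neq0.
have rE : ram e r = (Q - ram e q) * ram e p.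
  by move: fE; rewrite {1}fd rmorphD rmorphM /= mulrBl => <-; rewrite addrAC subrr add0r.
have [d0|d0] := eqVneq (Q - ram e q) 0.
  by apply: (@ram_inj e); rewrite rE d0 mul0r rmorph0.
have pm' : ram e p \is monic by apply: monic_map.
have := congr1 (size \o val) rE; rewrite /= size_ram size_Mmonic // size_ram => sz.
have : size (Q - ram e q) != 0%N by rewrite size_poly_eq0.
move: sr; rewrite sz; case: (size (Q - ram e q)) => // n.
by rewrite addSn /= ltnNge leq_addl.
Qed.

Lemma norm_unity_root (z : C) n : (0 < n)%N -> z ^+ n = 1 -> `|z| = 1.
Proof.
move=> n0 /(congr1 Num.norm); rewrite normrX normr1 => /eqP.
by rewrite pexpr_eq1 // => /eqP.
Qed.

(* The orbit of a Puiseux root [a] under [s |-> w * s], [w] a root of unity, has a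
   product [ph] that descends to a power series polynomial [p].  If the conjugate
   of [a] is outside of the orbit, [p * pcj p] divides [f].  Otherwise a twist [b]
   of [a] is real, and nonnegativity forces [p] to divide [f] twice. *)
Lemma local_factor_step f : f \is monic -> (1 < size f)%N -> pcj f = f -> fpsd f ->
  exists p h, [/\ p \is monic, (1 < size p)%N & f = p * pcj p * h].
Proof.
move=> fm sf rf fp; have [e [a ra]] := puiseux fm sf.
have [mu [mu_uniq mu_size muP]] := @unity_roots_seq C e.+1 isT.
have mu0 w : w \in mu -> w != 0.
  rewrite muP => /eqP we; apply: contra_eq_neq we => ->.
  by rewrite expr0n /= eq_sym oner_neq0.
have mu1 w : w \in mu -> w ^+ e.+1 = 1 by rewrite muP => /eqP.
set F := ram e f in ra.
have Fw w : w \in mu -> map_poly (fsub w 0) F = F.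
  by move=> /mu1 w1; rewrite map_fsub_ram w1.
have fsubM (v w : C) x : fsub v 0 (fsub w 0 x) = fsub (w * v) 0 x.
  by rewrite fsub_comp.
pose rs := undup [seq fsub w 0 a | w <- mu].
have rsP x : reflect (exists2 w, w \in mu & x = fsub w 0 a) (x \in rs).
  by rewrite mem_undup; apply: mapP.
have mu_mul v w : v \in mu -> w \in mu -> w * v \in mu.
  by rewrite !muP exprMn => /eqP-> /eqP->; rewrite mulr1.
have mu_one : 1 \in mu by rewrite muP expr1n.
have mu_conj w : w \in mu -> w^* \in mu.
  by rewrite !muP -rmorphXn => /eqP->; rewrite rmorph1.
have mu_inv w : w \in mu -> w^* * w = 1.
  by move=> /mu1/norm_unity_root => /(_ isT) n1; rewrite mulrC -normCK n1 expr1n.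
have a_rs : a \in rs by apply/rsP; exists 1; rewrite ?fsub1.
have rsw w x : w \in mu -> x \in rs -> fsub w 0 x \in rs.
  by move=> wmu /rsP[v vmu ->]; rewrite fsubM; apply/rsP; exists (v * w); rewrite // mu_mul.
have root_w w x : w \in mu -> root F x -> root F (fsub w 0 x).
  by move=> wmu rx; rewrite -(Fw w wmu) /root horner_map (rootP rx) rmorph0.
have rs_root : all (root F) rs by apply/allP => _ /rsP[w wmu ->]; apply: root_w.
have urs : uniq rs by apply: undup_uniq.
pose ph := \prod_(b <- rs) ('X - b%:P).
have phw w : w \in mu -> map_poly (fsub w 0) ph = ph.
  move=> wmu; rewrite map_prod_XsubC; apply: perm_big; apply: perm_eq_map_sub => //.
    exact/fsub_inj/mu0.
  by move=> _ /mapP[x xrs ->]; apply: rsw.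
have [p phE] := ram_descent mu_uniq mu_size muP phw.
have phm : ph \is monic by apply: monic_prod_XsubC.
have pm : p \is monic.
  have := phm; rewrite phE !monicE lead_coef_map_inj ?rmorph0 //; last exact/fsub_inj/oner_neq0.
  move/eqP => lc1; apply/eqP/(@fsub_inj C 1 e (oner_neq0 _)); rewrite lc1.
  by rewrite rmorph1.
have sp : (1 < size p)%N.
  rewrite -(size_ram e) -phE size_prod_XsubC ltnS.
  by rewrite lt0n size_eq0; apply/eqP => rs0; rewrite rs0 in a_rs.
have pcm : pcj p \is monic by apply: monic_map.
have ram_cj g : ram e (pcj g) = pcj (ram e g).
  by apply/polyP => i; rewrite !coef_map /= fcj_sub rmorph1.
have rF : pcj F = F by rewrite -ram_cj rf.
have root_cj x : root F x -> root F (fcj x).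
  by move=> rx; rewrite -rF /root horner_map (rootP rx) rmorph0.
have pchE : ram e (pcj p) = \prod_(b <- map fcj rs) ('X - b%:P).
  by rewrite ram_cj -phE map_prod_XsubC.
have fcj_inj : injective (fcj : fps C -> fps C) := can_inj (@fcjK C).
have [/rsP[z zmu az]|caN] := boolP (fcj a \in rs); last first.
  have urs2 : uniq (rs ++ map fcj rs).
    rewrite cat_uniq urs map_inj_uniq // urs andbT /=.
    apply/hasPn => _ /mapP[_ /rsP[w wmu ->] ->]; apply: contra caN.
    by rewrite fcj_sub => /(rsw w _ wmu); rewrite fsubM mu_inv // fsub1.
  have rts2 : all (root F) (rs ++ map fcj rs).
    rewrite all_cat rs_root /=; apply/allP => _ /mapP[x xrs ->].
    exact/root_cj/(allP rs_root).
  have [Q FE] := dvdp_uniq_roots urs2 rts2.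
  have [h fE] : exists h, f = h * (p * pcj p).
    apply: (@ram_dvd e _ _ Q); first by rewrite monicMl.
    by rewrite -/F FE big_cat /= rmorphM /= pchE -phE.
  by exists p, h; rewrite mulrC.
have pcE : pcj p = p.
  apply: (@ram_inj e); rewrite pchE -phE; apply: perm_big.
  apply: perm_eq_map_sub => // _ /mapP[_ /rsP[w wmu ->] ->].
  by rewrite fcj_sub az; apply: rsw; [exact: mu_conj | apply/rsP; exists z].
have [Q FE] := dvdp_uniq_roots urs rs_root.
have [h fE] : exists h, f = h * p by apply: (@ram_dvd e _ _ Q) => //; rewrite -phE.
have QE : Q = ram e h.
  have : F = ram e h * ph by rewrite /F fE rmorphM /= -phE.
  by rewrite {1}FE; apply: mulIf; rewrite monic_neq0.
(* [z] records how conjugation moves [a], and twisting by a square root of [z] makes [b] fixed by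
   conjugation. As [z ^ e.+1 = 1], [sg] is only a sign; this is why [fpsd] tests both signs of
   [s]. *)
pose w := sqrtC z; pose b := fsub w 0 a; pose sg := w ^+ e.+1.
have w2 : w ^+ 2 = z by apply: sqrtCK.
have wc : w^* * w = 1.
  rewrite mulrC -normCK (@norm_unity_root w (2 * e.+1)) ?expr1n //.
  by rewrite exprM w2 mu1.
have w0 : w != 0 by apply: contra_eq_neq wc => ->; rewrite mulr0 eq_sym oner_neq0.
have sg1 : sg = 1 \/ sg = -1.
  have : sg ^+ 2 == 1 by rewrite /sg -exprM mulnC exprM w2 mu1.
  by rewrite sqrf_eq1 => /orP[]/eqP; [left | right].
have rb : fcj b = b.
  by rewrite /b fcj_sub az fsubM -w2 expr2 -mulrA [w * w^*]mulrC wc mulr1.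
pose R := \prod_(x <- rem a rs) ('X - x%:P).
have phR : ph = ('X - a%:P) * R by rewrite /ph (perm_big _ (perm_to_rem a_rs)) big_cons.
have Fsg : map_poly (fsub sg e) f = ('X - b%:P) * map_poly (fsub w 0) (R * Q).
  rewrite -map_fsub_ram -/F FE -/ph phR mulrC -mulrA rmorphM /=.
  by rewrite rmorphB /= map_polyX map_polyC.
have := fpsd_real_root fp sg1 rb Fsg.
rewrite horner_map /= -(rmorph0 (fsub w 0)) => /(fsub_inj w0)/eqP.
rewrite hornerM mulf_eq0 -[R.[a] == 0]/(root R a) root_prod_XsubC mem_rem_uniq //.
rewrite inE eqxx /= => Qa.
have Q_root : all (root Q) rs.
  apply/allP => _ /rsP[v vmu ->].
  have <- : map_poly (fsub v 0) Q = Q by rewrite QE map_fsub_ram mu1.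
  by rewrite /root horner_map (eqP Qa) rmorph0.
have [Q2 Q2E] := dvdp_uniq_roots urs Q_root.
have [h2 h2E] : exists h2, h = h2 * p.
  by apply: (@ram_dvd e _ _ Q2) => //; rewrite -phE -QE.
by exists p, h2; split=> //; rewrite pcE fE h2E; ring.
Qed.

Theorem local_factor f : f \is monic -> pcj f = f -> fpsd f ->
  exists p, p \is monic /\ f = p * pcj p.
Proof.
have [N] := ubnP (size f); elim: N f => // N IH f; rewrite ltnS => sfN fm rf fp.
have [sf|sf] := leqP (size f) 1.
  exists 1; split; first exact: monic1.
  rewrite rmorph1 mulr1 (size1_polyC sf); move/monicP: fm.
  by rewrite {1}(size1_polyC sf) lead_coefC => ->.
have [p [h [pm sp fE]]] := local_factor_step fm sf rf fp.
have pcm : pcj p \is monic by apply: monic_map.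
have ppm : p * pcj p \is monic by rewrite monicMl.
have hm : h \is monic by move: fm; rewrite fE monicMl.
have rh : pcj h = h.
  apply: (mulfI (monic_neq0 ppm)); rewrite -fE -[RHS]rf fE !rmorphM /= pcjK.
  by rewrite [pcj p * p]mulrC.
have hp : fpsd h by apply: (@fpsd_quotient _ p); rewrite -?fE // monic_neq0.
have [|g [gm hE]] := IH h _ hm rh hp.
  apply: leq_trans sfN; rewrite fE size_monicM ?monic_neq0 //.
  rewrite size_monicM ?monic_neq0 //.
  have : (0 < size h)%N by rewrite lt0n size_poly_eq0 monic_neq0.
  by rewrite size_pcj; move: sp; lia.
exists (p * g); split; first by rewrite monicMl.
by rewrite fE {1}hE rmorphM mulrACA.
Qed.
End Factor.

(** * Polynomials whose leading coefficient is a positive unit *)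

Section LeadFactor.
Variable C : numClosedFieldType.
Implicit Types (x y : fps C) (f p : {poly fps C}).
Notation fcj := (fmap (@Num.conj C)).
Notation pcj := (map_poly fcj).

Lemma fnonneg_cst x : 0 < fcst x -> fnonneg x.
Proof. by right; exists 0%N. Qed.

Lemma fnonnegM x y : fnonneg x -> fnonneg y -> fnonneg (x * y).
Proof.
case=> [->|[m [xm mx]]]; first by rewrite mul0r; left.
case=> [->|[n [yn ny]]]; first by rewrite mulr0; left.
right; exists (m + n)%N; split; first by rewrite fcoefM_lead // mulr_gt0.
move=> k lt_k; rewrite fcoefM big1 // => i _; have [lt_im|le_mi] := ltnP i m.
  by rewrite mx // mul0r.
have lt_ki : (k - i < n)%N.
  by rewrite ltn_subLR ?(leq_trans lt_k) ?leq_add2r // -ltnS.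
by rewrite (ny _ lt_ki) mulr0.
Qed.

Lemma fcst_sub (c : C) e x : fcst (fsub c e x) = fcst x.
Proof. by rewrite /fcst fcoef_sub dvdn0 div0n expr0 mul1r. Qed.

Lemma fcst_fcj x : fcst (fcj x) = (fcst x)^*.
Proof. by []. Qed.

Lemma real_sqr_ge0 (a : C) : a^* = a -> 0 <= a ^+ 2.
Proof. by move=> ra; rewrite expr2 -{2}ra -normCK exprn_ge0. Qed.

(** ['X^2 + a] is nonnegative, so [local_factor] writes it as a monic linear polynomial times its
    conjugate; [a] is read off the constant coefficients. *)
Lemma fps_pos_norm a : fcj a = a -> 0 < fcst a -> exists c, a = c * fcj c.
Proof.
move=> ra a0; have sX : size ('X^2 + a%:P) = 3 by rewrite size_XnaddC.
have [|||p [pm pE]] := @local_factor C ('X^2 + a%:P).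
- by rewrite monicE lead_coefXnaddC.
- by rewrite rmorphD rmorphXn /= map_polyX map_polyC /= ra.
- move=> e sg g sg1 rg; apply: fnonneg_cst.
  rewrite rmorphD rmorphXn /= map_polyX map_polyC /= !hornerE.
  rewrite rmorphD rmorphXn /= fcst_sub ltr_wpDl //.
  by apply: real_sqr_ge0; rewrite -fcst_fcj rg.
have spc := size_pcj p.
have sp : size p = 2.
  move: sX; rewrite pE size_monicM ?spc //; last first.
    by rewrite -size_poly_eq0 spc size_poly_eq0 monic_neq0.
  by rewrite addnn; case: (size p) => [|[|[|m]]].
have p1 : p`_1 = 1 by move/monicP: pm; rewrite lead_coefE sp.
exists p`_0; have := congr1 (fun q : {poly fps C} => q`_0) pE.
by rewrite coefD coefXn coefC add0r coefM big_ord_recl big_ord0 addr0 coef_map.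
Qed.

Theorem lead_factor f : pcj f = f -> fpsd f -> 0 < fcst (lead_coef f) ->
  exists p, f = p * pcj p.
Proof.
move=> rf fp a0; set a := lead_coef f in a0.
have ra : fcj a = a by rewrite /a -{2}rf lead_coef_map_inj ?rmorph0 //; apply: can_inj (@fcjK C).
have [u ua] : exists u, u * a = 1 by apply: fps_unit_cst; rewrite gt_eqF.
have ru : fcj u = u.
  have u0 : a != 0 by apply: contraTneq a0 => ->; rewrite rmorph0 ltxx.
  by apply: (mulIf u0); rewrite ua -[in LHS]ra -rmorphM ua rmorph1.
have u0 : 0 < fcst u.
  by rewrite -(pmulr_lgt0 _ a0) -rmorphM ua rmorph1 ltr01.
have [|||p [pm pE]] := @local_factor C (u *: f).
- by rewrite monicE lead_coefZ ua.
- by rewrite map_polyZ rf /= ru.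
- move=> e sg g sg1 rg; rewrite map_polyZ hornerZ; apply: fnonnegM; last exact: fp.
  by apply: fnonneg_cst; rewrite /= fcst_sub.
have [c cE] := fps_pos_norm ra a0.
exists (c *: p); rewrite map_polyZ -scalerAl -scalerAr scalerA -cE -pE scalerA.
by rewrite mulrC ua scale1r.
Qed.
End LeadFactor.

(** * Polynomials on the real line *)

Section RealPoly.
Variable R : realType.
Notation C := R[i].
Local Open Scope complex_scope.

Lemma poly_nat_eq0 (F : numDomainType) (p : {poly F}) :
  (forall n : nat, p.[n%:R] = 0) -> p = 0.
Proof.
move=> p0; apply/eqP; apply: contraT => pn0.
have := @max_poly_roots _ p [seq n%:R | n <- iota 0 (size p)] pn0.
rewrite size_map size_iota ltnn; apply.
  by apply/allP => _ /mapP[n _ ->]; apply/eqP.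
by rewrite map_inj_uniq ?iota_uniq // => m n /eqP; rewrite eqr_nat => /eqP.
Qed.

Lemma poly_real_eq (bad : seq R) (p q : {poly C}) :
  (forall y : R, y \notin bad -> p.[y%:C] = q.[y%:C]) -> p = q.
Proof.
move=> pq; apply/eqP; rewrite -subr_eq0.
have nz : \prod_(b <- bad) ('X - (b%:C)%:P) != 0 :> {poly C}.
  by apply: monic_neq0; apply: rpred_prod => b _; apply: monicXsubC.
have [//|h] := boolP (p - q == 0).
have : (p - q) * \prod_(b <- bad) ('X - (b%:C)%:P) = 0.
  apply: poly_nat_eq0 => n; rewrite hornerM; have [nb|nb] := boolP ((n%:R : R) \in bad).
    rewrite (big_rem _ nb) /= [X in _ * X]hornerM hornerXsubC rmorph_nat subrr.
    by rewrite mul0r mulr0.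
  by rewrite hornerD hornerN -(rmorph_nat (real_complex R)) /= pq // subrr mul0r.
by move/eqP; rewrite mulf_eq0 (negPf h) (negPf nz).
Qed.

Lemma horner_conj (p : {poly C}) (y : R) :
  (map_poly Num.conj p).[y%:C] = Num.conj p.[y%:C].
Proof.
have {1}<- : Num.conj y%:C = y%:C by apply/CrealP; rewrite complex_real.
by rewrite horner_map.
Qed.

Lemma poly_real_conj (bad : seq R) (p : {poly C}) :
  (forall y : R, y \notin bad -> p.[y%:C] \is Num.real) -> map_poly Num.conj p = p.
Proof.
move=> rp; apply: (@poly_real_eq bad) => y yb.
by rewrite horner_conj (CrealP _) ?rp.
Qed.

Definition Repoly (p : {poly C}) : {poly R} := map_poly (@complex.Re R) p.

Lemma RepolyK (p : {poly C}) : map_poly Num.conj p = p ->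
  map_poly (real_complex R) (Repoly p) = p.
Proof.
move=> rp; apply/polyP => i; rewrite coef_map coef_map_id0 //=.
apply: RRe_real; apply/CrealP; by rewrite -{2}rp coef_map.
Qed.

Lemma horner_Repoly (p : {poly C}) y : map_poly Num.conj p = p ->
  p.[y%:C] = ((Repoly p).[y])%:C.
Proof. by move=> /RepolyK {1}<-; rewrite horner_map. Qed.

Lemma poly_right_ge0 (q : {poly R}) (x d : R) : 0 < d ->
  (forall s, x < s -> s < x + d -> 0 <= q.[s]) -> 0 <= q.[x].
Proof.
move=> d0 qs; rewrite leNgt; apply/negP => qx.
have nqx : 0 < - q.[x] by rewrite oppr_gt0.
have [e e0 qe] := poly_cont x q nqx.
pose s := x + Num.min d e / 2.
have m0 : 0 < Num.min d e by rewrite lt_min d0 e0.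
have md : Num.min d e <= d by rewrite ge_min lexx.
have me : Num.min d e <= e by rewrite ge_min lexx orbT.
have q1 : 0 <= q.[s] by apply: qs; rewrite /s; lra.
have : `|q.[s] - q.[x]| < - q.[x].
  apply: qe; rewrite /s addrAC subrr add0r ger0_norm; lra.
rewrite ger0_norm; lra.
Qed.

Lemma right_gap (bad : seq R) (x : R) :
  exists2 d, 0 < d & forall s, x < s -> s < x + d -> s \notin bad.
Proof.
elim: bad => [|b bad [d d0 dP]]; first by exists 1.
have [xb|bx] := ltP x b.
  exists (Num.min d (b - x)); first by rewrite lt_min d0 subr_gt0.
  move=> s xs; rewrite -ltrBlDl lt_min => /andP[h1 h2]; rewrite inE negb_or.
  by rewrite dP // ?andbT; [rewrite lt_eqF //; lra | lra].
exists d => // s xs sd; rewrite inE negb_or dP // andbT gt_eqF //; lra.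
Qed.

Lemma poly_nonneg_except (bad : seq R) (p : {poly C}) :
  (forall y : R, y \notin bad -> 0 <= p.[y%:C]) -> forall y : R, 0 <= p.[y%:C].
Proof.
move=> pp y; have rp : map_poly Num.conj p = p.
  by apply: (@poly_real_conj bad) => s /pp; apply: ger0_real.
have [d d0 dP] := right_gap bad y.
rewrite horner_Repoly // lecR; apply: (poly_right_ge0 d0) => s ys sd.
by rewrite -lecR -horner_Repoly // pp // dP.
Qed.

Lemma poly_nonneg_lead (p : {poly C}) L : (forall s : R, 0 <= p.[s%:C]) ->
  (forall k, (k < L)%N -> p`_k = 0) -> p`_L != 0 -> 0 < p`_L.
Proof.
move=> pp p0 pL; rewrite lt_def pL /=.
pose q := \poly_(i < size p) p`_(i + L).
have pE : p = 'X^L * q.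
  apply/polyP => i; rewrite coefXnM; case: ltnP => [/p0 //|le_Li].
  rewrite coef_poly subnK //; case: ltnP => // h.
  by rewrite nth_default // (leq_trans h) // leq_subr.
have -> : p`_L = q.[0].
  by rewrite horner_coef0 pE coefXnM ltnn subnn.
have qs (s : R) : 0 < s -> 0 <= q.[s%:C].
  move=> s0; have := pp s; rewrite pE hornerM hornerXn pmulr_rge0 //.
  by rewrite exprn_gt0 // (ltcR 0).
have rq : map_poly Num.conj q = q.
  have rp : map_poly Num.conj p = p.
    by apply: (@poly_real_conj [::]) => s _; apply: ger0_real.
  apply/polyP => i; rewrite coef_map /= !coef_poly; case: ifP => _; last by rewrite conjC0.
  by rewrite -{2}rp coef_map.
rewrite -(rmorph0 (real_complex R)) horner_Repoly // lecR.
apply: (@poly_right_ge0 _ _ 1) => // s s0 _.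
by rewrite -lecR -horner_Repoly // qs.
Qed.

End RealPoly.

(** * Polynomials as power series, and local sums of squares *)

Section PolyToFps.
Variable K : fieldType.
Definition fpol (p : {poly K}) : fps K := Fps (fun k => p`_k).
Lemma fcoef_pol p k : fcoef (fpol p) k = p`_k. Proof. by []. Qed.
Lemma fpol_is_additive : zmod_morphism fpol.
Proof. by move=> p q; apply: fps_ext => k; rewrite fcoefB !fcoef_pol coefB. Qed.
Lemma fpol_is_multiplicative : monoid_morphism fpol.
Proof.
split=> [|p q]; apply: fps_ext => k; first by rewrite fcoef_pol coef1.
by rewrite fcoef_pol coefM fcoefM.
Qed.
HB.instance Definition _ := GRing.isZmodMorphism.Build _ _ fpol fpol_is_additive.
HB.instance Definition _ := GRing.isMonoidMorphism.Build _ _ fpol fpol_is_multiplicative.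
Lemma fpol_inj : injective fpol.
Proof. by move=> p q e; apply/polyP => i; rewrite -!fcoef_pol e. Qed.
Lemma fcst_pol p : fcst (fpol p) = p.[0].
Proof. by rewrite horner_coef0. Qed.

Lemma fpol_comp (c : K) e (p : {poly K}) : fpol (p \Po (c *: 'X^(e.+1))) = fsub c e (fpol p).
Proof.
have -> : c *: 'X^(e.+1) = (c *: 'X) \Po 'X^(e.+1) by rewrite comp_polyZ comp_polyX.
apply: fps_ext => k; rewrite fcoef_pol comp_polyA coef_comp_poly_Xn // coef_scaleX.
by rewrite fcoef_sub.
Qed.
End PolyToFps.

(* the polynomial [F(z, .)] in the second variable *)
Definition fib (K : comNzRingType) (F : {poly {poly K}}) (z : K) : {poly K} :=
  map_poly (horner_eval z) F.

Section LocalSos.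
Variable R : realType.
Notation C := R[i].
Local Open Scope complex_scope.
Notation fcj := (fmap (@Num.conj C)).
Notation pcj := (map_poly fcj).

Lemma coef_fib (F : {poly {poly C}}) z i : (fib F z)`_i = (F`_i).[z].
Proof. by rewrite coef_map. Qed.

Lemma conj_RC (y : R) : Num.conj y%:C = y%:C.
Proof. by apply/CrealP; rewrite complex_real. Qed.

(** Truncating the real series [g] beyond the order [L] of the value turns the branch into a
    polynomial arc through real points, where [F] is nonnegative, without changing the leading
    coefficient. *)
Lemma fpsd_poly (F : {poly {poly C}}) :
  (forall t y : R, 0 <= (fib F t%:C).[y%:C]) -> fpsd (map_poly (@fpol C) F).
Proof.
move=> F0 e sg g sg1 rg; set X := _.[g].
have [->|] := eqVneq X 0; first by left.
move=> /fps_neq0P[L [XL LX]]; right; exists L; split=> //.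
pose g' := ftrunc L.+1 g.
pose Y := (map_poly (comp_poly (sg *: 'X^(e.+1))) F).[g'].
have YX k : (k < L.+1)%N -> Y`_k = fcoef X k.
  move=> lt_k; rewrite -fcoef_pol -(horner_map (@fpol C)).
  have -> : map_poly (@fpol C) (map_poly (comp_poly (sg *: 'X^(e.+1))) F) =
    map_poly (fsub sg e) (map_poly (@fpol C) F).
    by apply/polyP => i; rewrite !coef_map /= fpol_comp.
  rewrite /X; apply: (@horner_perturb C _ _ _ L.+1) => // j lt_j.
  by rewrite fcoefB fcoef_pol coef_ftrunc // subrr.
rewrite -YX //; apply: poly_nonneg_lead => [s|k lt_k|]; last 2 first.
- by rewrite YX ?LX // ltnW.
- by rewrite YX.
have -> : Y.[s%:C] = (fib F (sg * s%:C ^+ e.+1)).[g'.[s%:C]].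
  rewrite -[LHS]/(horner_eval s%:C Y) -horner_map; congr (_.[_]).
  apply/polyP => i; rewrite coef_fib !coef_map /= /horner_eval horner_comp.
  by rewrite !hornerE.
have [r ->] : exists r : R, sg * s%:C ^+ e.+1 = r%:C.
  case: sg1 => ->; [exists (s ^+ e.+1) | exists (- s ^+ e.+1)].
    by rewrite mul1r rmorphXn.
  by rewrite mulN1r rmorphN rmorphXn.
have [u ->] : exists u : R, g'.[s%:C] = u%:C.
  apply/complex_realP/CrealP; rewrite -horner_conj; congr (_.[_]).
  apply/polyP => i; rewrite coef_map /= /g' coef_poly; case: ifP => _; last exact: conjC0.
  by rewrite -{2}rg fcoef_map.
exact: F0.
Qed.

Lemma poly2_real_conj (F : {poly {poly C}}) :
  (forall t y : R, 0 <= (fib F t%:C).[y%:C]) -> pcj (map_poly (@fpol C) F) = map_poly (@fpol C) F.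
Proof.
move=> F0; suff rF i : map_poly Num.conj F`_i = F`_i.
  apply/polyP => i; rewrite !coef_map /=; apply: fps_ext => k.
  by rewrite fcoef_map !fcoef_pol -{2}rF coef_map.
apply: (@poly_real_conj _ [::]) => t _; rewrite -coef_fib; apply/CrealP.
have : map_poly Num.conj (fib F t%:C) = fib F t%:C.
  by apply: (@poly_real_conj _ [::]) => y _; apply: ger0_real.
by move=> e; rewrite -{2}e [RHS]coef_map.
Qed.

Theorem local_sos (F : {poly {poly C}}) :
  (forall t y : R, 0 <= (fib F t%:C).[y%:C]) -> 0 < (lead_coef F).[0] ->
  exists P, map_poly (@fpol C) F = P * pcj P.
Proof.
move=> F0 lc; apply: lead_factor; [exact: poly2_real_conj | exact: fpsd_poly |].
by rewrite lead_coef_map_inj ?rmorph0 //; [rewrite fcst_pol | exact: fpol_inj].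
Qed.

Lemma psd_lead_gt0 (q : {poly C}) : (forall y : R, 0 <= q.[y%:C]) -> q != 0 ->
  0 < lead_coef q.
Proof.
move=> q0 qn0; have rq : map_poly Num.conj q = q.
  by apply: (@poly_real_conj _ [::]) => y _; apply: ger0_real.
have lcE : lead_coef q = (lead_coef (Repoly q))%:C.
  by rewrite -{1}(RepolyK rq) lead_coef_map_inj ?rmorph0 //; apply: complexI.
rewrite lcE ltcR ltNge; apply/negP => lc0.
have lcn0 : lead_coef (Repoly q) != 0.
  by rewrite -(inj_eq (@complexI R)) -lcE rmorph0 lead_coef_eq0.
have lcN : 0 < lead_coef (- Repoly q) by rewrite lead_coefN oppr_gt0 lt_neqAle lcn0.
have [n nP] := poly_pinfty_gt_lc lcN.
have := nP n (lexx _); rewrite hornerN => h.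
have := q0 n; rewrite horner_Repoly // lecR leNgt; apply/negP/negPn.
by rewrite -oppr_gt0 (lt_le_trans lcN).
Qed.

(** This is [local_sos] for a polynomial that is constant in [s], read at [s = 0]. The size bound is
    what later controls the degree in [y] of the squares. *)
Theorem psd_poly_norm (q : {poly C}) : (forall y : R, 0 <= q.[y%:C]) ->
  exists p : {poly C}, (forall y : R, q.[y%:C] = `|p.[y%:C]| ^+ 2) /\
    forall d, (size q <= d.*2.+1)%N -> (size p <= d.+1)%N.
Proof.
move=> q0; have [->|qn0] := eqVneq q 0.
  by exists 0; split=> [y|d _]; rewrite ?size_poly0 // !horner0 normr0 expr0n.
have [|| P PE] := @local_sos (map_poly polyC q).
- move=> t y; have -> : fib (map_poly polyC q) t%:C = q.
    by apply/polyP => i; rewrite coef_fib coef_map /= hornerC.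
  exact: q0.
- rewrite lead_coef_map_inj ?rmorph0 //; last exact: polyC_inj.
  by rewrite hornerC psd_lead_gt0.
pose p := map_poly (@fcst C) P.
have qE : q = p * map_poly Num.conj p.
  have -> : q = map_poly (@fcst C) (map_poly (@fpol C) (map_poly polyC q)).
    by apply/polyP => i; rewrite !coef_map /= fcst_pol hornerC.
  rewrite PE rmorphM; congr (_ * _).
  by apply/polyP => i; rewrite !coef_map.
exists p; split=> [y|d]; first by rewrite qE hornerM horner_conj normCK.
have spc : size (map_poly Num.conj p) = size p.
  by rewrite size_map_inj_poly ?rmorph0 //; apply: can_inj (@conjCK C).
have pn0 : p != 0 by apply: contra_neq qn0 => p0; rewrite qE p0 mul0r.
rewrite qE size_mul // ?spc; last by rewrite -size_poly_eq0 spc size_poly_eq0.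
by rewrite addnn; case: (size p) => // n; rewrite doubleS /= !ltnS leq_double.
Qed.
End LocalSos.

Section FibTheory.
Variable K : comNzRingType.
Implicit Types (F G : {poly {poly K}}) (p : {poly K}).

Lemma fibD F G z : fib (F + G) z = fib F z + fib G z. Proof. exact: rmorphD. Qed.

Lemma fibB F G z : fib (F - G) z = fib F z - fib G z. Proof. exact: rmorphB. Qed.
Lemma fibM F G z : fib (F * G) z = fib F z * fib G z. Proof. exact: rmorphM. Qed.

Lemma fib0 z : fib (0 : {poly {poly K}}) z = 0. Proof. exact: rmorph0. Qed.

Lemma fibC p z : fib p%:P z = (p.[z])%:P. Proof. exact: map_polyC. Qed.
Lemma fibXX z : fib ('X : {poly {poly K}}) z = 'X. Proof. exact: map_polyX. Qed.
Lemma fib_map p z : fib (map_poly polyC p) z = p.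
Proof. by apply/polyP => i; rewrite !coef_map /= /horner_eval hornerC. Qed.

Lemma size_fib F z : (size (fib F z) <= size F)%N.
Proof. exact: size_poly. Qed.

Lemma horner_fibE F z y k j : (size F <= k)%N -> (forall i, (size (F`_i)%R <= j)%N) ->
  (fib F z).[y] = \sum_(a < k) \sum_(b < j) F`_a`_b * z ^+ b * y ^+ a.
Proof.
move=> sF sFi; rewrite (@horner_coef_wide _ k) ?(leq_trans (size_fib _ _)) //.
apply: eq_bigr => a _; rewrite coef_map /= /horner_eval (@horner_coef_wide _ j) //.
by rewrite mulr_suml.
Qed.
End FibTheory.

Lemma sum_ltn_minn N K : (\sum_(a < N) (a < K)%N = minn N K)%N.
Proof.
elim: N => [|N IH]; first by rewrite big_ord0 min0n.
rewrite big_ord_recr /= IH; case: (ltnP N K) => h /=; last by rewrite addn0 !minnE; lia.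
by rewrite !minnE; lia.
Qed.

Lemma sum_eqn_ltn (N m : nat) : (\sum_(a < N) (m == a)%N = (m < N)%N)%N.
Proof.
elim: N => [|N IH]; first by rewrite big_ord0.
by rewrite big_ord_recr /= IH ltnS; case: (ltngtP m N).
Qed.

(* the number of pairs [a, b < N] with [a - b = j - n] *)
Definition nshift (n N j : nat) : nat := (\sum_(a < N) \sum_(b < N) (j + b == n + a))%N.

(** These are the unnormalized Fejer weights [N - |j - n|], cut off at zero. *)
Lemma nshiftE n N j : nshift n N j = (N - maxn (j - n) (n - j))%N.
Proof.
rewrite /nshift; have key m : (\sum_(a < N) (m + a < N) = N - m)%N.
  transitivity (\sum_(a < N) (a < N - m)%N)%N; last by rewrite sum_ltn_minn; lia.
  by apply: eq_bigr => a _; congr nat_of_bool; apply/idP/idP; lia.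
have [le_nj|lt_jn] := leqP n j.
  rewrite exchange_big /= (_ : maxn _ _ = (j - n)%N); last lia.
  rewrite -key; apply: eq_bigr => b _; rewrite -sum_eqn_ltn.
  by apply: eq_bigr => a _; congr nat_of_bool; apply/eqP/eqP; lia.
rewrite (_ : maxn _ _ = (n - j)%N); last lia.
rewrite -key; apply: eq_bigr => b _; rewrite -sum_eqn_ltn.
by apply: eq_bigr => a _; congr nat_of_bool; apply/eqP/eqP; lia.
Qed.

(** * Laurent polynomials on the unit circle *)

Section Global.
Variable R : realType.
Notation C := R[i].
Local Open Scope complex_scope.
Implicit Types (F G : {poly {poly C}}) (z : C) (y : R).

(* the Laurent polynomial [z^-n F(z, y)]; with [z = x1 + i x2], these are the
   complex-valued polynomial functions on [V] *)
Definition lev n F z y : C := z ^- n * (fib F z).[y%:C].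

(** Since [|z| = 1], powers of [z] do not affect a modulus, so polynomials in [z] suffice inside the
    squares. The bound [d] on the degree in [y] is part of the notion because [sosd_mobius] must
    clear denominators in [y]. *)
Definition sosd d (f : C -> R -> C) := exists s : seq {poly {poly C}},
  (forall G, G \in s -> (size G <= d.+1)%N) /\
  forall z y, `|z| = 1 -> f z y = \sum_(G <- s) `|(fib G z).[y%:C]| ^+ 2.

Lemma sosd_ext d f g : (forall z y, `|z| = 1 -> f z y = g z y) -> sosd d f -> sosd d g.
Proof. by move=> fg [s [sd fs]]; exists s; split=> // z y z1; rewrite -fg ?fs. Qed.

Lemma sosdD d f g : sosd d f -> sosd d g -> sosd d (fun z y => f z y + g z y).
Proof.
move=> [s [sd fs]] [t [td gt]]; exists (s ++ t); split.
  by move=> G; rewrite mem_cat => /orP[/sd|/td].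
by move=> z y z1; rewrite big_cat /= fs ?gt.
Qed.

Lemma sosd_norm d G : (size G <= d.+1)%N -> sosd d (fun z y => `|(fib G z).[y%:C]| ^+ 2).
Proof.
move=> sG; exists [:: G]; split=> [H|z y z1]; last by rewrite big_seq1.
by rewrite inE => /eqP->.
Qed.

Lemma sosdMnorm d e G f : (size G <= e.+1)%N -> sosd d f ->
  sosd (e + d) (fun z y => `|(fib G z).[y%:C]| ^+ 2 * f z y).
Proof.
move=> sG [s [sd fs]]; exists [seq G * H | H <- s]; split.
  move=> _ /mapP[H /sd sH ->]; apply: (leq_trans (size_polyMleq _ _)).
  by have := leq_add sG sH; rewrite addSn addnS; case: (size G + size H)%N.
move=> z y z1; rewrite fs // big_map mulr_sumr; apply: eq_bigr => H _.
by rewrite fibM hornerM normrM exprMn.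
Qed.

Lemma circ_neq0 z : `|z| = 1 -> z != 0.
Proof. by move=> z1; rewrite -normr_eq0 z1 oner_neq0. Qed.
Lemma circ_conj z : `|z| = 1 -> Num.conj z = z^-1.
Proof.
move=> z1; apply: (mulfI (circ_neq0 z1)).
by rewrite mulfV ?circ_neq0 // -normCK z1 expr1n.
Qed.

(** Multiplication by a root of unity [v] permutes them, so the sum satisfies
    [S = v ^ p * v ^- q * S]; for distinct [p] and [q] below [L] some [v] makes the factor different
    from 1. *)
Lemma sum_unity_roots L (mu : seq C) p q :
  uniq mu -> size mu = L -> (forall w, (w \in mu) = (w ^+ L == 1)) ->
  (p < L)%N -> (q < L)%N ->
  \sum_(w <- mu) w ^+ p * w ^- q = ((p == q) * L)%:R.
Proof.
move=> umu smu muP lt_p lt_q; have L0 : (0 < L)%N by apply: leq_ltn_trans lt_p.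
have mu0 w : w \in mu -> w != 0.
  by rewrite muP => /eqP wL; apply: contra_eq_neq wL => ->; rewrite expr0n eqn0Ngt L0 eq_sym oner_eq0.
have [->|ne_pq] := eqVneq p q.
  rewrite big_seq (eq_bigr (fun=> 1)) => [|w /mu0 w0]; last by rewrite mulfV // expf_neq0.
  by rewrite -big_seq big_const_seq count_predT smu iter_addr_0 mul1n.
rewrite mul0n; set S := \sum_(w <- mu) _.
have [v vmu vpq] : exists2 v, v \in mu & v ^+ p != v ^+ q.
  apply: contrapT => nex.
  have pq w : w \in mu -> w ^+ p = w ^+ q.
    by move=> wmu; apply/eqP/negPn/negP => ne; apply: nex; exists w.
  wlog lt_pq : p q lt_p lt_q pq ne_pq {S nex} / (p < q)%N.
    move=> W; case: (ltngtP p q) => [|h|e]; first exact: (W p q).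
      by apply: (W q p) => //; [move=> w /pq | rewrite eq_sym].
    by rewrite e eqxx in ne_pq.
  have : (L %| q - p)%N.
    apply: (unity_roots_dvd umu smu muP L0) => w wmu.
    apply: (mulfI (expf_neq0 p (mu0 w wmu))).
    by rewrite -exprD subnKC ?(ltnW lt_pq) // mulr1 pq.
  by move/dvdn_leq; lia.
have SE : S = v ^+ p * v ^- q * S.
  rewrite /S -[LHS](perm_big _ (@perm_eq_map_sub _ (fun w => v * w) mu _ umu _)) /=; last 2 first.
  - exact/mulfI/mu0.
  - move=> _ /mapP[w wmu ->]; move: vmu wmu; rewrite !muP exprMn => /eqP-> /eqP->.
    by rewrite mulr1.
  rewrite big_map mulr_sumr; apply: eq_bigr => w _.
  by rewrite !exprMn invfM; ring.
apply/eqP; move/eqP: SE; rewrite -subr_eq0 -{1}[S]mul1r -mulrBl mulf_eq0 => /orP[|//].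
rewrite subr_eq0 => /eqP e; case/negP: vpq; apply/eqP.
have vq0 : v ^+ q != 0 by rewrite expf_neq0 ?mu0.
by apply: (mulIf (invr_neq0 vq0)); rewrite -e mulfV.
Qed.

End Global.

(** * Fejer kernels and strictly positive functions *)

Section Strict.
Variable R : realType.
Notation C := R[i].
Local Open Scope complex_scope.
Implicit Types (F G : {poly {poly C}}) (z : C) (y : R).

(** Together with the factor [z ^- n] of [lev], this restricts the Laurent exponents to the range
    from [-n] to [n]. *)
Definition degz n F := forall i, (size (F`_i)%R <= n.*2.+1)%N.

Lemma normRC (x : R) : `|x%:C| = `|x|%:C.
Proof. by rewrite normc_def /= expr0n addr0 sqrtr_sqr. Qed.

Lemma norm_exp_le (y : R) d k : (k <= d.*2)%N -> `|y| ^+ k <= (1 + y ^+ 2) ^+ d.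
Proof.
move=> le_kd; have y1 : 1 <= 1 + y ^+ 2 by rewrite lerDl sqr_ge0.
have [le_y1|lt_1y] := leP `|y| 1.
  apply: (@le_trans _ _ 1); first by rewrite exprn_ile1.
  by rewrite exprn_ege1.
apply: (@le_trans _ _ (`|y| ^+ d.*2)).
  by rewrite ler_eXn2l.
rewrite -muln2 mulnC exprM real_normK ?num_real //.
by rewrite lerXn2r ?nnegrE ?sqr_ge0 ?addr_ge0 ?ler01 ?sqr_ge0 // lerDr ler01.
Qed.

Definition csum n d F : R := \sum_(k < d.*2.+1) \sum_(j < n.*2.+1) complex.Re `|F`_k`_j|.

Lemma normRe (x : C) : (complex.Re `|x|)%:C = `|x|.
Proof. by rewrite RRe_real // normr_real. Qed.

Lemma csum_ge0 n d F : 0 <= csum n d F.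
Proof.
apply: sumr_ge0 => k _; apply: sumr_ge0 => j _.
by rewrite -lecR normRe normr_ge0.
Qed.

Lemma lev_wsum_le n d F (a : nat -> nat -> C) (e : R) z y : 0 <= e ->
  (forall k j, (k < d.*2.+1)%N -> (j < n.*2.+1)%N -> `|a k j| <= (e * complex.Re `|F`_k`_j|)%:C) ->
  `|z| = 1 ->
  `|z ^- n * \sum_(k < d.*2.+1) \sum_(j < n.*2.+1) a k j * z ^+ j * (y%:C) ^+ k| <=
  (e * csum n d F * (1 + y ^+ 2) ^+ d)%:C.
Proof.
move=> e0 ae z1; rewrite normrM normfV normrX z1 expr1n invr1 mul1r.
apply: (le_trans (ler_norm_sum _ _ _)); rewrite mulr_sumr mulr_suml rmorph_sum.
apply: ler_sum => k _; apply: (le_trans (ler_norm_sum _ _ _)).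
rewrite mulr_sumr mulr_suml rmorph_sum; apply: ler_sum => j _.
rewrite !normrM normrX z1 expr1n mulr1 rmorphM; apply: ler_pM => //.
  by apply: ae.
rewrite normrX normRC -rmorphXn lecR; apply: norm_exp_le.
by rewrite -ltnS.
Qed.

Lemma lev_bound n d F z y : (size F <= d.*2.+1)%N -> degz n F -> `|z| = 1 ->
  `|lev n F z y| <= (csum n d F * (1 + y ^+ 2) ^+ d)%:C.
Proof.
move=> sF dF z1; rewrite /lev (horner_fibE _ _ sF dF) -[csum n d F]mul1r.
apply: (@lev_wsum_le n d F (fun k j => F`_k`_j)) => // k j _ _.
by rewrite mul1r normRe.
Qed.

(* Fejer means: [F] is the average over the roots of unity [w] of
   [G(w, y) * `|D w (z)| ^ 2], where [G] is [F] with coefficients multiplied by [cf]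
   to compensate the kernel.  As [cf] tends to 1, [G] is still nonnegative, and
   each [G(w, _)] is a squared modulus. *)
Theorem strict_sos n d F (c : R) : 0 < c -> (size F <= d.*2.+1)%N -> degz n F ->
  (forall z y, `|z| = 1 -> (c * (1 + y ^+ 2) ^+ d)%:C <= lev n F z y) ->
  sosd d (lev n F).
Proof.
move=> c0 sF dF Fc.
pose S := csum n d F; have S0 : 0 <= S by apply: csum_ge0.
(* The factors [cf j] differ from 1 by at most [n / M], so this [M] keeps the change from [F] to [G]
   within the margin [c]. *)
pose M := (Num.bound (n%:R * S / c)).+1.
have M0 : 0 < M%:R :> R by rewrite ltr0n.
have MP : n%:R / M%:R * S <= c.
  have : n%:R * S / c < M%:R.
    apply: (lt_trans (archi_boundP _)); last by rewrite ltr_nat.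
    by rewrite mulr_ge0 ?invr_ge0 ?(ltW c0) // mulr_ge0 ?ler0n.
  by rewrite ltr_pdivrMr // mulrAC ler_pdivrMr // => /ltW; rewrite [c * _]mulrC.
(* [L] exceeds every exponent [j + b] and [n + a] below, so that the sum over the roots of unity
   detects equality of exponents and not merely congruence. *)
pose N := (n + M)%N; pose L := (n.*2.+1 + N)%N.
have L0 : (0 < L)%N by [].
have [mu [umu smu muP]] := @unity_roots_seq C L L0.
pose cf j : C := N%:R / (nshift n N j)%:R.
have nsM j : (j < n.*2.+1)%N -> (M <= nshift n N j)%N.
  by rewrite nshiftE /N; lia.
have nsN j : (nshift n N j <= N)%N by rewrite nshiftE leq_subr.
have ns0 j : (j < n.*2.+1)%N -> (nshift n N j)%:R != 0 :> C.
  by move=> /nsM h; rewrite pnatr_eq0 -lt0n (leq_trans _ h).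
have cfE j : (j < n.*2.+1)%N -> `|cf j - 1| <= (n%:R / M%:R)%:C.
  move=> ltj; have -> : cf j - 1 = (N - nshift n N j)%:R / (nshift n N j)%:R.
    by rewrite natrB // /cf mulrBl divff // ns0.
  rewrite ger0_norm ?mulr_ge0 ?invr_ge0 ?ler0n // fmorph_div !rmorph_nat.
  apply: ler_pM; rewrite ?invr_ge0 ?ler0n ?ler_nat //.
    by rewrite nshiftE /N; lia.
  by rewrite lef_pV2 ?posrE ?ltr0n ?ler_nat ?nsM // (leq_trans _ (nsM _ ltj)).
pose G := \poly_(k < d.*2.+1) \poly_(j < n.*2.+1) (F`_k`_j * cf j).
have sG : (size G <= d.*2.+1)%N by apply: size_poly.
have dG : degz n G.
  by move=> i; rewrite coef_poly; case: ifP => _; [exact: size_poly | rewrite size_poly0].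
have Gkj k j : (k < d.*2.+1)%N -> (j < n.*2.+1)%N -> G`_k`_j = F`_k`_j * cf j.
  by move=> hk hj; rewrite coef_poly hk coef_poly hj.
have GF z y : `|z| = 1 -> `|lev n G z y - lev n F z y| <= (c * (1 + y ^+ 2) ^+ d)%:C.
  move=> z1; rewrite /lev (horner_fibE _ _ sF dF) (horner_fibE _ _ sG dG) -mulrBr -sumrB.
  apply: (@le_trans _ _ (n%:R / M%:R * S * (1 + y ^+ 2) ^+ d)%:C); last first.
    by rewrite lecR ler_wpM2r // exprn_ge0 // addr_ge0 // sqr_ge0.
  have e0 : 0 <= n%:R / M%:R :> R by rewrite divr_ge0.
  rewrite (eq_bigr (fun k : 'I_d.*2.+1 => \sum_(j < n.*2.+1) (F`_k`_j * (cf j - 1)) * z ^+ j * y%:C ^+ k)); last first.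
    move=> k _; rewrite -sumrB; apply: eq_bigr => j _; rewrite Gkj //.
    by rewrite mulrBr mulr1 !mulrBl.
  apply: (@lev_wsum_le n d F (fun k j => F`_k`_j * (cf j - 1)) _ z y e0 _ z1).
  move=> k j hk hj; rewrite normrM mulrC rmorphM /= normRe ler_wpM2r //.
  exact: cfE.
pose D w : {poly C} := \poly_(a < N) w ^- a.
have DE w z : (D w).[z] = \sum_(a < N) w ^- a * z ^+ a by rewrite horner_poly.
have mu0 w : w \in mu -> w != 0.
  by rewrite muP => /eqP wL; apply: contra_eq_neq wL => ->; rewrite expr0n eq_sym oner_eq0.
have mu1 w : w \in mu -> `|w| = 1.
  by rewrite muP => /eqP/norm_unity_root; apply.
have D2 w z : w \in mu -> `|z| = 1 -> `|(D w).[z]| ^+ 2 =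
   \sum_(a < N) \sum_(b < N) (w ^- a * w ^+ b) * (z ^+ a * z ^- b).
  move=> wmu z1; rewrite normCK DE rmorph_sum mulr_suml; apply: eq_bigr => a _.
  rewrite mulr_sumr; apply: eq_bigr => b _.
  rewrite rmorphM /= fmorphV !rmorphXn /= (circ_conj (mu1 _ wmu)) (circ_conj z1) !exprVn invrK.
  by ring.
have main z y : `|z| = 1 ->
  \sum_(w <- mu) lev n G w y * `|(D w).[z]| ^+ 2 = (L * N)%:R * lev n F z y.
  move=> z1; have zn0 := circ_neq0 z1.
  rewrite {2}/lev (horner_fibE _ _ sF dF).
  transitivity (\sum_(w <- mu) \sum_(k < d.*2.+1) \sum_(j < n.*2.+1) \sum_(a < N) \sum_(b < N)
     (G`_k`_j * (y%:C) ^+ k * (z ^+ a * z ^- b)) * (w ^+ (j + b) * w ^- (n + a))).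
    rewrite big_seq [RHS]big_seq; apply: eq_bigr => w wmu.
    rewrite /lev (horner_fibE _ _ sG dG) D2 // -mulrA mulr_suml mulr_sumr.
    apply: eq_bigr => k _; rewrite mulr_suml mulr_sumr; apply: eq_bigr => j _.
    rewrite !mulr_sumr; apply: eq_bigr => a _; rewrite !mulr_sumr; apply: eq_bigr => b _.
    by rewrite !exprD invfM; ring.
  rewrite exchange_big /= !mulr_sumr; apply: eq_bigr => k _.
  rewrite exchange_big /= !mulr_sumr; apply: eq_bigr => j _.
  rewrite exchange_big /=.
  transitivity (\sum_(a < N) \sum_(b < N) (G`_k`_j * (y%:C) ^+ k * (z ^+ j * z ^- n)) *
      ((j + b == n + a)%N * L)%:R).
    apply: eq_bigr => a _; rewrite exchange_big /=; apply: eq_bigr => b _.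
    rewrite -mulr_sumr (sum_unity_roots umu smu muP) //; last 2 first.
    - by have := ltn_ord j; have := ltn_ord b; rewrite /L; lia.
    - by have := ltn_ord a; rewrite /L; lia.
    case: eqP => [e|_]; last by rewrite mul0n !mulr0.
    congr (_ * _ * _); apply: (mulIf (expf_neq0 b zn0)).
    rewrite mulfVK ?expf_neq0 // mulrAC -exprD e exprD mulrAC mulfV ?mul1r //.
    by rewrite expf_neq0.
  under eq_bigr => a _ do rewrite -mulr_sumr -natr_sum -big_distrl /=.
  rewrite -mulr_sumr -natr_sum -big_distrl /= -/(nshift n N j) Gkj // /cf !natrM.
  have h := ns0 _ (ltn_ord j).
  rewrite -[RHS]mulr1 -[X in _ = _ * X](mulfV h).
  by ring.
(* The real part of [lev n G w]. The average of these real parts is still [F], whose values on the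
   circle are real. *)
pose H w : {poly C} := 2^-1 *: (w ^- n *: fib G w + map_poly Num.conj (w ^- n *: fib G w)).
have HE w y : (H w).[y%:C] = 2^-1 * (lev n G w y + Num.conj (lev n G w y)).
  by rewrite hornerZ hornerD horner_conj hornerZ.
have levF_real w y : `|w| = 1 -> Num.conj (lev n F w y) = lev n F w y.
  move=> w1; apply/CrealP; apply: (@ger0_real _ (lev n F w y)); apply: le_trans (Fc w y w1).
  by rewrite lecR mulr_ge0 ?(ltW c0) // exprn_ge0 // addr_ge0 // sqr_ge0.
have two_neq0 : 2 != 0 :> C by rewrite pnatr_eq0.
have H0 w y : w \in mu -> 0 <= (H w).[y%:C].
  move=> /mu1 w1; rewrite HE; set u := lev n G w y; set v := lev n F w y.
  pose x := u - v; have -> : 2^-1 * (u + Num.conj u) = v + 2^-1 * (x + Num.conj x).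
    rewrite /x rmorphB /= [Num.conj v]levF_real //.
    have -> : u - v + (Num.conj u - v) = u + Num.conj u - 2 * v by ring.
    by rewrite mulrBr mulrA mulVf // mul1r addrCA subrr addr0.
  set r := 2^-1 * _; have rr : r \is Num.real.
    apply/CrealP; rewrite /r rmorphM rmorphD /= conjCK fmorphV /= rmorph_nat.
    by rewrite [Num.conj x + x]addrC.
  have rx : `|r| <= `|x|.
    rewrite /r normrM normfV normr_nat ler_pdivrMl ?ltr0n //.
    by apply: (le_trans (ler_normD _ _)); rewrite norm_conjC mulr_natl.
  have := GF w y w1; rewrite -/u -/v -/x => /(le_trans rx)/le_trans/(_ (Fc w y w1)) => rv.
  rewrite -/v in rv; rewrite -[r]opprK subr_ge0; apply: le_trans rv.
  by rewrite -normrN; apply: real_ler_norm; rewrite rpredN.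
have sH w : (size (H w) <= d.*2.+1)%N.
  apply: (leq_trans (size_scale_leq _ _)); apply: (leq_trans (size_polyD _ _)).
  rewrite geq_max; apply/andP; split; last apply: (leq_trans (size_poly _ _));
   by apply: (leq_trans (size_scale_leq _ _)); apply: (leq_trans (size_fib _ _)).
have /choice[q qP] : forall w, exists p : {poly C}, w \in mu ->
    (forall y, (H w).[y%:C] = `|p.[y%:C]| ^+ 2) /\ (size p <= d.+1)%N.
  move=> w; have [wmu|nw] := boolP (w \in mu); last by exists 0.
  have [p [pE pd]] := psd_poly_norm (H0 w ^~ wmu).
  by exists p => _; split=> //; apply: pd.
have LN0 : (L * N)%:R != 0 :> C by rewrite pnatr_eq0 muln_eq0 /L /N /M !addnS.
pose kap : C := sqrtC (L * N)%:R^-1.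
have kap2 : `|kap| ^+ 2 = (L * N)%:R^-1.
  by rewrite -normrX sqrtCK normfV normr_nat.
exists [seq map_poly polyC (q w) * (kap *: D w)%:P | w <- mu]; split.
  move=> _ /mapP[w wmu ->]; rewrite mulrC mul_polyC.
  apply: (leq_trans (size_scale_leq _ _)); apply: (leq_trans (size_poly _ _)).
  by have [_] := qP w wmu.
move=> z y z1; rewrite big_map.
apply: (mulfI LN0); rewrite mulr_sumr.
transitivity (\sum_(w <- mu) (H w).[y%:C] * `|(D w).[z]| ^+ 2).
  have mainc : \sum_(w <- mu) Num.conj (lev n G w y) * `|(D w).[z]| ^+ 2 = (L * N)%:R * lev n F z y.
    rewrite -(levF_real z y z1) -[(L * N)%:R](rmorph_nat (@Num.conj C)) -rmorphM /= -main //.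
    rewrite rmorph_sum; apply: eq_bigr => w _; rewrite [RHS]rmorphM.
    by congr (_ * _); apply/esym/CrealP/rpredX/normr_real.
  under eq_bigr => w _ do rewrite HE -mulrA mulrDl.
  rewrite -mulr_sumr big_split /= mainc main //.
  by field.
rewrite big_seq [RHS]big_seq; apply: eq_bigr => w wmu.
have [qE _] := qP w wmu.
rewrite qE fibM fib_map fibC hornerM hornerC hornerZ !normrM !exprMn kap2.
by rewrite [RHS]mulrCA [X in _ = _ * X]mulrA mulfV // mul1r.
Qed.
End Strict.

(** * Reflection of polynomials in the unit circle *)

Section Star.
Variable R : realType.
Notation C := R[i].
Local Open Scope complex_scope.
Implicit Types (F G : {poly {poly C}}) (z : C) (y : R) (p q : {poly C}).

Lemma circ_poly_eq p q : (forall z, `|z| = 1 -> p.[z] = q.[z]) -> p = q.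
Proof.
move=> pq; apply/eqP; rewrite -subr_eq0; apply: contraT => pq0.
have [mu [umu smu muP]] := @unity_roots_seq C (size (p - q)).+1 isT.
have rts : all (root (p - q)) mu.
  apply/allP => w; rewrite muP => /eqP/norm_unity_root => /(_ isT) w1.
  by rewrite /root hornerD hornerN pq // subrr.
by have := max_poly_roots pq0 rts umu; rewrite smu ltnNge leqnSn.
Qed.

(* on the unit circle, [z ^ N] times the conjugate of [p] *)
Definition star N p : {poly C} := \poly_(i < N.+1) Num.conj p`_(N - i).

Lemma size_star N p : (size (star N p) <= N.+1)%N.
Proof. exact: size_poly. Qed.

Lemma starB N p q : star N (p - q) = star N p - star N q.
Proof.
apply/polyP => i; rewrite coefB !coef_poly; case: ifP => _; last by rewrite subr0.
by rewrite coefB rmorphB.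
Qed.

Lemma horner_star N p z : (size p <= N.+1)%N -> `|z| = 1 ->
  (star N p).[z] = z ^+ N * Num.conj p.[z].
Proof.
move=> sp z1; rewrite horner_poly (horner_coef_wide _ sp) rmorph_sum mulr_sumr.
rewrite (reindex_inj rev_ord_inj) /=; apply: eq_bigr => i _.
have le_iN : (i <= N)%N by rewrite -ltnS.
rewrite subSS subKn // rmorphM rmorphXn /= (circ_conj z1) exprVn.
rewrite mulrCA; congr (_ * _).
apply: (mulIf (expf_neq0 i (circ_neq0 z1))).
by rewrite -exprD subnK // mulfVK // expf_neq0 // circ_neq0.
Qed.

Lemma starM N M p q : (size p <= N.+1)%N -> (size q <= M.+1)%N ->
  star (N + M) (p * q) = star N p * star M q.
Proof.
move=> sp sq; apply: circ_poly_eq => z z1; rewrite hornerM !horner_star //.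
  by rewrite hornerM rmorphM exprD; ring.
apply: (leq_trans (size_polyMleq _ _)).
by have := leq_add sp sq; rewrite addSn addnS; case: (size p + size q)%N.
Qed.

Definition starF N F : {poly {poly C}} := \poly_(i < size F) star N F`_i.

Lemma coef_starF N F i : (starF N F)`_i = star N F`_i.
Proof.
rewrite coef_poly; case: ltnP => // h; rewrite nth_default //.
apply/polyP => j; rewrite coef0 coef_poly; case: ifP => // _.
by rewrite coef0 conjC0.
Qed.

Definition zle N F := forall i, (size (F`_i)%R <= N.+1)%N.

Lemma fib_star N F z : zle N F -> `|z| = 1 ->
  fib (starF N F) z = z ^+ N *: map_poly Num.conj (fib F z).
Proof.
move=> zF z1; apply/polyP => i.
by rewrite coef_fib coef_starF horner_star // coefZ coef_map coef_fib.
Qed.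

Lemma fib_star_horner N F z y : zle N F -> `|z| = 1 ->
  (fib (starF N F) z).[y%:C] = z ^+ N * Num.conj (fib F z).[y%:C].
Proof. by move=> zF z1; rewrite fib_star // hornerZ horner_conj. Qed.

Lemma lev_norm N F z y : zle N F -> `|z| = 1 ->
  lev N (F * starF N F) z y = `|(fib F z).[y%:C]| ^+ 2.
Proof.
move=> zF z1; rewrite /lev fibM hornerM fib_star_horner // normCK.
by rewrite mulrCA mulKf ?expf_neq0 ?circ_neq0.
Qed.

Lemma fib_poly_eq F G : (forall z, `|z| = 1 -> fib F z = fib G z) -> F = G.
Proof.
move=> FG; apply/polyP => i; apply: circ_poly_eq => z z1.
by rewrite -!coef_fib FG.
Qed.

Lemma zle_exists F : exists N, zle N F.
Proof.
exists (\max_(i < size F) size (F`_i)%R)%N => i.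
have [lt_i|ge_i] := ltnP i (size F); last by rewrite nth_default ?size_poly0.
apply: leqW; exact: (@leq_bigmax _ (fun i : 'I_(size F) => size (F`_i)%R) (Ordinal lt_i)).
Qed.

Lemma zle_leq N M F : (N <= M)%N -> zle N F -> zle M F.
Proof. by move=> NM zF i; apply: (leq_trans (zF i)). Qed.

Lemma zleM N M F G : zle N F -> zle M G -> zle (N + M) (F * G).
Proof.
move=> zF zG i; rewrite coefM; apply: (leq_trans (size_sum _ _ _)).
apply/bigmax_leqP => j _; apply: (leq_trans (size_polyMleq _ _)).
by have := leq_add (zF j) (zG (i - j)%N); rewrite addSn addnS; case: (_ + _)%N.
Qed.

Lemma zleD N F G : zle N F -> zle N G -> zle N (F + G).
Proof.
move=> zF zG i; rewrite coefD; apply: (leq_trans (size_polyD _ _)).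
by rewrite geq_max zF zG.
Qed.

Lemma zleN N F : zle N F -> zle N (- F).
Proof. by move=> zF i; rewrite coefN size_polyN. Qed.

Lemma zle_polyC N p : (size p <= N.+1)%N -> zle N p%:P.
Proof. by move=> sp i; rewrite coefC; case: ifP; rewrite ?size_poly0. Qed.

Lemma zle_map N p : zle N (map_poly polyC p).
Proof. by move=> i; rewrite coef_map /= size_polyC (leq_trans (leq_b1 _)). Qed.

Lemma zle_starF N F : zle N (starF N F).
Proof. by move=> i; rewrite coef_starF size_star. Qed.

Lemma size_starF_le N F : (size (starF N F) <= size F)%N.
Proof. exact: size_poly. Qed.

Lemma starFM N M F G : zle N F -> zle M G ->
  starF (N + M) (F * G) = starF N F * starF M G.
Proof.
move=> zF zG; apply: fib_poly_eq => z z1.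
rewrite fibM !fib_star //; last exact: zleM.
by rewrite fibM rmorphM /= -scalerAl -scalerAr scalerA exprD.
Qed.

Lemma lev_shift n k F z y : `|z| = 1 -> lev (k + n) ('X^k%:P * F) z y = lev n F z y.
Proof.
move=> z1; rewrite /lev fibM fibC hornerXn hornerM hornerC exprD invfM.
by rewrite mulrACA mulVf ?mul1r // expf_neq0 // circ_neq0.
Qed.

Lemma lev_normalize a b F : exists n G, [/\ (size G <= size F)%N, degz n G &
  forall z y, `|z| = 1 -> lev n G z y = z ^+ a * z ^- b * (fib F z).[y%:C]].
Proof.
(* With [n = a + b + N], the exponent [a + (a + N)] is [n + a - b]; [N] leaves room for the degree
   of [F] in [z]. *)
have [N zF] := zle_exists F; exists (a + b + N)%N, ('X^(a + (a + N))%:P * F).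
split.
- by rewrite mul_polyC size_scale_leq.
- have : zle (a + (a + N) + N) ('X^(a + (a + N))%:P * F).
    by apply: zleM => //; apply: zle_polyC; rewrite size_polyXn.
  by apply: zle_leq; lia.
move=> z y z1; rewrite /lev fibM fibC hornerXn hornerM hornerC mulrA.
congr (_ * _); have zn k : z ^+ k != 0 by rewrite expf_neq0 // circ_neq0.
apply: (mulfI (zn (a + b + N)%N)); rewrite mulVKf //.
apply: (mulIf (zn b)); rewrite -!mulrA mulVf // mulr1 -!exprD; congr (_ ^+ _); lia.
Qed.

Definition psdV n F := forall z y, `|z| = 1 -> 0 <= lev n F z y.

End Star.

(** * Cayley charts *)

Section Chart.
Variable R : realType.
Notation C := R[i].
Notation I := (@Num.imaginary C).
Local Open Scope complex_scope.
Implicit Types (F : {poly {poly C}}) (z t P : C) (y : R) (q : {poly C}).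

Lemma horner_swap F z y : (fib F z).[y%:C] = (F.[(y%:C)%:P]).[z].
Proof.
by rewrite -[RHS]/(horner_eval z F.[(y%:C)%:P]) -horner_map /= /horner_eval hornerC.
Qed.

(* [q] in the coordinate [t] of [z = P (1 + i t) / (1 - i t)], which maps the real
   line to the circle without [- P], cleared of denominators *)
Definition chart n P q : {poly C} :=
  \sum_(k < n.*2.+1) (q`_k * P ^+ k * P ^- n) *: ((1 + I *: 'X) ^+ k * (1 - I *: 'X) ^+ (n.*2 - k)).

Lemma size_chart n P q : (size (chart n P q) <= n.*2.+1)%N.
Proof.
apply: (leq_trans (size_sum _ _ _)); apply/bigmax_leqP => k _.
apply: (leq_trans (size_scale_leq _ _)); apply: (leq_trans (size_polyMleq _ _)).
have s1 (e : C) m : (size ((1 + e *: 'X) ^+ m : {poly C})%R <= m.+1)%N.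
  apply: (leq_trans (size_poly_exp_leq _ _)); rewrite ltnS.
  have h : (size ((1 : {poly C}) + e *: 'X)%R <= 2)%N.
    apply: (leq_trans (size_polyD _ _)); rewrite geq_max size_poly1 /=.
    by apply: (leq_trans (size_scale_leq _ _)); rewrite size_polyX.
  by rewrite -[X in (_ <= X)%N]mul1n leq_mul //; move: h; case: (size _).
have := leq_add (s1 I k) (s1 (- I) (n.*2 - k)%N); rewrite scaleNr.
rewrite addSn addnS subnKC; last by rewrite -ltnS.
by case: (_ + _)%N.
Qed.

Lemma chart_eval n P q t : (size q <= n.*2.+1)%N -> 1 - I * t != 0 ->
  (chart n P q).[t] = (1 - I * t) ^+ n.*2 * P ^- n * q.[P * (1 + I * t) / (1 - I * t)].
Proof.
move=> sq t0; rewrite horner_sum (horner_coef_wide _ sq) mulr_sumr.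
have hv : (1 + I *: 'X : {poly C}).[t] = 1 + I * t by rewrite !hornerE.
have hu : (1 - I *: 'X : {poly C}).[t] = 1 - I * t by rewrite !hornerE.
apply: eq_bigr => k _; rewrite hornerZ hornerM !horner_exp hv hu.
set u := 1 - I * t in t0 *; set v := 1 + I * t.
have le_k : (k <= n.*2)%N by rewrite -ltnS.
have e : u ^+ n.*2 = u ^+ (n.*2 - k) * u ^+ k by rewrite -exprD subnK.
rewrite e !exprMn exprVn.
have uk : u ^+ k != 0 by rewrite expf_neq0.
move: uk; move: (u ^+ k) (u ^+ _) (v ^+ k) (P ^+ k) (P ^- n) => U U' V p1 p2 U0.
by field.
Qed.

(* the inverse of the chart is [t = chB P / chA P] *)
Definition chA P : {poly C} := 2^-1 *: (1 + P^-1 *: 'X).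
Definition chB P : {poly C} := (2 * I)^-1 *: (P^-1 *: 'X - 1).

Lemma I_neq0 : I != 0. Proof. exact: neq0Ci. Qed.

(** [chA P - i chB P = 1] and [P (chA P + i chB P) = 'X], so putting [t = chB P / chA P] into the
    chart and clearing denominators recovers [q]. *)
Lemma chart_inv n P q : P != 0 -> (size q <= n.*2.+1)%N ->
  q = P ^+ n *: \sum_(k < n.*2.+1) (chart n P q)`_k *: (chB P ^+ k * chA P ^+ (n.*2 - k)).
Proof.
move=> P0 sq; set Q := _ *: _.
have two0 : 2 != 0 :> C by rewrite pnatr_eq0.
have I0 := I_neq0; have I2 : I ^+ 2 = -1 := sqrCi C.
have key z : z != - P -> q.[z] = Q.[z].
  move=> zP; rewrite hornerZ horner_sum.
  pose a := (chA P).[z]; pose b := (chB P).[z].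
  have aE : a = 2^-1 * (1 + P^-1 * z) by rewrite /a /chA !hornerE.
  have bE : b = (2 * I)^-1 * (P^-1 * z - 1) by rewrite /b /chB !hornerE.
  have a0 : a != 0.
    rewrite aE mulf_neq0 ?invr_neq0 //; apply: contra zP => /eqP e.
    have : P * (1 + P^-1 * z) = 0 by rewrite e mulr0.
    by rewrite mulrDr mulr1 mulVKf // addrC => /eqP; rewrite addr_eq0.
  have ab1 : a - I * b = 1.
    by rewrite aE bE invfM; field; rewrite I0 P0.
  have ab2 : P * (a + I * b) = z by rewrite aE bE invfM; field; rewrite I0 P0.
  have ch := @chart_eval n P q (b / a) sq.
  have t1 : 1 - I * (b / a) = a^-1 by rewrite -[1 in LHS](mulfV a0) mulrA -mulrBl ab1 mul1r.
  have t2 : 1 + I * (b / a) = (a + I * b) / a by field.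
  rewrite t1 t2 invr_neq0 // invrK in ch; have {}ch := ch isT.
  have arg : P * ((a + I * b) / a) * a = z by rewrite -[RHS]ab2; field.
  rewrite arg in ch.
  transitivity (P ^+ n * (a ^+ n.*2 * (chart n P q).[b / a])).
    rewrite ch exprVn; field.
    by rewrite expf_neq0 // expf_neq0.
  congr (_ * _); rewrite (horner_coef_wide _ (size_chart n P q)) mulr_sumr.
  apply: eq_bigr => k _; rewrite hornerZ hornerM !horner_exp -/a -/b.
  have le_k : (k <= n.*2)%N by rewrite -ltnS.
  have e : a ^+ n.*2 = a ^+ (n.*2 - k) * a ^+ k by rewrite -exprD subnK.
  rewrite e exprMn exprVn; field.
  by rewrite expf_neq0.
apply/eqP; rewrite -subr_eq0.
have : (q - Q) * ('X + P%:P) = 0.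
  apply: poly_nat_eq0 => m; rewrite hornerM hornerD hornerN.
  have [e|/key->] := eqVneq (m%:R : C) (- P).
    by rewrite e hornerD hornerX hornerC addNr mulr0.
  by rewrite subrr mul0r.
move/eqP; rewrite mulf_eq0 => /orP[//|].
by rewrite -[P]opprK polyCN polyXsubC_eq0.
Qed.

Definition chartF n P F : {poly {poly C}} := \poly_(i < size F) chart n P F`_i.

Lemma chart0 n P : chart n P 0 = 0.
Proof. by rewrite /chart big1 // => k _; rewrite coef0 !mul0r scale0r. Qed.

Lemma coef_chartF n P F i : (chartF n P F)`_i = chart n P F`_i.
Proof. by rewrite coef_poly; case: ltnP => // h; rewrite nth_default // chart0. Qed.

Definition cayley P (t : R) : C := P * (1 + I * t%:C) / (1 - I * t%:C).

Lemma cayley_den (t : R) : (1 - I * t%:C) * (1 + I * t%:C) = (1 + t ^+ 2)%:C.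
Proof.
rewrite -subr_sqr expr1n exprMn sqrCi mulN1r opprK rmorphD rmorph1.
by rewrite rmorphXn.
Qed.

Lemma cayley_neq0 (t : R) : 1 - I * t%:C != 0 /\ 1 + I * t%:C != 0.
Proof.
have : (1 - I * t%:C) * (1 + I * t%:C) != 0.
  rewrite cayley_den -(rmorph0 (real_complex R)) (inj_eq (@complexI R)).
  by rewrite gt_eqF // ltr_pwDl // sqr_ge0.
by rewrite mulf_eq0 negb_or => /andP.
Qed.

Lemma norm_cayley P (t : R) : `|P| = 1 -> `|cayley P t| = 1.
Proof.
move=> P1; have [h1 h2] := cayley_neq0 t.
rewrite /cayley normrM normrM P1 mul1r normfV.
have -> : 1 + I * t%:C = Num.conj (1 - I * t%:C).
  by rewrite rmorphB rmorphM rmorph1 /= conjCi conj_RC mulNr opprK.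
by rewrite norm_conjC mulfV // normr_eq0.
Qed.

Lemma cayley0 P : cayley P 0 = P.
Proof. by rewrite /cayley rmorph0 mulr0 addr0 subr0 mulr1 divr1. Qed.

Lemma chart_lev n P F (t : R) y : `|P| = 1 -> degz n F ->
  (fib (chartF n P F) t%:C).[y%:C] = ((1 + t ^+ 2) ^+ n)%:C * lev n F (cayley P t) y.
Proof.
move=> P1 dF; have [h1 h2] := cayley_neq0 t; have P0 := circ_neq0 P1.
have -> : fib (chartF n P F) t%:C = ((1 - I * t%:C) ^+ n.*2 * P ^- n) *: fib F (cayley P t).
  by apply/polyP => i; rewrite coef_fib coef_chartF coefZ coef_fib chart_eval.
rewrite hornerZ /lev mulrA; congr (_ * _).
rewrite rmorphXn /= -cayley_den /cayley !exprMn exprVn -addnn exprD.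
by field; rewrite !expf_neq0.
Qed.

Lemma chart_psd n P F : `|P| = 1 -> degz n F -> psdV n F ->
  forall t y : R, 0 <= (fib (chartF n P F) t%:C).[y%:C].
Proof.
move=> P1 dF pF t y; rewrite chart_lev // mulr_ge0 ?pF ?norm_cayley //.
by rewrite lecR exprn_ge0 // addr_ge0 // sqr_ge0.
Qed.

Lemma cayley_inj_bad P (t : R) : P != 0 ->
  complex.Re ((cayley P t / P - 1) / (I * (cayley P t / P + 1))) = t.
Proof.
move=> P0; have [h1 h2] := cayley_neq0 t; have I0 := I_neq0.
have two0 : 2 != 0 :> C by rewrite pnatr_eq0.
suff -> : (cayley P t / P - 1) / (I * (cayley P t / P + 1)) = t%:C by [].
have e1 : cayley P t / P - 1 = 2 * I * t%:C / (1 - I * t%:C).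
  by rewrite /cayley; field; rewrite P0 h1.
have e2 : cayley P t / P + 1 = 2 / (1 - I * t%:C).
  by rewrite /cayley; field; rewrite P0 h1.
by rewrite e1 e2; field; rewrite h1 I0.
Qed.

(** Continuity at a point [P] is used in the chart centred at [P], where it concerns a polynomial on
    the real line and finitely many excluded parameters. *)
Lemma psdV_except n F (bad : seq C) : degz n F ->
  (forall z y, `|z| = 1 -> z \notin bad -> 0 <= lev n F z y) -> psdV n F.
Proof.
move=> dF pF P y P1; have P0 := circ_neq0 P1.
pose bt := [seq complex.Re ((b / P - 1) / (I * (b / P + 1))) | b <- bad].
have := @poly_nonneg_except _ bt ((chartF n P F).[(y%:C)%:P]) _ 0.
rewrite -horner_swap chart_lev // cayley0 expr0n addr0 expr1n rmorph1 mul1r; apply.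
move=> t tb; rewrite -horner_swap chart_lev // mulr_ge0 //.
  by rewrite lecR exprn_ge0 // addr_ge0 // sqr_ge0.
apply: pF; first exact: norm_cayley.
apply: contra tb => cb; apply/mapP; exists (cayley P t) => //.
by rewrite cayley_inj_bad.
Qed.

End Chart.

Lemma big_ord_recl2 (V : nmodType) (f : nat -> V) m :
  \sum_(k < m.+2) f k = f 0%N + (f 1%N + \sum_(k < m) f k.+2).
Proof. by rewrite !big_ord_recl. Qed.

(** * Zeros of the coefficients on the circle *)

Section Content.
Variable R : realType.
Notation C := R[i].
Notation I := (@Num.imaginary C).
Local Open Scope complex_scope.
Implicit Types (F H : {poly {poly C}}) (z P : C) (y : R) (p q : {poly C}).

(** Otherwise [q(t)] and [q(-t)] would both have a positive coefficient in degree 1. *)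
Lemma poly_nonneg_root0 q : (forall t : R, 0 <= q.[t%:C]) -> q`_0 = 0 -> q`_1 = 0.
Proof.
move=> q0 q00; apply/eqP; apply: contraT => q1.
have h1 : 0 < q`_1 by apply: poly_nonneg_lead => // -[].
pose r := q \Po (-1 *: 'X).
have rE k : r`_k = (-1) ^+ k * q`_k by rewrite coef_scaleX.
have : 0 < r`_1.
  apply: poly_nonneg_lead.
  - by move=> s; rewrite horner_comp hornerZ hornerX mulN1r -rmorphN; apply: q0.
  - by case=> // _; rewrite rE q00 mulr0.
  - by rewrite rE expr1 mulN1r oppr_eq0.
by rewrite rE expr1 mulN1r oppr_gt0 => /(lt_trans h1); rewrite ltxx.
Qed.

Lemma size_chAB P k m : (size (chB P ^+ k * chA P ^+ m)%R <= (k + m).+1)%N.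
Proof.
apply: (leq_trans (size_polyMleq _ _)).
have s1 p l : (size p <= 2)%N -> (size (p ^+ l)%R <= l.+1)%N.
  move=> sp; apply: (leq_trans (size_poly_exp_leq _ _)); rewrite ltnS.
  by rewrite -[X in (_ <= X)%N]mul1n leq_mul //; move: sp; case: (size _).
have sB : (size (chB P) <= 2)%N.
  apply: (leq_trans (size_scale_leq _ _)); apply: (leq_trans (size_polyD _ _)).
  rewrite geq_max size_polyN size_poly1 andbT.
  by apply: (leq_trans (size_scale_leq _ _)); rewrite size_polyX.
have sA : (size (chA P) <= 2)%N.
  apply: (leq_trans (size_scale_leq _ _)); apply: (leq_trans (size_polyD _ _)).
  rewrite geq_max size_poly1 /=.
  by apply: (leq_trans (size_scale_leq _ _)); rewrite size_polyX.
by have := leq_add (s1 _ k sB) (s1 _ m sA); rewrite addSn addnS; case: (_ + _)%N.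
Qed.

Lemma circ_dist z P : `|z| = 1 -> `|P| = 1 -> (z - P) ^+ 2 = - (z * P) * `|z - P| ^+ 2.
Proof.
move=> z1 P1; have z0 := circ_neq0 z1; have P0 := circ_neq0 P1.
by rewrite normCK rmorphB /= !circ_conj //; field; rewrite z0 P0.
Qed.

Lemma chB_circ z P : `|z| = 1 -> `|P| = 1 ->
  (chB P).[z] ^+ 2 = z / (4 * P) * `|z - P| ^+ 2.
Proof.
move=> z1 P1; have z0 := circ_neq0 z1; have P0 := circ_neq0 P1.
have I0 := I_neq0 R; have I2 : I ^+ 2 = -1 := sqrCi C.
have two0 : 2 != 0 :> C by rewrite pnatr_eq0.
have -> : (chB P).[z] = (z - P) / (2 * I * P).
  by rewrite /chB !hornerE; field; rewrite P0 I0.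
rewrite expr_div_n circ_dist // !exprMn I2.
by field.
Qed.

(** For every real [y], the chart at [P] gives a nonnegative polynomial in [t] vanishing at [t = 0],
    hence divisible by [t ^ 2]; the coefficients that vanish for all [y] are zero. *)
Lemma circle_zero_chart n F P k : `|P| = 1 -> degz n F -> psdV n F -> fib F P = 0 ->
  (k < 2)%N -> forall i, (chart n P F`_i)`_k = 0.
Proof.
move=> P1 dF pF FP k2.
pose K j : {poly C} := \poly_(i < size F) (chart n P F`_i)`_j.
have KE j y : (K j).[y%:C] = ((chartF n P F).[(y%:C)%:P])`_j.
  rewrite horner_poly (horner_coef_wide _ (_ : size (chartF n P F) <= size F)%N); last exact: size_poly.
  rewrite coef_sum; apply: eq_bigr => i _; rewrite coef_chartF -polyC_exp.
  by rewrite coefMC.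
have Q0 y (t : R) : 0 <= ((chartF n P F).[(y%:C)%:P]).[t%:C].
  by rewrite -horner_swap; apply: chart_psd.
have Q00 y : ((chartF n P F).[(y%:C)%:P])`_0 = 0.
  rewrite -horner_coef0 -(rmorph0 (real_complex R)) -horner_swap chart_lev // cayley0.
  by rewrite /lev FP horner0 !mulr0.
have K0 : K k = 0.
  apply: (@poly_real_eq _ [::]) => y _; rewrite KE horner0.
  by case: k k2 => [|[|//]] _; [exact: Q00 | apply: poly_nonneg_root0].
move=> i; have [lt_i|ge_i] := ltnP i (size F); last by rewrite (nth_default 0 ge_i) chart0 coef0.
by move/(congr1 (fun p : {poly C} => p`_i)): K0; rewrite coef0 coef_poly lt_i.
Qed.

Lemma circle_zero_step n F P : `|P| = 1 -> degz n.+1 F -> psdV n.+1 F -> fib F P = 0 ->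
  exists H, [/\ (size H <= size F)%N, degz n H, psdV n H &
    forall z y, `|z| = 1 -> lev n.+1 F z y = `|z - P| ^+ 2 * lev n H z y].
Proof.
move=> P1 dF pF FP; have P0 := circ_neq0 P1.
(* Dividing by [t ^ 2] removes two factors [chB P], and [chB_circ] evaluates their product on the
   circle, whence the constant [4 * P]; the remaining factor [z] accounts for passing from [n.+1] to
   [n]. *)
pose h q : {poly C} := (P ^+ n.+1 / (4 * P)) *:
  \sum_(k < n.*2.+1) (chart n.+1 P q)`_k.+2 *: (chB P ^+ k * chA P ^+ (n.*2 - k)).
pose H := \poly_(i < size F) h F`_i.
have hF i : H`_i = h F`_i.
  rewrite coef_poly; case: ltnP => // ge_i; rewrite (nth_default 0 ge_i) /h big1 ?scaler0 // => k _.
  by rewrite chart0 coef0 scale0r.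
have FE z i : `|z| = 1 -> (F`_i).[z] = z * `|z - P| ^+ 2 * (H`_i).[z].
  move=> z1; rewrite {1}(chart_inv P0 (dF i)) hF /h.
  rewrite !hornerZ doubleS (big_ord_recl2
    (fun k => (chart n.+1 P F`_i)`_k *: (chB P ^+ k * chA P ^+ (n.*2.+2 - k)))).
  rewrite !(circle_zero_chart P1 dF pF FP) // !scale0r !add0r.
  rewrite !horner_sum !mulr_sumr; apply: eq_bigr => k _.
  rewrite !hornerZ hornerM [in RHS]hornerM !horner_exp subSS subSS.
  have e : (chB P).[z] ^+ k.+2 = (chB P).[z] ^+ 2 * (chB P).[z] ^+ k by rewrite -exprD.
  rewrite e chB_circ //; field; exact: P0.
have HF z y : `|z| = 1 -> lev n.+1 F z y = `|z - P| ^+ 2 * lev n H z y.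
  move=> z1; have z0 := circ_neq0 z1.
  have -> : lev n.+1 F z y = z ^- n.+1 * (z * `|z - P| ^+ 2 * (fib H z).[y%:C]).
    rewrite /lev; congr (_ * _); rewrite -hornerZ; congr (_.[_]).
    by apply/polyP => i; rewrite coefZ !coef_fib FE.
  by rewrite /lev exprS; field; rewrite expf_neq0 // z0.
have dH : degz n H.
  move=> i; rewrite hF; apply: (leq_trans (size_scale_leq _ _)).
  apply: (leq_trans (size_sum _ _ _)); apply/bigmax_leqP => k _.
  apply: (leq_trans (size_scale_leq _ _)); apply: (leq_trans (size_chAB _ _ _)).
  by rewrite subnKC // -ltnS.
exists H; split=> //; first exact: size_poly.
apply: (@psdV_except _ _ _ [:: P]) => // z y z1.
rewrite inE => zP; have := pF z y z1; rewrite HF // pmulr_rge0 //.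
by rewrite exprn_gt0 // normr_gt0 subr_eq0.
Qed.

Lemma fib_eq0_degz0 F P : degz 0 F -> fib F P = 0 -> F = 0.
Proof.
move=> dF FP; apply/polyP => i; rewrite coef0.
move/(congr1 (fun p : {poly C} => p`_i)): FP; rewrite coef_fib coef0.
by rewrite (size1_polyC (dF i)) hornerC => ->.
Qed.

End Content.

(** * Repeated factors *)

Lemma irreducible_divisor (A : idomainType) (g : {poly A}) :
  g != 0 -> (1 < size g)%N -> exists p, irreducible_poly p /\ p %| g.
Proof.
move=> g0 sg.
pose P m := `[< exists p : {poly A}, [/\ (1 < size p)%N, size p = m & p %| g] >].
have exP : exists m, P m by exists (size g); apply/asboolP; exists g; rewrite dvdpp.
case: (ex_minnP exP) => m /asboolP[p [sp pm pg]] minm; exists p; split=> //.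
have p0 : p != 0 by rewrite -size_poly_gt0 ltnW.
split=> // q sq qp; have q0 : q != 0.
  by apply: contraTneq qp => ->; rewrite dvd0p.
have sq1 : (1 < size q)%N by rewrite ltn_neqAle eq_sym sq lt0n size_poly_eq0.
rewrite -dvdp_size_eqp // eqn_leq dvdp_leq //= pm.
by apply: minm; apply/asboolP; exists q; split=> //; apply: dvdp_trans pg.
Qed.

(** [p] is coprime to its nonzero derivative; writing [F = u p] up to a scalar, [p] divides
    [u' p + u p'], hence divides [u]. *)
Lemma irreducible_sqr_dvd (A : idomainType) (p F : {poly A}) :
  irreducible_poly p -> p^`() != 0 -> p %| F -> p %| F^`() -> p * p %| F.
Proof.
move=> ip dp0 pF pdF; have p0 := irredp_neq0 ip.
have /Pdiv.Idomain.dvdpP[[c u] /= c0 cFu] := pF.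
have cop : coprimep p p^`().
  rewrite /coprimep; apply: contraTT isT => sg1.
  have /eqp_size sgp := ip.2 _ sg1 (dvdp_gcdl p p^`()).
  have := dvdp_leq dp0 (dvdp_gcdr p p^`()).
  by rewrite sgp leqNgt lt_size_deriv.
have : p %| c *: F^`() by rewrite dvdpZr.
rewrite -derivZ cFu derivM (dvdp_addr _ (dvdp_mull _ (dvdpp p))) Gauss_dvdpl // => pu.
by rewrite -(dvdpZr _ _ c0) cFu dvdp_mul.
Qed.

(** * Primitive polynomials and Gauss's lemma *)

Section Primitive.
Variable C : numClosedFieldType.
Implicit Types (F G p : {poly {poly C}}) (q : {poly C}).

Lemma fib_eq0_factor F z : fib F z = 0 -> exists G, F = ('X - z%:P) *: G.
Proof.
move=> Fz; exists (\poly_(i < size F) (F`_i %/ ('X - z%:P))).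
apply/polyP => i; rewrite coefZ coef_poly; case: ltnP => [_|h]; last first.
  by rewrite mulr0 nth_default.
have /factor_theorem[q ->] : root F`_i z.
  by move/(congr1 (fun p : {poly C} => p`_i)): Fz; rewrite coef_map coef0 => /eqP.
by rewrite mulpK ?polyXsubC_eq0 // mulrC.
Qed.

(** The primes of [{poly C}] are the ['X - z], so primitivity means that no fibre vanishes. Dividing
    out such factors terminates because the degree of the leading coefficient drops. *)
Lemma primitive_part F : F != 0 -> exists q p,
  [/\ q != 0, F = q *: p & forall z, fib p z != 0].
Proof.
have [N] := ubnP (size (lead_coef F)); elim: N F => // N IH F; rewrite ltnS => sF F0.
have [|] := pselect (exists z, fib F z = 0); last first.
  move=> nz; exists 1, F; rewrite oner_neq0 scale1r; split=> // z.
  by apply/eqP => h; apply: nz; exists z.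
move=> [z /fib_eq0_factor[G FE]].
have G0 : G != 0 by apply: contra_neq F0 => G0; rewrite FE G0 scaler0.
have [|q [p [q0 GE pp]]] := IH G _ G0.
  apply: leq_trans sF; rewrite FE lead_coefZ size_monicM ?lead_coef_eq0 ?monicXsubC //.
  by rewrite size_XsubC.
exists (('X - z%:P) * q), p; rewrite mulf_neq0 ?polyXsubC_eq0 //.
by rewrite FE GE scalerA.
Qed.

Lemma fib_scale q F z : fib (q *: F) z = q.[z] *: fib F z.
Proof. by apply/polyP => i; rewrite !coef_map coefZ /= /horner_eval !coefZ hornerM coef_map. Qed.

(** One root [z] of [q] is removed at a time: the fibre of [G * p] at [z] vanishes and that of [p]
    does not, so ['X - z] divides [G]. *)
Lemma gauss_primitive p F G q : (forall z, fib p z != 0) -> q != 0 ->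
  q *: F = G * p -> exists H, F = H * p.
Proof.
move=> pp; have [N] := ubnP (size q); elim: N q G => // N IH q G; rewrite ltnS => sq q0 e.
have [s1|s1] := eqVneq (size q) 1%N.
  have qE := size1_polyC (eq_leq s1).
  have c0 : q`_0 != 0 by apply: contra_neq q0 => c0; rewrite qE c0.
  exists ((q`_0)^-1%:P *: G); rewrite -scalerAl -e qE coefC eqxx scalerA -polyCM mulVf //.
  by rewrite scale1r.
have /closed_rootP[z qz] := s1.
have : fib G z * fib p z = 0.
  by rewrite -fibM -e fib_scale (rootP qz) scale0r.
move/eqP; rewrite mulf_eq0 (negPf (pp z)) orbF => /eqP/fib_eq0_factor[G1 GE].
have /factor_theorem[q1 q1E] := qz.
have q10 : q1 != 0 by apply: contra_neq q0 => h; rewrite q1E h mul0r.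
apply: (IH q1 G1) => //.
  by apply: leq_trans sq; rewrite q1E size_Mmonic ?monicXsubC // size_XsubC addn2.
apply: (mulfI (_ : ('X - z%:P)%:P != 0)); first by rewrite polyC_eq0 polyXsubC_eq0.
by rewrite !mul_polyC scalerA mulrC -q1E e GE scalerAl.
Qed.

Lemma deriv_neq0 p : (1 < size p)%N -> p^`() != 0.
Proof.
move=> sp; apply/eqP => /(congr1 (fun q : {poly {poly C}} => q`_(size p).-2)).
rewrite coef_deriv coef0 prednK; last by case: (size p) sp => [|[]].
move/(congr1 (fun q : {poly C} => q`_(size (lead_coef p)).-1)); rewrite coefMn coef0 -lead_coefE.
move/eqP; rewrite -lead_coefE mulrn_eq0 lead_coef_eq0 lead_coef_eq0.
rewrite -size_poly_eq0; case: (size p) sp => [|[]] //.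
Qed.

End Primitive.

Section FactorStep.
Variable R : realType.
Notation C := R[i].
Local Open Scope complex_scope.
Implicit Types (F G H p : {poly {poly C}}) (z : C) (y : R) (q : {poly C}).

Lemma horner_star_gen N q z : (size q <= N.+1)%N -> z != 0 ->
  (star N q).[z] = z ^+ N * Num.conj q.[(Num.conj z)^-1].
Proof.
move=> sq z0; rewrite horner_poly (horner_coef_wide _ sq) rmorph_sum mulr_sumr.
rewrite (reindex_inj rev_ord_inj) /=; apply: eq_bigr => i _.
have le_iN : (i <= N)%N by rewrite -ltnS.
rewrite subSS subKn // rmorphM rmorphXn /= fmorphV /= conjCK exprVn.
rewrite mulrCA; congr (_ * _); apply: (mulIf (expf_neq0 i z0)).
by rewrite -exprD subnK // mulfVK // expf_neq0.
Qed.

Lemma star_eq0 N q : (size q <= N.+1)%N -> star N q = 0 -> q = 0.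
Proof.
move=> sq s0; apply/polyP => i; rewrite coef0.
have [le_i|lt_i] := leqP i N; last by rewrite nth_default // (leq_trans sq).
move/(congr1 (fun p : {poly C} => p`_(N - i))): s0.
rewrite coef_poly coef0 ltnS leq_subr subKn // => /eqP.
by rewrite conjC_eq0 => /eqP.
Qed.

Lemma zle_exact p : p != 0 -> exists N, zle N p /\ exists i, size (p`_i)%R = N.+1.
Proof.
move=> p0; have [M zM] := zle_exists p.
have ex : exists N, `[< zle N p >] by exists M; apply/asboolP.
case: (ex_minnP ex) => N /asboolP zN minN; exists N; split=> //.
case: N zN minN => [|N] zN minN.
  have lp : lead_coef p != 0 by rewrite lead_coef_eq0.
  exists (size p).-1; apply/anti_leq; rewrite zN /=.
  by rewrite lt0n size_poly_eq0 -lead_coefE.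
apply: contrapT => nex; suff /minN : `[< zle N p >] by rewrite ltnn.
apply/asboolP => i; rewrite leqNgt; apply/negP => h; apply: nex.
by exists i; apply/anti_leq; rewrite zN.
Qed.

(** Away from 0, the fibre at [z] is, up to a power of [z], conjugate to the fibre of [p] at the
    reflected point. At 0 it holds the conjugate coefficients of degree [N] in [z], hence the
    condition that [N] is attained. *)
Lemma starF_primitive N p : zle N p -> (exists i, size (p`_i)%R = N.+1) ->
  (forall z, fib p z != 0) -> forall z, fib (starF N p) z != 0.
Proof.
move=> zN [i si] pp z; have [->|z0] := eqVneq z 0.
  apply/eqP => /(congr1 (fun q : {poly C} => q`_i)).
  rewrite coef_fib coef_starF coef0 horner_coef0 coef_poly /= subn0 => /eqP.
  rewrite conjC_eq0 => /eqP e.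
  have : lead_coef p`_i != 0 by rewrite lead_coef_eq0 -size_poly_gt0 si.
  by rewrite lead_coefE si /= e eqxx.
apply/eqP => h; case/eqP: (pp (Num.conj z)^-1); apply/polyP => j.
move/(congr1 (fun q : {poly C} => q`_j)): h; rewrite !coef_fib coef_starF !coef0.
rewrite horner_star_gen // => /eqP.
by rewrite mulf_eq0 expf_eq0 (negPf z0) andbF conjC_eq0 => /eqP.
Qed.

Lemma size_starF N p : zle N p -> size (starF N p) = size p.
Proof.
move=> zN; have [->|p0] := eqVneq p 0.
  by apply/eqP; rewrite size_poly0 size_poly_eq0; apply/eqP/polyP => i; rewrite coef_poly size_poly0 coef0.
rewrite size_poly_eq //; apply: contra_neq p0 => /(star_eq0 (zN _)) /eqP.
by rewrite -lead_coefE lead_coef_eq0 => /eqP.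
Qed.

Lemma psdV_conj n F z : psdV n F -> `|z| = 1 ->
  map_poly Num.conj (fib F z) = z ^- n.*2 *: fib F z.
Proof.
move=> pF z1; have zn k : z ^+ k != 0 by rewrite expf_neq0 // circ_neq0.
have : map_poly Num.conj (z ^- n *: fib F z) = z ^- n *: fib F z.
  by apply: (@poly_real_conj _ [::]) => y _; rewrite hornerZ; apply/ger0_real/pF.
rewrite map_polyZ /= fmorphV rmorphXn /= (circ_conj z1) exprVn invrK => e.
rewrite -[LHS](scalerK (zn n)) e scalerA; congr (_ *: _).
by rewrite -addnn exprD invfM.
Qed.

(** Being real on the circle, [F] agrees with its own reflection up to powers of [z], so reflecting
    [F = G * p] exhibits the factor [starF N p]. The powers of [z] are nonzero scalars, which [%|]
    ignores. *)
Lemma psdV_star_dvd n F G p N : psdV n F -> zle N p -> F = G * p -> starF N p %| F.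
Proof.
move=> pF zN FE; have [K zK] := zle_exists G.
have xn k : 'X^k != 0 :> {poly C} by rewrite -size_poly_eq0 size_polyXn.
rewrite -(dvdpZr _ _ (xn (K + N)%N)).
have -> : 'X^(K + N) *: F = ('X^(n.*2) *: starF K G) * starF N p.
  rewrite -scalerAl -starFM // -FE; apply: fib_poly_eq => z z1.
  rewrite !fib_scale !hornerXn fib_star //; last by rewrite FE; apply: zleM.
  rewrite (psdV_conj pF z1) !scalerA; congr (_ *: _).
  by rewrite mulrAC mulfV ?mul1r // expf_neq0 // circ_neq0.
exact: dvdp_mulIr.
Qed.

(* [p] divides [F] and [F^`()].  Its reflection [starF N p] also divides [F]; it is
   either coprime to [p] or associated to it, and in the latter case the double
   factor [p * p] of [F] is used. *)
Theorem factor_step n F : psdV n F -> F != 0 -> (1 < size (gcdp F F^`()))%N ->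
  exists p H n', [/\ (1 < size p)%N, (size H + (size p).-1.*2 <= size F)%N, degz n' H,
    psdV n' H & forall z y, `|z| = 1 ->
      lev n F z y = `|(fib p z).[y%:C]| ^+ 2 * lev n' H z y].
Proof.
move=> pF F0 sg.
have g0 : gcdp F F^`() != 0 by rewrite -size_poly_gt0 ltnW.
have [p0 [ip0 p0g]] := irreducible_divisor g0 sg.
have [q [p [q0 p0E pp]]] := primitive_part (irredp_neq0 ip0).
have pp0 : p0 %= p by rewrite p0E eqp_scale.
have sp : (1 < size p)%N by rewrite -(eqp_size pp0) ip0.1.
have ip : irreducible_poly p.
  split=> // r sr rp; apply: eqp_trans pp0; apply: ip0.2 => //.
  by rewrite p0E dvdpZr.
have pn0 := irredp_neq0 ip.
have pF1 : p %| F.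
  by rewrite -(eqp_dvdl _ pp0) (dvdp_trans p0g) // dvdp_gcdl.
have pF2 : p %| F^`().
  by rewrite -(eqp_dvdl _ pp0) (dvdp_trans p0g) // dvdp_gcdr.
have [G FG] : exists G, F = G * p.
  by have /Pdiv.Idomain.dvdpP[[c u] /= c0 cFu] := pF1; apply: gauss_primitive cFu.
have [N [zN exN]] := zle_exact pn0.
have psF := psdV_star_dvd pF zN FG.
have sps := size_starF zN.
have pps := starF_primitive zN exN pp.
have pspF : p * starF N p %| F.
  have [cop|ncop] := boolP (coprimep p (starF N p)).
    by rewrite Gauss_dvdp // pF1.
  have e1 := ip.2 _ ncop (dvdp_gcdl _ _).
  have : p %| starF N p by rewrite -(eqp_dvdl _ e1) dvdp_gcdr.
  move/dvdp_size_eqp; rewrite sps eqxx => /esym pps'.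
  rewrite -(eqp_dvdl _ (eqp_mull p pps')).
  by apply: irreducible_sqr_dvd => //; apply: deriv_neq0.
have [H0 FH] : exists H0, F = H0 * (p * starF N p).
  have /Pdiv.Idomain.dvdpP[[c u] /= c0 cFu] := pspF.
  apply: gauss_primitive cFu => // z; rewrite fibM mulf_neq0 //.
have H00 : H0 != 0 by apply: contra_neq F0 => h; rewrite FH h mul0r.
have ps0 : starF N p != 0 by rewrite -size_poly_eq0 sps size_poly_eq0.
have [n' [H [sH dH HE]]] := lev_normalize N n H0.
have levE z y : `|z| = 1 -> lev n F z y = `|(fib p z).[y%:C]| ^+ 2 * lev n' H z y.
  move=> z1; rewrite HE // {1}FH /lev !fibM !hornerM fib_star_horner // normCK.
  by ring.
exists p, H, n'; split=> //.
  rewrite FH size_mul ?mulf_neq0 // size_mul // sps.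
  apply: (@leq_trans (size H0 + (size p).-1.*2)); first by rewrite leq_add2r.
  by case: (size p) sp => // s _; rewrite addSn /= addnS addnS /= addnn.
move=> z y z1; rewrite /lev -hornerZ.
have [rs rsE] := closed_field_poly_normal (fib p z).
apply: (@poly_nonneg_except _ [seq complex.Re r | r <- rs]) => s sbad.
have ps_neq0 : (fib p z).[s%:C] != 0.
  apply: contra sbad => /eqP h; apply/mapP; exists s%:C => //.
  have : root (fib p z) s%:C by apply/rootP.
  by rewrite rsE rootZ ?root_prod_XsubC // lead_coef_eq0.
have := pF z s z1; rewrite levE // pmulr_rge0 ?exprn_gt0 ?normr_gt0 //.
by rewrite hornerZ.
Qed.

End FactorStep.

(** * The lower bound given by the resultant *)

Section PolyMin.
Variable R : rcfType.
Implicit Types (q : {poly R}).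

(** Following [q] downhill to the next critical point, or to the end [b], shows in [poly_min] that
    the least value among ends and critical points is the minimum on the interval. *)
Lemma descend_right q (y b : R) : y < b -> q^`().[y] < 0 ->
  exists x, [/\ y < x, x <= b, x = b \/ q^`().[x] = 0 & q.[x] <= q.[y]].
Proof.
move=> yb qy.
have key x : y < x -> (forall s, y < s -> s < x -> q^`().[s] != 0) -> q.[x] <= q.[y].
  move=> yx nz; rewrite leNgt; apply/negP => h.
  have [c /itvP cI qc] := poly_mvt q yx.
  have c0 : 0 < q^`().[c].
    by rewrite -(pmulr_lgt0 _ (_ : 0 < x - y)) ?subr_gt0 // -qc subr_gt0.
  have yc : y <= c by rewrite ltW // cI.
  have qyc : q^`().[y] * q^`().[c] < 0 by rewrite nmulr_rlt0.
  have [s /itvP sI sr] := poly_ivtoo yc qyc.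
  have /nz : y < s by rewrite sI.
  have cx : c < x by rewrite cI.
  have sc : s < c by rewrite sI.
  by move=> /(_ (lt_trans sc cx)); rewrite (rootP sr) eqxx.
case: (next_rootP q^`() y b) => [d0|x d0 rx /itvP xI noroot_x|x d0 xb noroot_x].
- by rewrite d0 horner0 ltxx in qy.
- exists x; split; rewrite ?xI //; first by right.
  by apply: key => [|s ys sx]; rewrite ?xI // noroot_x // in_itv /= ys sx.
- exists b; split=> //; first by left.
  by apply: key => // s ys sb; apply: noroot_x; rewrite in_itv /= ys sb.
Qed.

Lemma seq_min (T : eqType) (f : T -> R) (s : seq T) : s != [::] ->
  exists2 m, m \in s & forall x, x \in s -> f m <= f x.
Proof.
elim: s => // a [|b s] IH _.
  by exists a; rewrite ?inE // => x; rewrite inE => /eqP->.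
have [//|m ms mP] := IH; have [h|h] := leP (f a) (f m).
  exists a; first by rewrite inE eqxx.
  by move=> x; rewrite inE => /orP[/eqP->|/mP] //; apply: le_trans.
exists m; first by rewrite inE ms orbT.
by move=> x; rewrite inE => /orP[/eqP->|/mP] //; apply: ltW.
Qed.

Lemma poly_min q (r : R) : 0 < r ->
  exists x, [/\ -r <= x, x <= r, [\/ x = - r, x = r | q^`().[x] = 0] &
    forall y, -r <= y -> y <= r -> q.[x] <= q.[y]].
Proof.
move=> r0; have rr : - r < r by lra.
have [dq0|dq0] := eqVneq q^`() 0.
  exists (- r); split=> //; [exact: ltW | by constructor 1 |].
  move=> y y1 y2; have [->//|ne] := eqVneq y (- r).
  have /(poly_mvt q)[c _ qc] : - r < y by rewrite lt_def ne.
  by rewrite -subr_ge0 qc dq0 horner0 mul0r.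
pose s := [:: - r, r & roots q^`() (- r) r].
have [//|x xs xmin] := @seq_min _ (horner q) s.
have sI t : t \in s -> -r <= t /\ t <= r.
  rewrite !inE => /or3P[/eqP->|/eqP->|/roots_in/itvP tI]; try by split; lra.
  by rewrite !ltW ?tI.
have sr t : -r <= t -> t <= r -> [\/ t = - r, t = r | q^`().[t] = 0] -> t \in s.
  move=> t1 t2; rewrite !inE => -[->|->|qt]; rewrite ?eqxx ?orbT //.
  have [//|n1] := eqVneq t (- r); have [//|n2] := eqVneq t r.
  rewrite root_in_roots ?orbT //; last exact/rootP.
  by rewrite in_itv /= !lt_neqAle t1 t2 n2 eq_sym n1.
have [x1 x2] := sI _ xs.
exists x; split=> //.
  move: xs; rewrite !inE => /or3P[/eqP->|/eqP->|/root_roots/rootP h]; by constructor.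
move=> y y1 y2.
suff [t ts ty] : exists2 t, t \in s & q.[t] <= q.[y] by apply: le_trans (xmin _ ts) ty.
have [y3|y3] := eqVneq y (- r); first by exists y => //; apply: sr => //; constructor 1.
have [y4|y4] := eqVneq y r; first by exists y => //; apply: sr => //; constructor 2.
have ly : - r < y by rewrite lt_def y3.
have ry : y < r by rewrite lt_neqAle y4.
case: (ltgtP q^`().[y] 0) => [h|h|h].
- have [t [t1 t2 t3 t4]] := descend_right ry h; exists t => //.
  apply: sr => //; first lra.
  by case: t3 => ->; [constructor 2 | constructor 3].
- pose p := q \Po - 'X.
  have pE t : p.[t] = q.[- t] by rewrite horner_comp hornerN hornerX.
  have dpE t : p^`().[t] = - q^`().[- t].
    by rewrite deriv_comp derivN derivX hornerM horner_comp !hornerN hornerX hornerC mulrN1.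
  have [||t [t1 t2 t3 t4]] := @descend_right p (- y) r; first lra.
    by rewrite dpE opprK oppr_lt0.
  exists (- t); last by move: t4; rewrite !pE opprK.
  apply: sr; [lra | lra |]; case: t3 => [->|e]; first by constructor 1.
  by constructor 3; apply/eqP; rewrite -oppr_eq0 -dpE e.
- by exists y => //; apply: sr => //; constructor 3.
Qed.

End PolyMin.

(** * Explicit bounds on the circle and for large [y] *)

Section Bounds.
Variable R : realType.
Notation C := R[i].
Local Open Scope complex_scope.
Implicit Types (F : {poly {poly C}}) (z : C) (y : R) (q : {poly C}).

Definition nr (x : C) : R := complex.Re `|x|.
Lemma nrE x : (nr x)%:C = `|x|. Proof. exact: normRe. Qed.
Lemma nr_ge0 x : 0 <= nr x. Proof. by rewrite -lecR nrE normr_ge0. Qed.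
Lemma nrM x w : nr (x * w) = nr x * nr w.
Proof. by apply: (@complexI R); rewrite rmorphM /= !nrE normrM. Qed.
Lemma nrD x w : nr (x + w) <= nr x + nr w.
Proof. by rewrite -lecR rmorphD /= !nrE ler_normD. Qed.
Lemma nr_sum I (r : seq I) (P : pred I) (f : I -> C) :
  nr (\sum_(i <- r | P i) f i) <= \sum_(i <- r | P i) nr (f i).
Proof.
rewrite -lecR nrE rmorph_sum /=; apply: (le_trans (ler_norm_sum _ _ _)).
by apply: ler_sum => i _; rewrite nrE.
Qed.
Lemma nrX x n : nr (x ^+ n) = nr x ^+ n.
Proof. by apply: (@complexI R); rewrite rmorphXn /= !nrE normrX. Qed.
Lemma nr_circ z : `|z| = 1 -> nr z = 1.
Proof. by move=> z1; rewrite /nr z1. Qed.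
Lemma nr_real (x : R) : nr x%:C = `|x|.
Proof. by rewrite /nr normRC. Qed.
Lemma nr_V x : nr x^-1 = (nr x)^-1.
Proof. by apply: (@complexI R); rewrite fmorphV /= !nrE normfV. Qed.

(** The constant is explicit: in the factorization of [q] into linear factors, [|z - r|] is at least
    the distance of [|r|] from 1, which is positive. *)
Lemma circ_lower q : (forall z, `|z| = 1 -> q.[z] != 0) ->
  exists2 c : R, 0 < c & forall z, `|z| = 1 -> c <= nr q.[z].
Proof.
move=> qz; have [rs qE] := closed_field_poly_normal q.
have q0 : q != 0.
  by apply: contra_neq (qz 1 (normr1 _)) => ->; rewrite horner0.
have rs1 r : r \in rs -> nr r != 1.
  move=> rrs; apply/eqP => r1; have r1' : `|r| = 1 by rewrite -nrE r1.
  have /negP := qz r r1'; apply; apply/eqP/rootP.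
  by rewrite qE rootZ ?lead_coef_eq0 // root_prod_XsubC.
exists (nr (lead_coef q) * \prod_(r <- rs) `|nr r - 1|).
  rewrite mulr_gt0 //; first by rewrite -ltcR nrE normr_gt0 lead_coef_eq0.
  rewrite big_seq; apply: prodr_gt0 => r /rs1 h.
  by rewrite normr_gt0 subr_eq0.
move=> z z1; rewrite {2}qE hornerZ nrM ler_wpM2l ?nr_ge0 //.
rewrite horner_prod; elim: rs {qE rs1} => [|r rs IH]; first by rewrite !big_nil /nr normr1.
rewrite !big_cons nrM ler_pM ?normr_ge0 ?prodr_ge0 // hornerXsubC.
have e : `|nr r - 1|%:C = `| `|r| - `|z| | by rewrite -normRC rmorphB /= nrE z1.
by rewrite -lecR nrE e [`|z - r|]distrC; apply: ler_dist_dist.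
Qed.

Lemma circ_upper q : exists2 B : R, 0 < B & forall z, `|z| = 1 -> nr q.[z] <= B.
Proof.
exists (1 + \sum_(i < size q) nr q`_i).
  by rewrite ltr_pwDl // sumr_ge0 // => i _; apply: nr_ge0.
move=> z z1; rewrite horner_coef; apply: (le_trans (nr_sum _ _ _)).
rewrite ler_wpDl //; apply: ler_sum => i _.
by rewrite nrM nrX (nr_circ z1) expr1n mulr1.
Qed.

Lemma fib_upper F (r : R) : 1 <= r -> exists2 B : R, 0 < B & forall z y, `|z| = 1 ->
  `|y| <= r -> nr (fib F z).[y%:C] <= B.
Proof.
move=> r1; have [N zN] := zle_exists F.
exists (1 + \sum_(k < size F) \sum_(j < N.+1) nr F`_k`_j * r ^+ k).
  rewrite ltr_pwDl // sumr_ge0 // => k _; rewrite sumr_ge0 // => j _.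
  by rewrite mulr_ge0 ?nr_ge0 ?exprn_ge0 // (le_trans ler01).
move=> z y z1 yr; rewrite (horner_fibE _ _ (leqnn _) zN).
apply: (le_trans (nr_sum _ _ _)); rewrite ler_wpDl //; apply: ler_sum => k _.
apply: (le_trans (nr_sum _ _ _)); apply: ler_sum => j _.
rewrite !nrM !nrX (nr_circ z1) expr1n mulr1 nr_real ler_wpM2l ?nr_ge0 //.
by rewrite lerXn2r // nnegrE // (le_trans ler01).
Qed.

Lemma split_circ_roots q : q != 0 -> exists L q0,
  [/\ q = \prod_(r <- L) ('X - r%:P) * q0, forall r, r \in L -> `|r| = 1 &
    forall z, `|z| = 1 -> q0.[z] != 0].
Proof.
move=> q0; have [rs qE] := closed_field_poly_normal q.
exists [seq r <- rs | `|r| == 1],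
  (lead_coef q *: \prod_(r <- [seq r <- rs | `|r| != 1]) ('X - r%:P)).
split.
- rewrite {1}qE -scalerAr; congr (_ *: _).
  by rewrite !big_filter [LHS](bigID (fun r : C => `|r| == 1)).
- by move=> r; rewrite mem_filter => /andP[/eqP].
move=> z z1; rewrite -[_ == 0]/(root _ _) rootZ ?lead_coef_eq0 // root_prod_XsubC.
by rewrite mem_filter z1 eqxx.
Qed.

Lemma psd_growth n d F : (0 < d)%N -> size F = d.*2.+1 -> psdV n F ->
  (forall z, `|z| = 1 -> (F`_d.*2).[z] != 0) ->
  exists a r : R, [/\ 0 < a, 1 <= r & forall z y, `|z| = 1 -> r <= `|y| ->
    (a * (1 + y ^+ 2) ^+ d)%:C <= lev n F z y].
Proof.
move=> d0 sF pF lead0; have [a0 a00 aP] := circ_lower lead0.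
have [N zN] := zle_exists F.
pose S := \sum_(k < d.*2) \sum_(j < N.+1) nr F`_k`_j.
have S0 : 0 <= S by rewrite sumr_ge0 // => k _; rewrite sumr_ge0 // => j _; apply: nr_ge0.
have r1 : 1 <= 1 + 2 * S / a0 by rewrite lerDl divr_ge0 ?(ltW a00) // mulr_ge0.
(* Beyond this radius the lower terms take at most half of the leading term; the factor [2 ^ d]
   comes from [1 + y ^ 2 <= 2 y ^ 2] for [|y| >= 1]. *)
exists (a0 / 2 / 2 ^+ d), (1 + 2 * S / a0); split=> //.
  by rewrite !divr_gt0 // exprn_gt0.
move=> z y z1 ry; have y1 : 1 <= `|y| := le_trans r1 ry.
have y0 : 0 < `|y| := lt_le_trans ltr01 y1.
have -> : lev n F z y = (nr (lev n F z y))%:C by rewrite nrE ger0_norm // pF.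
rewrite lecR /lev nrM nr_V nrX (nr_circ z1) expr1n invr1 mul1r.
rewrite (horner_coef_wide _ (size_fib F z)) sF big_ord_recr /= coef_fib.
set A := \sum_(i < d.*2) _; set B := (X in nr (A + X)).
have nB : a0 * `|y| ^+ d.*2 <= nr B.
  by rewrite nrM nrX nr_real ler_wpM2r ?exprn_ge0 // aP.
have nA : nr A <= S * `|y| ^+ d.*2.-1.
  apply: (le_trans (nr_sum _ _ _)); rewrite mulr_suml; apply: ler_sum => k _.
  rewrite coef_fib (horner_coef_wide _ (zN k)) nrM nrX nr_real.
  apply: ler_pM; rewrite ?nr_ge0 ?exprn_ge0 //.
    apply: (le_trans (nr_sum _ _ _)); apply: ler_sum => j _.
    by rewrite nrM nrX (nr_circ z1) expr1n mulr1.
  by rewrite ler_weXn2l // -ltnS prednK ?double_gt0 // ltn_ord.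
have SA : S * `|y| ^+ d.*2.-1 <= a0 / 2 * `|y| ^+ d.*2.
  have -> : `|y| ^+ d.*2 = `|y| * `|y| ^+ d.*2.-1 by rewrite -exprS prednK ?double_gt0.
  rewrite mulrA ler_wpM2r ?exprn_ge0 //.
  have h : 2 * S / a0 <= `|y| by lra.
  rewrite ler_pdivrMr // in h; lra.
have nAB : nr B <= nr (A + B) + nr A.
  have := nrD (A + B) (- A); rewrite addrAC subrr add0r.
  by have -> : nr (- A) = nr A by rewrite /nr normrN.
have yd : (1 + y ^+ 2) ^+ d <= 2 ^+ d * `|y| ^+ d.*2.
  rewrite -muln2 mulnC exprM -exprMn lerXn2r ?nnegrE //.
  - by rewrite addr_ge0 // sqr_ge0.
  - by rewrite mulr_ge0 // exprn_ge0.
  - by rewrite real_normK ?num_real // mulr_natl mulr2n lerD2r -(real_normK (num_real y)) exprn_ege1.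
have h2 : 0 < (2 : R) ^+ d by rewrite exprn_gt0.
apply: (@le_trans _ _ (a0 / 2 * `|y| ^+ d.*2)); last lra.
rewrite -mulrA ler_wpM2l ?divr_ge0 ?(ltW a00) //.
by rewrite mulrC ler_pdivrMr // mulrC.
Qed.

End Bounds.

Section LowerBound.
Variable R : realType.
Notation C := R[i].
Local Open Scope complex_scope.
Implicit Types (F p : {poly {poly C}}) (z : C) (y : R) (q : {poly C}).

(** The resultant is a combination [u F + v F']; at a critical point only [u F] remains, and [u] is
    bounded for [|x| <= r]. *)
Lemma psd_bezout_bound n d F (r : R) : (0 < d)%N -> size F = d.*2.+1 -> psdV n F -> 1 <= r ->
  exists2 U : R, 0 < U & forall z x, `|z| = 1 -> `|x| <= r ->
    (fib F^`() z).[x%:C] = 0 -> nr (resultant F F^`()).[z] <= U * nr (lev n F z x).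
Proof.
move=> d0 sF pF r1.
have sF1 : (1 < size F)%N by rewrite sF ltnS double_gt0.
have lF : lead_coef F != 0 by rewrite lead_coef_eq0 -size_poly_gt0 ltnW.
have sF'1 : (1 < size F^`())%N.
  rewrite (leq_trans _ (_ : d.*2 <= _)%N) //; first by case: (d) d0.
  rewrite leqNgt; apply/negP => h.
  have : F^`()`_d.*2.-1 = 0 by rewrite nth_default // -ltnS prednK ?double_gt0.
  rewrite coef_deriv prednK ?double_gt0 // => e.
  case/eqP: lF; rewrite lead_coefE sF /=; apply/polyP => i.
  move/(congr1 (fun q : {poly C} => q`_i)): e; rewrite coefMn coef0 => /eqP.
  by rewrite mulrn_eq0 double_eq0 eqn0Ngt d0 /= => /eqP.
have [[u v] /= _ uv] := resultant_in_ideal sF1 sF'1.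
have [U U0 UP] := fib_upper u r1; exists U => // z x z1 xr dx.
have -> : (resultant F F^`()).[z] = (fib u z).[x%:C] * (fib F z).[x%:C].
  have := congr1 (fun p => (fib p z).[x%:C]) uv.
  by rewrite fibC hornerC fibD !fibM hornerD !hornerM dx mulr0 addr0.
rewrite nrM /lev nrM nr_V nrX (nr_circ z1) expr1n invr1 mul1r.
by rewrite ler_wpM2r ?nr_ge0 // UP.
Qed.

(* For fixed [z], the minimum over a large interval is attained at its ends, where
   the leading term dominates, or at a critical point, where the resultant of [F]
   and [F^`()] is a multiple of [F]. *)
Theorem psd_lower_bound n d F : (0 < d)%N -> size F = d.*2.+1 -> psdV n F ->
  (forall z, `|z| = 1 -> (F`_d.*2).[z] != 0) -> resultant F F^`() != 0 ->
  exists L (k : R), [/\ 0 < k, forall w, w \in L -> `|w| = 1 & forall z y, `|z| = 1 ->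
    k * nr (\prod_(w <- L) ('X - w%:P)).[z] ^+ 2 * (1 + y ^+ 2) ^+ d <= nr (lev n F z y)].
Proof.
move=> d0 sF pF lead0 res0; set rho := resultant F F^`() in res0.
have [a [r [a0 r1 grow]]] := psd_growth d0 sF pF lead0.
have r0 : 0 < r := lt_le_trans ltr01 r1.
have [U U0 UP] := psd_bezout_bound d0 sF pF r1.
have [B B0 BP] := circ_upper rho.
have {}grow z y : `|z| = 1 -> r <= `|y| -> a * (1 + y ^+ 2) ^+ d <= nr (lev n F z y).
  by move=> z1 yr; rewrite -lecR nrE ger0_norm ?pF // grow.
have y21 y : 1 <= 1 + y ^+ 2 by rewrite lerDl sqr_ge0.
(* [a / B] serves the ends of the interval, where the growth bound holds; [U^-1] serves the critical
   points inside. *)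
pose b := Num.min (a / B) (U^-1).
have b0 : 0 < b by rewrite lt_min divr_gt0 // invr_gt0.
have ba : b <= a / B by rewrite ge_min lexx.
have bU : b <= U^-1 by rewrite ge_min lexx orbT.
have ab z : `|z| = 1 -> b * nr rho.[z] <= a.
  move=> z1; apply: (@le_trans _ _ (a / B * nr rho.[z])).
    by rewrite ler_wpM2r ?nr_ge0.
  rewrite mulrAC ler_pdivrMr // ler_wpM2l ?(ltW a0) //; exact: BP.
have mid z y : `|z| = 1 -> `|y| <= r -> b * nr rho.[z] <= nr (lev n F z y).
  move=> z1 yr.
  pose qc := z ^- n *: fib F z.
  have qcE x : qc.[x%:C] = lev n F z x by rewrite hornerZ.
  have rq : map_poly Num.conj qc = qc.
    by apply: (@poly_real_conj _ [::]) => x _; rewrite qcE; apply/ger0_real/pF.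
  pose q := Repoly qc.
  have qE x : q.[x] = nr (lev n F z x).
    by apply: (@complexI R); rewrite nrE ger0_norm ?pF // -qcE horner_Repoly.
  have [x [x1 x2 x3 xmin]] := poly_min q r0.
  have yI : -r <= y /\ y <= r by move: yr; rewrite ler_norml => /andP[].
  rewrite -qE; apply: le_trans (xmin y yI.1 yI.2); rewrite qE.
  have xr : `|x| <= r by rewrite ler_norml x1 x2.
  have big : r <= `|x| -> b * nr rho.[z] <= nr (lev n F z x).
    move=> rx; apply: (le_trans (ab z z1)); apply: le_trans (grow z x z1 rx).
    by rewrite ler_peMr ?(ltW a0) // exprn_ege1.
  case: x3 => [xE|xE|dq].
  - by apply: big; rewrite xE normrN ger0_norm // ltW.
  - by apply: big; rewrite xE ger0_norm // ltW.
  have dF : (fib F^`() z).[x%:C] = 0.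
    have : qc^`().[x%:C] = 0.
      by rewrite -(RepolyK rq) deriv_map horner_map dq rmorph0.
    rewrite derivZ hornerZ /fib deriv_map => /eqP.
    by rewrite mulf_eq0 invr_eq0 expf_eq0 (negPf (circ_neq0 z1)) andbF => /eqP.
  have := UP z x z1 xr dF; rewrite -/rho => h.
  apply: (@le_trans _ _ (U^-1 * nr rho.[z])); first by rewrite ler_wpM2r ?nr_ge0.
  by rewrite ler_pdivrMl.
have r2 : 0 < (1 + r ^+ 2) ^+ d.
  by apply: lt_le_trans ltr01 _; rewrite exprn_ege1.
pose k0 := b / (1 + r ^+ 2) ^+ d.
have k00 : 0 < k0 by rewrite divr_gt0.
have k0b : k0 <= b by rewrite ler_pdivrMr // ler_peMr ?(ltW b0) // exprn_ege1.
have all_y z y : `|z| = 1 -> k0 * nr rho.[z] * (1 + y ^+ 2) ^+ d <= nr (lev n F z y).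
  move=> z1; have [yr|yr] := leP r `|y|.
    apply: le_trans (grow z y z1 yr); rewrite ler_wpM2r //.
      by rewrite exprn_ge0 // (le_trans ler01).
    by apply: le_trans (ab z z1); rewrite ler_wpM2r ?nr_ge0.
  apply: le_trans (mid z y z1 (ltW yr)).
  rewrite /k0 -!mulrA ler_wpM2l ?(ltW b0) // mulrCA ler_piMr ?nr_ge0 //.
  rewrite ler_pdivrMl // mulr1 lerXn2r ?nnegrE ?(le_trans ler01) //.
  rewrite lerD2l -(real_normK (num_real y)) lerXn2r ?nnegrE //; exact: ltW.
move: k0 k00 k0b all_y => k0 k00 _ all_y.
(* Only the zeros of the resultant on the circle matter: the other factor [rho0] is bounded below by
   [c]. One factor of the square of [rho1] is bounded by [B1]; the square is wanted because [E] has
   to be a squared modulus. *)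
have [L [rho0 [rhoE L1 rho00]]] := split_circ_roots res0.
have [c c0 cP] := circ_lower rho00.
set rho1 := \prod_(w <- L) _ in rhoE *.
have [B1 B10 B1P] := circ_upper rho1.
exists L, (k0 * c / B1); split=> //; first by rewrite divr_gt0 // mulr_gt0.
move=> z y z1; apply: le_trans (all_y z y z1).
rewrite ler_wpM2r //; first by rewrite exprn_ge0 // (le_trans ler01).
rewrite -/rho1 -!mulrA ler_wpM2l ?(ltW k00) // rhoE hornerM nrM.
rewrite [X in _ <= X]mulrC; apply: ler_pM; rewrite ?(ltW c0) ?cP //.
  by rewrite mulr_ge0 ?exprn_ge0 ?nr_ge0 // invr_ge0 ltW.
by rewrite ler_pdivrMl // expr2 ler_wpM2r ?nr_ge0 // B1P.
Qed.

End LowerBound.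

(** * Patching the local factorizations *)

Section Crt.
Variable K : fieldType.
Implicit Types (s : seq K) (q : {poly K}).

Lemma coprimep_XsubC_prod M a s : a \notin s ->
  coprimep (('X - a%:P) ^+ M) (\prod_(b <- s) ('X - b%:P) ^+ M).
Proof.
move=> nas; rewrite coprimep_expl // coprimep_sym big_seq.
apply: (big_ind (fun q => coprimep q ('X - a%:P))).
- exact: coprime1p.
- by move=> p q hp hq; rewrite coprimepMl hp hq.
move=> b bs; rewrite coprimep_expl // coprimep_XsubC root_XsubC.
by apply: contraNneq nas => ->.
Qed.

Lemma dvdp_prod_XsubC_exp M s q : uniq s ->
  (forall a, a \in s -> ('X - a%:P) ^+ M %| q) -> \prod_(a <- s) ('X - a%:P) ^+ M %| q.
Proof.
elim: s => [|a s IH] /=; first by rewrite big_nil dvd1p.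
case/andP => nas us h; rewrite big_cons Gauss_dvdp ?coprimep_XsubC_prod //.
rewrite h ?inE ?eqxx //=; apply: IH => // b bs; apply: h.
by rewrite inE bs orbT.
Qed.

Lemma size_prod_XsubC_exp M s :
  size (\prod_(a <- s) ('X - a%:P) ^+ M : {poly K}) = (M * size s).+1.
Proof.
elim: s => [|a s IH]; first by rewrite big_nil size_poly1 muln0.
have m1 : \prod_(b <- s) ('X - b%:P) ^+ M \is @monic K.
  by apply: monic_prod => b _; rewrite monic_exp // monicXsubC.
rewrite big_cons size_monicM ?monic_exp ?monicXsubC ?monic_neq0 //.
by rewrite size_exp_XsubC IH /= addnS mulnS.
Qed.

Lemma poly_crt M s (f : K -> {poly K}) : uniq s ->
  exists2 g : {poly K}, (size g <= (M * size s))%N &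
    forall a, a \in s -> ('X - a%:P) ^+ M %| g - f a.
Proof.
move=> us; suff [g gP] : exists g : {poly K}, forall a, a \in s -> ('X - a%:P) ^+ M %| g - f a.
  exists (g %% (\prod_(a <- s) ('X - a%:P) ^+ M)).
    rewrite -ltnS -size_prod_XsubC_exp ltn_modp -size_poly_eq0 size_prod_XsubC_exp //.
  move=> a ha; set P := \prod_(_ <- s) _.
  have -> : g %% P - f a = (g - f a) - (g %/ P) * P.
    by rewrite {2}(divp_eq g P) addrAC [_ + g %% P]addrC addrK.
  rewrite dvdp_sub ?gP // dvdp_mull // /P (big_rem a) //=.
  exact: dvdp_mulIl.
elim: s us => [|a s IH] /=; first by exists 0.
case/andP => nas /IH[g gP].
have /Bezout_eq1_coprimepP[[u v] /= uv] := coprimep_XsubC_prod M nas.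
set P := \prod_(_ <- s) _ in uv; set A := _ ^+ M in uv.
exists (g + v * P * (f a - g)) => b; rewrite inE => /orP[/eqP->|bs].
  have -> : g + v * P * (f a - g) - f a = (u * (g - f a)) * A.
    have -> : v * P = 1 - u * A by rewrite -uv addrAC subrr add0r.
    by ring.
  exact: dvdp_mulIr.
have -> : g + v * P * (f a - g) - f b = (g - f b) + P * (v * (f a - g)) by ring.
rewrite dvdp_add ?gP // dvdp_mulr // /P (big_rem b) //=; exact: dvdp_mulIl.
Qed.

End Crt.

(** * Transport from the Cayley chart back to the circle *)

Section Patch.
Variable R : realType.
Notation C := R[i].
Notation I := (@Num.imaginary C).
Local Open Scope complex_scope.
Implicit Types (F G : {poly {poly C}}) (z P : C) (y : R) (p q : {poly C}).
Notation fcj := (fmap (@Num.conj C)).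
Notation pcj := (map_poly fcj).

(** The homogenization of degree [N], equal to [chA P ^ N] times [p] at [t = chB P / chA P]: it
    turns a polynomial in the chart coordinate into one in [z]. *)
Definition hom P N p : {poly C} := \sum_(k < N.+1) p`_k *: (chB P ^+ k * chA P ^+ (N - k)).

Lemma homB P N p q : hom P N (p - q) = hom P N p - hom P N q.
Proof. by rewrite /hom -sumrB; apply: eq_bigr => k _; rewrite coefB scalerBl. Qed.
Lemma hom_sum P N I (r : seq I) (f : I -> {poly C}) :
  hom P N (\sum_(i <- r) f i) = \sum_(i <- r) hom P N (f i).
Proof.
rewrite /hom exchange_big; apply: eq_bigr => k _.
by rewrite coef_sum scaler_suml.
Qed.

Lemma horner_hom P N p z : (size p <= N.+1)%N -> (chA P).[z] != 0 ->
  (hom P N p).[z] = (chA P).[z] ^+ N * p.[(chB P).[z] / (chA P).[z]].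
Proof.
move=> sp a0; rewrite horner_sum (horner_coef_wide _ sp) mulr_sumr.
apply: eq_bigr => k _; rewrite hornerZ hornerM !horner_exp.
have le_k : (k <= N)%N by rewrite -ltnS.
have ak : (chA P).[z] ^+ k != 0 by rewrite expf_neq0.
have e : (chA P).[z] ^+ N = (chA P).[z] ^+ (N - k) * (chA P).[z] ^+ k by rewrite -exprD subnK.
rewrite e exprMn exprVn; move: ak.
move: (_ ^+ k) (_ ^+ k) (_ ^+ (N - k)) => U V W U0.
by rewrite mulrCA -!mulrA; field.
Qed.

Lemma chA_neq0 P : chA P != 0.
Proof.
have : (chA P).[0] != 0.
  by rewrite /chA hornerZ hornerD hornerC hornerZ hornerX mulr0 addr0 mulr1 invr_eq0 pnatr_eq0.
by apply: contra_neq => ->; rewrite horner0.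
Qed.

Lemma chA_poly_eq P p q : (forall z, (chA P).[z] != 0 -> p.[z] = q.[z]) -> p = q.
Proof.
move=> pq; apply/eqP; rewrite -subr_eq0.
have : (p - q) * chA P = 0.
  apply: poly_nat_eq0 => m; rewrite hornerM hornerD hornerN.
  have [->|/pq->] := eqVneq (chA P).[m%:R] 0; first by rewrite mulr0.
  by rewrite subrr mul0r.
by move/eqP; rewrite mulf_eq0 (negPf (chA_neq0 P)) orbF.
Qed.

Lemma homM P N M p q : (size p <= N.+1)%N -> (size q <= M.+1)%N ->
  hom P N p * hom P M q = hom P (N + M) (p * q).
Proof.
move=> sp sq; apply: (@chA_poly_eq P) => z a0.
rewrite hornerM !horner_hom //; last first.
  apply: (leq_trans (size_polyMleq _ _)).
  by have := leq_add sp sq; rewrite addSn addnS; case: (size p + size q)%N.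
by rewrite hornerM exprD mulrACA.
Qed.

Lemma size_hom P N p : (size (hom P N p) <= N.+1)%N.
Proof.
apply: (leq_trans (size_sum _ _ _)); apply/bigmax_leqP => k _.
apply: (leq_trans (size_scale_leq _ _)); apply: (leq_trans (size_chAB _ _ _)).
by rewrite subnKC // -ltnS.
Qed.

Lemma dvd_hom P N M p : (forall k, (k < M)%N -> p`_k = 0) -> chB P ^+ M %| hom P N p.
Proof.
move=> p0; rewrite /hom; apply: (big_ind (fun q => chB P ^+ M %| q)).
- exact: dvdp0.
- by move=> ? ?; apply: dvdp_add.
move=> k _; have [/p0->|le_Mk] := ltnP k M; first by rewrite scale0r dvdp0.
by rewrite -(subnKC le_Mk) exprD -mulrA -mul_polyC dvdp_mull // dvdp_mulIl.
Qed.

Lemma chB_dvd P M q : P != 0 -> chB P ^+ M %| q -> ('X - P%:P) ^+ M %| q.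
Proof.
move=> P0; have I0 := I_neq0 R.
have -> : chB P = ((2 * I)^-1 / P) *: ('X - P%:P).
  rewrite /chB -[RHS]scalerA [P^-1 *: (_ - _)]scalerBr -[P^-1 *: P%:P]mul_polyC.
  by rewrite -polyCM mulVf // polyC1.
rewrite exprZn dvdpZl // expf_neq0 // mulf_neq0 ?invr_neq0 // mulf_neq0 //.
by rewrite pnatr_eq0.
Qed.

(** On the circle, conjugation multiplies both [chA P] and [chB P] by [P / z]; their quotient [t] is
    real, so only the coefficients of [p] get conjugated. *)
Lemma star_hom P N p : `|P| = 1 -> star N (hom P N p) = P ^+ N *: hom P N (map_poly Num.conj p).
Proof.
move=> P1; have P0 := circ_neq0 P1; apply: circ_poly_eq => z z1; have z0 := circ_neq0 z1.
rewrite horner_star ?size_hom // hornerZ !horner_sum rmorph_sum !mulr_sumr.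
apply: eq_bigr => k _; rewrite !hornerZ !hornerM !horner_exp coef_map /=.
have two0 : 2 != 0 :> C by rewrite pnatr_eq0.
have I0 := I_neq0 R.
have hA : (chA P).[z] = 2^-1 * (1 + P^-1 * z) by rewrite /chA !hornerE.
have hB : (chB P).[z] = (2 * I)^-1 * (P^-1 * z - 1) by rewrite /chB !hornerE.
have cP : Num.conj P^-1 = P by rewrite fmorphV /= (circ_conj P1) invrK.
have cz : Num.conj z = z^-1 := circ_conj z1.
have c2 : Num.conj (2^-1 : C) = 2^-1 by rewrite fmorphV rmorph_nat.
have cI : Num.conj ((2 * I)^-1) = - (2 * I)^-1.
  by rewrite fmorphV rmorphM rmorph_nat /= conjCi mulrN invrN.
have ca : Num.conj (chA P).[z] = (chA P).[z] * (P / z).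
  rewrite hA rmorphM rmorphD rmorphM rmorph1 /= c2 cP cz.
  by field; rewrite z0 P0.
have cb : Num.conj (chB P).[z] = (chB P).[z] * (P / z).
  rewrite hB rmorphM rmorphB rmorphM rmorph1 /= cI cP cz.
  by field; rewrite z0 P0 I0.
rewrite !rmorphM !rmorphXn /= ca cb !exprMn.
have le_k : (k <= N)%N by rewrite -ltnS.
have e : z ^+ N * (P ^+ k * z^-1 ^+ k) * (P ^+ (N - k) * z^-1 ^+ (N - k)) = P ^+ N.
  by rewrite -!exprMn -mulrA -exprD subnKC // -exprMn mulrCA mulfV // mulr1.
by rewrite -e; ring.
Qed.

(** The chart at [P] is factored over the power series, the factor is truncated at [t ^ M] and
    homogenized back; agreement modulo [t ^ M] becomes divisibility by the [M]-th power of ['X - P].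
    The nonzero leading coefficient at [P] gives the factor degree exactly [d] in [y]. *)
Lemma local_patch n d F P M : `|P| = 1 -> degz n F -> psdV n F -> size F = d.*2.+1 ->
  (F`_d.*2).[P] != 0 -> (M <= n.+1)%N ->
  exists G, [/\ (size G <= d.+1)%N, zle n G &
    forall i, ('X - P%:P) ^+ M %| (F - G * starF n G)`_i].
Proof.
move=> P1 dF pF sF lead0 Mn; have P0 := circ_neq0 P1.
pose A := chartF n P F.
have fA0 : fib A 0 = P ^- n *: fib F P.
  apply: (@poly_real_eq _ [::]) => y _; rewrite -(rmorph0 (real_complex R)) chart_lev //.
  by rewrite cayley0 expr0n addr0 expr1n rmorph1 mul1r hornerZ.
have A2 : (A`_d.*2).[0] != 0.
  by rewrite -coef_fib fA0 coefZ coef_fib mulf_neq0 // invr_neq0 // expf_neq0.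
have sA : size A = d.*2.+1.
  apply/anti_leq/andP; split; first by rewrite -sF size_poly.
  by apply: contraNT A2; rewrite -ltnNge ltnS => h; rewrite nth_default // horner0.
have leadA : 0 < (lead_coef A).[0].
  have sfA : size (fib A 0) = d.*2.+1.
    apply/anti_leq/andP; split; first by rewrite -sA size_fib.
    by apply: contraNT A2; rewrite -ltnNge ltnS -coef_fib => h; rewrite nth_default.
  rewrite lead_coefE sA /= -coef_fib.
  have := @psd_lead_gt0 R (fib A 0); rewrite lead_coefE sfA /=; apply.
    by move=> y; rewrite -(rmorph0 (real_complex R)); apply: chart_psd.
  by rewrite -size_poly_eq0 sfA.
have [Q QE] := local_sos (chart_psd P1 dF pF) leadA.
have sQc := size_pcj Q.
have sQ : size Q = d.+1.
  have := congr1 (fun u : {poly fps C} => size u) QE.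
  rewrite size_map_inj_poly ?rmorph0 //; last exact: fpol_inj.
  have [->|Q0] := eqVneq Q 0; first by rewrite mul0r -/A sA size_poly0.
  have Qc0 : pcj Q != 0 by rewrite -size_poly_eq0 sQc size_poly_eq0.
  rewrite -/A sA size_mul // sQc addnn; case: (size Q) => // s.
  by rewrite doubleS /= => -[/double_inj ->].
pose t (x : fps C) := ftrunc M x.
have st x : (size (t x) <= n.+1)%N by apply: leq_trans (size_poly _ _) Mn.
pose G := \poly_(i < d.+1) hom P n (t Q`_i).
have hom0 N : hom P N 0 = 0 :> {poly C}.
  by rewrite /hom big1 // => k _; rewrite coef0 scale0r.
have t0 : t 0 = 0 by apply/polyP => i; rewrite coef_poly coef0 if_same.
have GE i : G`_i = hom P n (t Q`_i).
  by rewrite coef_poly; case: ltnP => // h; rewrite (nth_default 0) ?sQ // t0 hom0.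
have zG : zle n G by move=> i; rewrite GE size_hom.
exists G; split=> //; first exact: size_poly.
move=> i; apply: chB_dvd => //; rewrite coefB coefM.
rewrite (chart_inv P0 (dF i)) -/(hom P n.*2 _).
have -> : \sum_(j < i.+1) G`_j * (starF n G)`_(i - j) =
    P ^+ n *: hom P n.*2 (\sum_(j < i.+1) t Q`_j * t (fcj Q`_(i - j))).
  rewrite hom_sum scaler_sumr; apply: eq_bigr => j _.
  rewrite coef_starF !GE star_hom // -scalerAr; congr (_ *: _).
  rewrite -addnn -homM //; congr (hom _ _ _ * hom _ _ _).
  by apply/polyP => k; rewrite coef_map !coef_poly; case: ifP => _ //=; rewrite conjC0.
rewrite -scalerBr -homB -mul_polyC dvdp_mull //; apply: dvd_hom => k lt_kM.
rewrite coefB [X in _ - X]coef_sum.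
have -> : (chart n P F`_i)`_k = fcoef ((map_poly (@fpol C) A)`_i) k.
  by rewrite coef_map fcoef_pol coef_chartF.
rewrite QE coefM fcoef_sum -sumrB big1 // => j _.
by rewrite (fcoefM_trunc _ _ lt_kM) coef_map subrr.
Qed.

Lemma starF_sub n F G : starF n F - starF n G = starF n (F - G).
Proof. by apply/polyP => i; rewrite coefB !coef_starF coefB starB. Qed.

Lemma star_XsubC_exp P M : `|P| = 1 ->
  star M (('X - P%:P) ^+ M) = (- P^-1) ^+ M *: ('X - P%:P) ^+ M.
Proof.
move=> P1; have P0 := circ_neq0 P1; apply: circ_poly_eq => z z1; have z0 := circ_neq0 z1.
rewrite horner_star ?size_exp_XsubC // hornerZ horner_exp hornerXsubC.
rewrite rmorphXn rmorphB /= (circ_conj z1) (circ_conj P1) -!exprMn; congr (_ ^+ _).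
by field; rewrite z0 P0.
Qed.

(** For [|P| = 1], the reflection of ['X - P] is a constant multiple of ['X - P]. *)
Lemma star_dvd n P M q : `|P| = 1 -> (M <= n)%N -> (size q <= n.+1)%N ->
  ('X - P%:P) ^+ M %| q -> ('X - P%:P) ^+ M %| star n q.
Proof.
move=> P1 Mn sq /dvdpP[u qE].
have Xm : ('X - P%:P) ^+ M \is monic by rewrite monic_exp // monicXsubC.
have [u0|u0] := eqVneq u 0.
  have -> : star n q = 0; last exact: dvdp0.
  by rewrite qE u0 mul0r; apply/polyP => i; rewrite coef_poly !coef0 conjC0 if_same.
have su : (size u <= (n - M).+1)%N.
  move: sq; rewrite qE size_Mmonic // size_exp_XsubC addnS /=.
  by rewrite -subSn // leq_subRL ?(leqW Mn) // addnC.
rewrite qE -{1}(subnK Mn) starM // ?size_exp_XsubC //.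
by rewrite star_XsubC_exp // -scalerAr -mul_polyC dvdp_mull // dvdp_mull.
Qed.

Lemma dvd_coefM q F G i : (forall j, q %| F`_j) -> q %| (F * G)`_i.
Proof.
move=> h; rewrite coefM; apply: (big_ind (fun u => q %| u)); first exact: dvdp0.
  by move=> ? ?; apply: dvdp_add.
by move=> j _; rewrite dvdp_mulr.
Qed.

(** The local solutions are glued by the Chinese remainder theorem, one coefficient in [y] at a
    time. *)
Lemma global_patch n d F (L : seq C) M : (forall P, P \in L -> `|P| = 1) -> degz n F ->
  psdV n F -> (size F <= d.*2.+1)%N -> (forall P, P \in L -> (F`_d.*2).[P] != 0) ->
  (M <= n)%N -> (M * size L <= n.+1)%N ->
  exists G, [/\ (size G <= d.+1)%N, zle n G &
    forall P, P \in L -> forall i, ('X - P%:P) ^+ M %| (F - G * starF n G)`_i].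
Proof.
move=> L1 dF pF sF lead0 Mn MLn.
have /choice[g gP] : forall P, exists G, P \in L -> [/\ (size G <= d.+1)%N, zle n G &
    forall i, ('X - P%:P) ^+ M %| (F - G * starF n G)`_i].
  move=> P; have [PL|nPL] := boolP (P \in L); last by exists 0.
  have sF' : size F = d.*2.+1.
    apply/anti_leq; rewrite sF /=; apply: contraNT (lead0 P PL); rewrite -leqNgt => h.
    by rewrite nth_default // horner0.
  by have [G h] := local_patch (L1 P PL) dF pF sF' (lead0 P PL) (leqW Mn); exists G.
have /choice[c cP] : forall i, exists q : {poly C}, (size q <= n.+1)%N /\
    forall P, P \in L -> ('X - P%:P) ^+ M %| q - (g P)`_i.
  move=> i; have [q sq qP] := poly_crt M (fun P => (g P)`_i) (undup_uniq L).
  exists q; split; last by move=> P PL; apply: qP; rewrite mem_undup.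
  by apply: (leq_trans sq); apply: leq_trans MLn; rewrite leq_mul2l size_undup orbT.
pose G := \poly_(i < d.+1) c i.
have zG : zle n G.
  by move=> i; rewrite coef_poly; case: ifP => _; rewrite ?size_poly0 //; case: (cP i).
exists G; split=> //; first exact: size_poly.
move=> P PL i; have [sg zg gd] := gP P PL.
have gG j : ('X - P%:P) ^+ M %| (g P - G)`_j.
  rewrite coefB coef_poly; case: ltnP => h.
    by rewrite -dvdpNr opprB; case: (cP j) => _; apply.
  by rewrite subr0 nth_default ?dvdp0 // (leq_trans sg).
(* [g P] is replaced by [G] in one factor after the other; each error carries [g P - G] or its
   reflection. *)
have -> : F - G * starF n G = (F - g P * starF n (g P)) + (g P - G) * starF n (g P)
   + starF n (g P - G) * G by rewrite -starF_sub; ring.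
have sd j : ('X - P%:P) ^+ M %| (starF n (g P - G))`_j.
  rewrite coef_starF; apply: star_dvd => //; first exact: L1.
  rewrite coefB; apply: (leq_trans (size_polyD _ _)).
  by rewrite geq_max size_polyN zg zG.
rewrite coefD; apply: dvdp_add; last exact: dvd_coefM.
by rewrite coefD; apply: dvdp_add; [exact: gd | exact: dvd_coefM].
Qed.

End Patch.

(** * The algebra of Laurent polynomial functions *)

Section Regular.
Variable R : realType.
Notation C := R[i].
Local Open Scope complex_scope.
Implicit Types (F G : {poly {poly C}}) (z P : C) (y : R) (f g : C -> R -> C).

(** Hiding [n] and [F] makes sums and products of functions immediate; only the degree bound [k] in
    [y] is tracked. It corresponds to [d.*2] for [sosd d]. *)
Definition reg k f := exists n F, [/\ (size F <= k.+1)%N, degz n F &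
  forall z y, `|z| = 1 -> f z y = lev n F z y].

Lemma degz_shift k n F : degz n F -> degz (k + n) ('X^k%:P * F).
Proof.
move=> dF; have : zle (k + n.*2) ('X^k%:P * F).
  by apply: zleM => //; apply: zle_polyC; rewrite size_polyXn.
by apply: zle_leq; rewrite doubleD leq_add2r -addnn leq_addr.
Qed.

Lemma reg_lev k n F : (size F <= k.+1)%N -> degz n F -> reg k (lev n F).
Proof. by exists n, F. Qed.

Lemma reg_ext k f g : (forall z y, `|z| = 1 -> f z y = g z y) -> reg k f -> reg k g.
Proof. by move=> fg [n [F [sF dF fE]]]; exists n, F; split=> // z y z1; rewrite -fg ?fE. Qed.

Lemma reg_leq k l f : (k <= l)%N -> reg k f -> reg l f.
Proof. by move=> kl [n [F [sF dF fE]]]; exists n, F; split=> //; apply: leq_trans sF _. Qed.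

Lemma regD k f g : reg k f -> reg k g -> reg k (fun z y => f z y + g z y).
Proof.
move=> [n [F [sF dF fE]]] [m [G [sG dG gE]]].
exists (m + n)%N, ('X^m%:P * F + 'X^n%:P * G); split.
- apply: (leq_trans (size_polyD _ _)); rewrite geq_max !mul_polyC.
  by rewrite !(leq_trans (size_scale_leq _ _)).
- apply: zleD; first exact: degz_shift.
  by rewrite [(m + n)%N]addnC; apply: degz_shift.
move=> z y z1; rewrite fE // gE // -(lev_shift n m F y z1) -(lev_shift m n G y z1).
by rewrite /lev fibD hornerD mulrDr [(n + m)%N]addnC.
Qed.

Lemma regM k l f g : reg k f -> reg l g -> reg (k + l) (fun z y => f z y * g z y).
Proof.
move=> [n [F [sF dF fE]]] [m [G [sG dG gE]]].
exists (n + m)%N, (F * G); split.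
- apply: (leq_trans (size_polyMleq _ _)).
  by have := leq_add sF sG; rewrite addSn addnS; case: (size F + size G)%N.
- by rewrite /degz doubleD; apply: zleM.
move=> z y z1; rewrite fE // gE // /lev fibM hornerM exprD invfM; ring.
Qed.

Lemma reg_const k (c : C) : reg k (fun _ _ => c).
Proof.
exists 0%N, c%:P%:P; split.
- by apply: (leq_trans (size_polyC_leq1 _)).
- by move=> i; rewrite coefC; case: ifP; rewrite ?size_poly0 // size_polyC_leq1.
by move=> z y _; rewrite /lev fibC !hornerC invr1 mul1r.
Qed.

Lemma regN k f : reg k f -> reg k (fun z y => - f z y).
Proof.
move=> rf; apply: (@reg_ext _ (fun z y => -1 * f z y)); first by move=> z y _; rewrite mulN1r.
exact: (regM (reg_const 0 (-1)) rf).
Qed.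

Lemma reg_sum k m (f : nat -> C -> R -> C) : (forall i, reg k (f i)) ->
  reg k (fun z y => \sum_(i < m) f i z y).
Proof.
move=> rf; elim: m => [|m IH].
  by apply: reg_ext (reg_const k 0) => z y _; rewrite big_ord0.
by apply: reg_ext (regD IH (rf m)) => z y _; rewrite big_ord_recr.
Qed.

Lemma reg0X f m : reg 0 f -> reg 0 (fun z y => f z y ^+ m).
Proof.
move=> rf; elim: m => [|m IH]; first exact: reg_const.
by apply: reg_ext (regM rf IH) => z y _; rewrite exprS.
Qed.

Lemma reg_norm k G : (size G <= k.+1)%N -> reg k.*2 (fun z y => `|(fib G z).[y%:C]| ^+ 2).
Proof.
move=> sG; have [N zN] := zle_exists G; exists N, (G * starF N G); split.
- apply: (leq_trans (size_polyMleq _ _)).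
  have := leq_add sG (leq_trans (size_starF_le N G) sG); rewrite addSn addnS addnn.
  by case: (size G + _)%N.
- by rewrite /degz -addnn; apply: zleM => //; apply: zle_starF.
by move=> z y z1; rewrite lev_norm.
Qed.

Lemma reg_weight d : reg d.*2 (fun _ y => ((1 + y ^+ 2) ^+ d)%:C).
Proof.
exists 0%N, (map_poly polyC ((1 + 'X^2) ^+ d)); split.
- apply: (leq_trans (size_poly _ _)); apply: (leq_trans (size_poly_exp_leq _ _)).
  by rewrite ltnS addrC size_XnaddC // mul2n.
- exact: zle_map.
move=> z y _; rewrite /lev fib_map invr1 mul1r horner_exp hornerD hornerXn hornerC.
by rewrite rmorphXn rmorphD rmorph1 rmorphXn.
Qed.

Lemma reg_bound d f : reg d.*2 f -> exists2 K : R, 0 <= K & forall z y, `|z| = 1 ->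
  `|f z y| <= (K * (1 + y ^+ 2) ^+ d)%:C.
Proof.
move=> [n [F [sF dF fE]]]; exists (csum n d F); first exact: csum_ge0.
by move=> z y z1; rewrite fE //; apply: lev_bound.
Qed.

Lemma reg_strict d f (c : R) : 0 < c -> reg d.*2 f ->
  (forall z y, `|z| = 1 -> (c * (1 + y ^+ 2) ^+ d)%:C <= f z y) -> sosd d f.
Proof.
move=> c0 [n [F [sF dF fE]]] h; apply: (@sosd_ext _ _ (lev n F)).
  by move=> z y z1; rewrite fE.
by apply: (strict_sos c0) => // z y z1; rewrite -fE // h.
Qed.

(** Bernoulli's inequality in the form [x ^ m * (1 + m * (1 - x)) <= 1] gives an explicit [m]. *)
Lemma bernoulli_small (x e K : R) : 0 <= x -> x < 1 -> 0 < e -> 0 <= K ->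
  exists m : nat, x ^+ m * K <= e.
Proof.
move=> x0 x1 e0 K0.
have h m : x ^+ m * (1 + m%:R * (1 - x)) <= 1.
  elim: m => [|m IH]; first by rewrite expr0 mul1r mul0r addr0.
  apply: le_trans IH; rewrite exprS mulrC mulrA -[X in _ <= X]mulrC ler_wpM2r ?exprn_ge0 //.
  rewrite -natr1; have m0 : 0 <= m%:R :> R by rewrite ler0n.
  rewrite -subr_ge0 (_ : _ - _ = (m%:R + 1) * (1 - x) ^+ 2); last by ring.
  by rewrite mulr_ge0 ?sqr_ge0 // addr_ge0.
pose m := Num.bound (K / e / (1 - x)); exists m.
have mP : K / e / (1 - x) < m%:R by rewrite archi_boundP // !divr_ge0 // ?ltW // subr_gt0.
have x10 : 0 < 1 - x by rewrite subr_gt0.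
rewrite ltr_pdivrMr // ltr_pdivrMr // in mP.
have xm : 0 <= x ^+ m by rewrite exprn_ge0.
have := h m; set t := x ^+ m in xm *; set s := m%:R * (1 - x) in mP *.
move=> ht; have : t * K <= t * (s * e) by rewrite ler_wpM2l // ltW.
move=> /le_trans; apply; rewrite mulrA ler_piMl ?(ltW e0) //.
by apply: le_trans ht; rewrite ler_wpM2l // lerDr.
Qed.

End Regular.

(** * The separable case *)

Section Separable.
Variable R : realType.
Notation C := R[i].
Local Open Scope complex_scope.
Implicit Types (F G : {poly {poly C}}) (z P : C) (y : R) (q : {poly C}) (f g : C -> R -> C).

(** On the circle the square of such a product is its squared modulus times a constant and a power
    of [z]; this converts divisibility by [e ^ 4] into a factor [E ^ 2]. *)
Lemma prod_circ_sqr (L : seq C) z : (forall w, w \in L -> `|w| = 1) -> `|z| = 1 ->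
  (\prod_(w <- L) ('X - w%:P)).[z] ^+ 2 =
  z ^+ size L * (\prod_(w <- L) - w) * `|(\prod_(w <- L) ('X - w%:P)).[z]| ^+ 2.
Proof.
move=> L1 z1; elim: L L1 => [|w L IH] L1.
  by rewrite !big_nil hornerC normr1 !expr1n !mulr1.
have zS : z ^+ size (w :: L) = z * z ^+ size L by rewrite -exprS.
rewrite zS !big_cons hornerM hornerXsubC normrM !exprMn IH; last first.
  by move=> v vL; apply: L1; rewrite inE vL orbT.
by rewrite circ_dist ?(L1 w) ?inE ?eqxx //; ring.
Qed.

(** The list of circle roots may have repetitions, whereas the patching works with distinct points;
    this bounds the product over the list by a power of the product over the distinct points. *)
Lemma dvdp_prod_exp (T : eqType) (s : seq T) (h : T -> {poly C}) q :
  (forall x, x \in s -> h x %| q) -> \prod_(x <- s) h x %| q ^+ size s.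
Proof.
elim: s => [|x s IH] hq; first by rewrite big_nil dvd1p.
rewrite big_cons exprS dvdp_mul ?hq ?inE ?eqxx //; apply: IH => u us.
by apply: hq; rewrite inE us orbT.
Qed.

(* the arithmetic behind [psd_sosd_separable]: [E] is the squared modulus of [e], [v] the
   value of [E * kappa], [t] the value of the cut-off, [s] that of [(1 - t) / E] *)
Lemma patch_lower_bound (E W g f v s t K0 K1 eta x : R) :
  0 <= E -> 1 <= W -> 0 <= g -> E * W <= f -> E * v = f - E * W / 2 - g ->
  `|v| <= E * K0 * W -> E * s = 1 - t -> 0 <= s -> 0 <= K0 -> 0 < eta ->
  eta * K0 <= 1 / 4 -> g <= K1 * W -> 0 <= t -> (eta < E -> t <= x) ->
  0 <= K1 -> x * K1 <= 3 / 4 * eta ->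
  W / 4 <= v + s * g + W / 2.
Proof.
move=> E0 W1 g0 fE Ev vK Es s0 K00 eta0 etaK gK t0 tx K10 xK.
have W0 : 0 < W by lra.
have [le_E|lt_E] := leP E eta.
  have h1 : E * K0 * W <= W / 4.
    have : E * K0 <= 1 / 4 by apply: le_trans etaK; rewrite ler_wpM2r.
    by move=> h; have := ler_wpM2r (ltW W0) h; lra.
  have h2 : 0 <= s * g by rewrite mulr_ge0.
  have : - (W / 4) <= v by move: vK; rewrite ler_norml => /andP[h _]; lra.
  by lra.
have Epos : 0 < E by apply: lt_trans eta0 lt_E.
have tg : t * g <= 3 / 4 * E * W.
  apply: (@le_trans _ _ (x * (K1 * W))).
    by apply: ler_pM => //; apply: tx.
  rewrite mulrA ler_wpM2r ?(ltW W0) //; apply: (le_trans xK).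
  by rewrite ler_wpM2l ?divr_ge0 ?ler0n // ltW.
rewrite -(ler_pM2l Epos).
have -> : E * (v + s * g + W / 2) = f - t * g.
  have -> : E * (v + s * g + W / 2) = E * v + E * s * g + E * W / 2 by ring.
  by rewrite Ev Es; ring.
by lra.
Qed.

Theorem psd_sosd_separable n d F : (0 < d)%N -> size F = d.*2.+1 -> degz n F -> psdV n F ->
  (forall z, `|z| = 1 -> (F`_d.*2).[z] != 0) -> resultant F F^`() != 0 ->
  sosd d (lev n F).
Proof.
move=> d0 sF dF pF lead0 res0.
have [L [k [k0 L1 LB]]] := psd_lower_bound d0 sF pF lead0 res0.
set PL := \prod_(w <- L) _ in LB.
(* [e] absorbs the constant [k] of the lower bound, so that [E = |e| ^ 2] satisfies [f >= E W]. *)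
pose s := Num.sqrt k; pose e : {poly C} := s%:C *: PL.
have s0 : s != 0 by rewrite sqrtr_eq0 -ltNge.
have s2 : s ^+ 2 = k by rewrite sqr_sqrtr ?ltW.
pose E z : R := nr e.[z] ^+ 2.
have EC z : (E z)%:C = `|e.[z]| ^+ 2 by rewrite rmorphXn /= nrE.
have E0 z : 0 <= E z by rewrite sqr_ge0.
have EP z : E z = k * nr PL.[z] ^+ 2.
  by rewrite /E hornerZ nrM nr_real exprMn real_normK ?num_real // s2.
pose W y : R := (1 + y ^+ 2) ^+ d.
have W1 y : 1 <= W y by rewrite exprn_ege1 // lerDl sqr_ge0.
have fE z y : `|z| = 1 -> E z * W y <= nr (lev n F z y) by move=> z1; rewrite EP; apply: LB.
(* A root of [e] has multiplicity at most [m], so agreement to order [M = 4 m] at each root gives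
   divisibility by [e ^ 4]. [n1] is simply large enough for all degree conditions below. *)
pose m := size L; pose M := (4 * m)%N; pose n1 := (n + m + M * m + M)%N.
have sPL : size PL = m.+1 by rewrite size_prod_XsubC.
have se : (size e <= m.+1)%N by rewrite -sPL size_scale_leq.
pose Wp : {poly {poly C}} := map_poly polyC ((1 + 'X^2) ^+ d).
have WpE z y : (fib Wp z).[y%:C] = (W y)%:C.
  rewrite fib_map horner_exp hornerD hornerXn hornerC.
  by rewrite rmorphXn rmorphD rmorph1 rmorphXn.
have sWp : (size Wp <= d.*2.+1)%N.
  apply: (leq_trans (size_poly _ _)); apply: (leq_trans (size_poly_exp_leq _ _)).
  by rewrite ltnS addrC size_XnaddC // mul2n.
pose c1 : {poly C} := 2^-1 *: ('X^(n1 - m) * (e * star m e)).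
pose F1 := 'X^(n1 - n)%:P * F - c1%:P * Wp.
have le_n : (n <= n1)%N by rewrite /n1; lia.
have le_m : (m <= n1)%N by rewrite /n1; lia.
have F1E z y : `|z| = 1 -> lev n1 F1 z y = lev n F z y - 2^-1 * (E z)%:C * (W y)%:C.
  move=> z1; have zn j : z ^+ j != 0 by rewrite expf_neq0 // circ_neq0.
  rewrite -(lev_shift n (n1 - n) F y z1) subnK // {1}/lev fibB hornerD hornerN mulrBr.
  congr (_ - _); rewrite fibM fibC hornerM hornerC WpE mulrA; congr (_ * _).
  rewrite /c1 hornerZ !hornerM hornerXn horner_star // EC normCK.
  have e1 : z ^- n1 * (z ^+ (n1 - m) * z ^+ m) = 1 by rewrite -exprD subnK // mulVf.
  rewrite -[RHS]mulr1 -e1; ring.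
have dF1 : degz n1 F1.
  apply: zleD.
    by have := @degz_shift _ (n1 - n) n F dF; rewrite subnK.
  apply: zleN; have : zle (n1 - m + (m + m) + 0) (c1%:P * Wp).
    apply: zleM; last exact: zle_map.
    apply: zle_polyC; apply: (leq_trans (size_scale_leq _ _)).
    rewrite size_monicM ?monicXn //; last first.
      have ne0 : e != 0 by rewrite scaler_eq0 negb_or -size_poly_eq0 sPL andbT (inj_eq (@complexI R)).
      by rewrite mulf_neq0 //; apply: contra_neq ne0; apply: star_eq0.
    rewrite size_polyXn /= -addnS leq_add2l.
    apply: (leq_trans (size_polyMleq _ _)).
    by have := leq_add se (size_star m e); rewrite addSn addnS; case: (_ + _)%N.
  by apply: zle_leq; rewrite addn0 addnA subnK // -addnn leq_add2l.
have sF1 : (size F1 <= d.*2.+1)%N.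
  apply: (leq_trans (size_polyD _ _)); rewrite geq_max size_polyN !mul_polyC.
  by rewrite !(leq_trans (size_scale_leq _ _)) // sF.
have half : 2^-1 = (2^-1)%:C :> C by rewrite fmorphV rmorph_nat.
have levR z y : `|z| = 1 -> lev n F z y = (nr (lev n F z y))%:C.
  by move=> z1; rewrite nrE ger0_norm // pF.
have pF1 : psdV n1 F1.
  move=> z y z1; rewrite F1E // levR // half -!rmorphM -rmorphB /= lecR subr_ge0.
  apply: le_trans (fE z y z1); rewrite -mulrA ler_piMl //.
    by rewrite mulr_ge0 // (le_trans ler01).
  by rewrite invf_le1 ?ler1n.
have e_root P : P \in L -> e.[P] = 0.
  move=> PL'; rewrite hornerZ (rootP _) ?mulr0 // root_prod_XsubC //.
(* [e] vanishes at [P], so subtracting [E W / 2] leaves the leading coefficient there unchanged up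
   to a power of [P]. *)
have lead1 P : P \in L -> (F1`_d.*2).[P] != 0.
  move=> PL'; have P1 := L1 P PL'.
  rewrite coefB !mul_polyC !coefZ hornerD hornerN !hornerM hornerXn.
  rewrite /c1 hornerZ !hornerM (e_root P PL') mul0r !mulr0 mul0r subr0.
  by rewrite mulf_neq0 ?lead0 // expf_neq0 // circ_neq0.
have Mn : (M <= n1)%N by rewrite /n1 leq_addl.
have MLn : (M * size L <= n1.+1)%N by rewrite -/m /n1; lia.
(* [F1] agrees with the squared modulus of [G] up to a multiple of [e ^ 4] *)
have [G [sG zG Gd]] := global_patch L1 dF1 pF1 sF1 lead1 Mn MLn.
set D := F1 - G * starF n1 G in Gd.
have eD i : e ^+ 4 %| D`_i.
  have : \prod_(P <- undup L) ('X - P%:P) ^+ M %| D`_i.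
    apply: dvdp_prod_XsubC_exp; first exact: undup_uniq.
    by move=> P; rewrite mem_undup => PL'; apply: Gd.
  apply: dvdp_trans; rewrite /e exprZn dvdpZl ?expf_neq0 ?(inj_eq (@complexI R)) //.
  rewrite prodrXl /M mulnC exprM; apply: dvdp_exp2r.
  apply: dvdp_prod_exp => w wL; rewrite dvdp_XsubCl root_prod_XsubC mem_undup.
  exact: wL.
pose K := \poly_(i < d.*2.+1) (D`_i %/ e ^+ 4).
have sD : (size D <= d.*2.+1)%N.
  apply: (leq_trans (size_polyD _ _)); rewrite geq_max sF1 size_polyN.
  apply: (leq_trans (size_polyMleq _ _)); have := leq_add sG (leq_trans (size_starF_le n1 G) sG).
  by rewrite addSn addnS addnn; case: (size G + _)%N.
have DK : D = (e ^+ 4) *: K.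
  apply/polyP => i; rewrite coefZ coef_poly; case: ltnP => h.
    by rewrite mulrC divpK.
  by rewrite mulr0 nth_default // (leq_trans sD).
have sK : (size K <= d.*2.+1)%N by apply: size_poly.
pose et : C := \prod_(w <- L) - w.
have [n2 [K2 [sK2 dK2 K2E]]] := lev_normalize (2 * m) n1 ((et ^+ 2)%:P *: K).
pose ka := lev n2 K2.
have kaE z y : `|z| = 1 -> lev n1 F1 z y = `|(fib G z).[y%:C]| ^+ 2 + (E z)%:C ^+ 2 * ka z y.
  move=> z1; have -> : F1 = D + G * starF n1 G by rewrite /D subrK.
  rewrite {1}/lev fibD hornerD mulrDr addrC -/(lev n1 _ z y) lev_norm //; congr (_ + _).
  rewrite /ka K2E // DK !fib_scale !hornerZ horner_exp hornerC EC.
  have e2 : e.[z] ^+ 2 = z ^+ m * et * `|e.[z]| ^+ 2.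
    rewrite hornerZ exprMn prod_circ_sqr // -/et -/m normrM exprMn.
    have -> : `|s%:C| ^+ 2 = s%:C ^+ 2 :> C by rewrite normRC -!rmorphXn /= real_normK ?num_real.
    by ring.
  have -> : e.[z] ^+ 4 = (e.[z] ^+ 2) ^+ 2 by rewrite -exprM.
  rewrite e2 mulnC exprM; ring.
have rka : reg d.*2 ka by apply: reg_lev => //; apply: (leq_trans sK2); apply: (leq_trans (size_scale_leq _ _)).
have rg : reg d.*2 (fun z y => `|(fib G z).[y%:C]| ^+ 2) by apply: reg_norm.
have [K0 K00 kaK] := reg_bound rka.
have [K1 K10 gK] := reg_bound rg.
have [B B0 eB] := circ_upper e.
have B20 : 0 < B ^+ 2 by rewrite exprn_gt0.
have EB z : `|z| = 1 -> E z <= B ^+ 2.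
  by move=> z1; rewrite lerXn2r ?nnegrE ?nr_ge0 ?(ltW B0) // eB.
pose b := (B ^+ 2)^-1; have b0 : 0 < b by rewrite invr_gt0.
have bE z : `|z| = 1 -> b * E z <= 1.
  by move=> z1; rewrite ler_pdivrMl // mulr1 EB.
(* The first bound gives [E * K0 <= 1 / 4] wherever [E <= eta]; the second keeps [1 - b * eta]
   nonnegative. *)
pose eta := Num.min (4 * K0 + 4)^-1 (B ^+ 2).
have K04 : 0 < 4 * K0 + 4 by rewrite ltr_wpDl // mulr_ge0.
have eta0 : 0 < eta by rewrite lt_min invr_gt0 K04 B20.
have etaK : eta * K0 <= 1 / 4.
  apply: (@le_trans _ _ ((4 * K0 + 4)^-1 * K0)).
    by rewrite ler_wpM2r // ge_min lexx.
  rewrite ler_pdivrMl // (_ : _ * (1 / 4) = K0 + 1); last by field.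
  by rewrite lerDl.
have etaB : b * eta <= 1 by rewrite ler_pdivrMl // mulr1 ge_min lexx orbT.
pose x := 1 - b * eta.
have x0 : 0 <= x by rewrite subr_ge0.
have x1 : x < 1 by rewrite /x ltrBlDr ltrDl mulr_gt0.
have eta34 : 0 < 3 / 4 * eta by rewrite mulr_gt0 // divr_gt0.
have [N' N'P] := bernoulli_small x0 x1 eta34 K10.
(* The even exponent makes [tau] the squared modulus of [T ^ N'] below; [sig] is [(1 - tau) / E]
   written as a geometric sum, hence a polynomial in [E]. *)
pose tau z : R := (1 - b * E z) ^+ N'.*2.
pose sig z : R := b * \sum_(i < N'.*2) (1 - b * E z) ^+ i.
have E_sig z : E z * sig z = 1 - tau z.
  rewrite /sig /tau mulrA [E z * b]mulrC; set t := 1 - b * E z.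
  have -> : b * E z = 1 - t by rewrite /t opprB addrCA subrr addr0.
  by rewrite -(opprB t 1) mulNr -subrX1 opprB.
(* the quotient by [E] of [F - tau * `|G| ^ 2] *)
pose h z y : C := (E z)%:C * ka z y + (sig z)%:C * `|(fib G z).[y%:C]| ^+ 2 + 2^-1 * (W y)%:C.
have rE : reg 0 (fun z _ => (E z)%:C).
  apply: (@reg_ext _ _ (fun z y => `|(fib e%:P z).[y%:C]| ^+ 2)).
    by move=> z y _; rewrite fibC hornerC EC.
  by apply: (@reg_norm _ 0); rewrite size_polyC_leq1.
have rh : reg d.*2 h.
  have rbE : reg 0 (fun z _ => (1 - b * E z)%:C).
    apply: (@reg_ext _ _ (fun z _ => 1 + - (b%:C * (E z)%:C))).
      by move=> z y _; rewrite [RHS]rmorphB rmorph1 [X in _ = _ - X]rmorphM.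
    by apply: regD; [exact: reg_const | apply/regN/(regM (reg_const 0 _) rE)].
  have rsig : reg 0 (fun z _ => (sig z)%:C).
    apply: (@reg_ext _ _ (fun z _ => b%:C * \sum_(i < N'.*2) (1 - b * E z)%:C ^+ i)).
      move=> z y _; rewrite rmorphM rmorph_sum; congr (_ * _).
      by apply: eq_bigr => i _; rewrite rmorphXn.
    apply: (regM (reg_const 0 _)).
    by apply: (@reg_sum _ 0 _ (fun i z _ => (1 - b * E z)%:C ^+ i)) => i; apply: reg0X.
  apply: regD; first apply: regD.
  - exact: (regM rE rka).
  - exact: (regM rsig rg).
  - exact: (regM (reg_const 0 _) (reg_weight _ d)).
have h_id z y : `|z| = 1 ->
    lev n F z y = (tau z)%:C * `|(fib G z).[y%:C]| ^+ 2 + (E z)%:C * h z y.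
  move=> z1; have fE1 : lev n F z y = lev n1 F1 z y + 2^-1 * (E z)%:C * (W y)%:C.
    by rewrite F1E // subrK.
  rewrite fE1 kaE // /h.
  have -> : (tau z)%:C = 1 - (E z)%:C * (sig z)%:C.
    by rewrite -rmorphM E_sig rmorphB rmorph1 opprB addrC subrK.
  by ring.
have h_low z y : `|z| = 1 -> (4^-1 * (1 + y ^+ 2) ^+ d)%:C <= h z y.
  move=> z1; pose gr : R := nr (fib G z).[y%:C] ^+ 2.
  have gE : `|(fib G z).[y%:C]| ^+ 2 = gr%:C by rewrite /gr rmorphXn /= nrE.
  pose fr := nr (lev n F z y).
  have Eka2 : (E z)%:C * ((E z)%:C * ka z y) = (fr - E z * W y / 2 - gr)%:C.
    have := kaE z y z1; rewrite F1E // levR // gE -/fr half => e1.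
    have -> : (fr - E z * W y / 2 - gr)%:C = fr%:C - (2^-1)%:C * (E z)%:C * (W y)%:C - gr%:C.
      by move: fr gr (E z) (W y) {e1 gE} => r1 r2 r3 r4; rewrite !rmorphB !rmorphM /=; ring.
    rewrite e1; ring.
  (* Dividing by [E] shows that [E * ka] is real when [E] is nonzero; where [E = 0] the product is
     zero, whatever [ka] is. *)
  have [v vE] : exists v : R, (E z)%:C * ka z y = v%:C.
    have [Ez|Ez] := eqVneq (E z) 0; first by exists 0; rewrite Ez mul0r.
    exists ((fr - E z * W y / 2 - gr) / E z).
    have Ez' : (E z)%:C != 0 by rewrite (inj_eq (@complexI R)).
    by apply: (mulfI Ez'); rewrite Eka2 -rmorphM [X in _ = real_complex _ X]mulrC divfK.
  have Ev : E z * v = fr - E z * W y / 2 - gr.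
    by apply: (@complexI R); rewrite rmorphM /= -vE Eka2.
  have vK : `|v| <= E z * K0 * W y.
    rewrite -lecR -normRC -vE normrM normRC (ger0_norm (E0 z)) -[E z * K0 * W y]mulrA.
    rewrite [X in _ <= X]rmorphM; apply: ler_pM => //; first by rewrite ler0c E0.
    exact: kaK.
  have -> : h z y = (v + sig z * gr + W y / 2)%:C.
    rewrite /h vE gE half !rmorphD !rmorphM /=; ring.
  have t01 : 0 <= 1 - b * E z by rewrite subr_ge0 bE.
  have t1 : 1 - b * E z <= 1 by rewrite lerBlDr lerDl mulr_ge0 // ltW.
  rewrite lecR [4^-1 * _]mulrC -/(W y); apply: (@patch_lower_bound (E z) (W y) gr fr v (sig z) (tau z) K0 K1 eta (x ^+ N')) => //.
  - exact: sqr_ge0.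
  - exact: fE.
  - by rewrite mulr_ge0 ?(ltW b0) // sumr_ge0 // => i _; rewrite exprn_ge0.
  - rewrite -lecR -gE; apply: le_trans (gK z y z1).
    by rewrite normrX normr_id lexx.
  - by rewrite exprn_ge0.
  - move=> lt_E; apply: (@le_trans _ _ ((1 - b * E z) ^+ N')).
      by rewrite /tau -addnn exprD ler_piMl ?exprn_ge0 // exprn_ile1.
    rewrite lerXn2r ?nnegrE // lerD2l lerN2 ler_wpM2l ?(ltW b0) //; exact: ltW.
have sh : sosd d h by apply: (@reg_strict _ _ _ 4^-1) => //; rewrite invr_gt0.
pose T : {poly C} := 'X^m - b%:C *: (e * star m e).
have TE z : `|z| = 1 -> `|T.[z]| ^+ 2 = ((1 - b * E z) ^+ 2)%:C.
  move=> z1; have -> : T.[z] = z ^+ m * (1 - b * E z)%:C.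
    rewrite hornerD hornerN hornerZ hornerXn hornerM horner_star // rmorphB rmorphM /= rmorph1 EC normCK.
    by ring.
  rewrite normrM normrX z1 expr1n mul1r normRC -rmorphXn /= real_normK ?num_real //.
apply: (@sosd_ext _ _ (fun z y => `|(fib ((T ^+ N')%:P * G) z).[y%:C]| ^+ 2 +
   `|(fib e%:P z).[y%:C]| ^+ 2 * h z y)).
  move=> z y z1; rewrite h_id // fibM hornerM !fibC !hornerC normrM exprMn EC; congr (_ * _ + _).
  rewrite horner_exp normrX exprAC TE // -rmorphXn /= /tau.
  by rewrite -exprM mul2n.
apply: sosdD; last by apply: (@sosdMnorm _ d 0) => //; rewrite size_polyC_leq1.
by apply: sosd_norm; rewrite mul_polyC; apply: (leq_trans (size_scale_leq _ _)).
Qed.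
End Separable.

(** * The induction *)

Section Reversal.
Variable K : fieldType.
Implicit Types (F : {poly {poly K}}) (z y c : K).

Definition revp m F : {poly {poly K}} := \poly_(i < m.+1) F`_(m - i).

Definition shiftp c F : {poly {poly K}} := F \Po map_poly polyC ('X + c%:P).

Lemma size_shiftp c F : size (shiftp c F) = size F.
Proof.
rewrite size_comp_poly2 // size_map_inj_poly ?polyC0 //; last exact: polyC_inj.
by rewrite size_XaddC.
Qed.

Lemma fib_shiftp c F z y : (fib (shiftp c F) z).[y] = (fib F z).[y + c].
Proof. by rewrite /fib map_comp_poly horner_comp -!/(fib _ z) fib_map !hornerE. Qed.

Lemma fib_revp m F z y : (size F <= m.+1)%N -> y != 0 ->
  (fib (revp m F) z).[y] = y ^+ m * (fib F z).[y^-1].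
Proof.
move=> sF y0.
have sr : (size (fib (revp m F) z) <= m.+1)%N.
  by apply: (leq_trans (size_fib _ _)); apply: size_poly.
rewrite (horner_coef_wide _ sr) (horner_coef_wide _ (leq_trans (size_fib F z) sF)).
rewrite [LHS](reindex_inj rev_ord_inj) mulr_sumr; apply: eq_bigr => i _.
rewrite !coef_map coef_poly /= subSS ltnS leq_subr subKn -1?ltnS //.
rewrite mulrCA; congr (_ * _); rewrite exprVn expfB_cond; last by rewrite (negPf y0) add0n -ltnS.
by [].
Qed.

End Reversal.

Section Main.
Variable R : realType.
Notation C := R[i].
Local Open Scope complex_scope.
Implicit Types (F G H : {poly {poly C}}) (z P : C) (y c : R) (p q : {poly C}) (f g : C -> R -> C).

Lemma zle_shiftp N F (c : C) : zle N F -> zle N (shiftp c F).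
Proof.
move=> zF; rewrite /shiftp comp_polyE.
apply: (big_ind (zle N)); first by apply: zle_polyC; rewrite size_poly0.
  by move=> G H; apply: zleD.
move=> i _; rewrite -mul_polyC -[N]addn0; apply: zleM; first exact: zle_polyC.
by rewrite -rmorphXn; apply: zle_map.
Qed.

Lemma zle_revp N m F : zle N F -> zle N (revp m F).
Proof. by move=> zF i; rewrite coef_poly; case: ifP; rewrite ?size_poly0. Qed.

Lemma sosd_leq d e f : (d <= e)%N -> sosd d f -> sosd e f.
Proof.
by move=> de [s [sd fs]]; exists s; split=> // G /sd sG; apply: (leq_trans sG).
Qed.

(** By [psd_poly_norm], each fibre over the circle is a polynomial times its conjugate up to a power
    of [z], so its degree is even. *)
Lemma psdV_size_odd n k F : psdV n F -> (size F <= k.*2.+2)%N -> (size F <= k.*2.+1)%N.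
Proof.
move=> pF sF; suff F0 : F`_k.*2.+1 = 0.
  move: sF; rewrite leq_eqVlt => /predU1P[sF|] //.
  have /eqP := F0; rewrite -[k.*2.+1]/(k.*2.+2.-1) -sF -lead_coefE lead_coef_eq0.
  by move=> /eqP->; rewrite size_poly0.
apply: circ_poly_eq => z z1; rewrite horner0.
pose q := z ^- n *: fib F z.
have qE y : q.[y%:C] = lev n F z y by rewrite hornerZ.
have [y|p [pE _]] := @psd_poly_norm _ q; first by rewrite qE pF.
have qp : q = p * map_poly Num.conj p.
  by apply: (@poly_real_eq _ [::]) => y _; rewrite pE hornerM horner_conj normCK.
have q0 : q`_k.*2.+1 = 0.
  have sq : (size q <= k.*2.+2)%N.
    by apply: (leq_trans (size_scale_leq _ _)); apply: leq_trans sF; apply: size_fib.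
  move: sq; rewrite leq_eqVlt => /predU1P[sq|]; last exact: nth_default.
  have p0 : p != 0 by apply: contra_eq_neq sq => p0; rewrite qp p0 mul0r size_poly0.
  have /(congr1 odd) := sq.
  rewrite qp size_mul ?map_poly_eq0 // size_map_poly addnn.
  by move: p0; rewrite -size_poly_gt0; case: (size p) => // m _ /=; rewrite !odd_double.
have /eqP := q0; rewrite coefZ coef_fib mulf_eq0 invr_eq0 expf_eq0.
by rewrite (negPf (circ_neq0 z1)) andbF => /eqP.
Qed.

Lemma psdV_zero_deriv n F z y : psdV n F -> `|z| = 1 -> lev n F z y = 0 ->
  (fib F^`() z).[y%:C] = 0.
Proof.
move=> pF z1 l0; pose q := z ^- n *: fib F z.
have qE x : q.[x%:C] = lev n F z x by rewrite hornerZ.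
pose r := q \Po ('X + y%:C%:P).
have rE x : r.[x%:C] = lev n F z (x + y) by rewrite horner_comp hornerD hornerX hornerC -rmorphD qE.
have r0 : r`_0 = 0 by rewrite -horner_coef0 -[0]/(0%:C) rE add0r.
have r1 : r`_1 = 0 by apply: poly_nonneg_root0 => // x; rewrite rE pF.
have : r^`().[0] = 0 by rewrite horner_coef0 coef_deriv r1 mul0rn.
rewrite deriv_comp derivD derivX derivC addr0 mulr1 horner_comp hornerD hornerX hornerC add0r.
rewrite derivZ hornerZ /fib deriv_map => /eqP.
by rewrite mulf_eq0 invr_eq0 expf_eq0 (negPf (circ_neq0 z1)) andbF => /eqP.
Qed.

(* After the substitution [y |-> c + 1 / y] the leading coefficient in [y] does not
   vanish on the circle. *)
Lemma good_shift n d F : (0 < d)%N -> size F = d.*2.+1 -> psdV n F ->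
  resultant F F^`() != 0 -> (forall z, `|z| = 1 -> fib F z != 0) ->
  exists c, forall z, `|z| = 1 -> (fib F z).[c%:C] != 0.
Proof.
move=> d0 sF pF res0 fF; have [L [q0 [rE L1 q00]]] := split_circ_roots res0.
(* A real zero of a fibre is also a zero of the [y]-derivative, by nonnegativity, and so forces the
   resultant to vanish at [z]. Hence only the fibres over [L] can have real zeros, and [c] has to
   avoid the roots of their product. *)
pose Q := \prod_(P <- L) fib F P.
have Q0 : Q != 0 by rewrite prodf_seq_neq0; apply/allP => P /L1 /fF ->.
have [c Qc] : exists c : nat, Q.[c%:R] != 0.
  apply: contrapT => /forallNP h; case/eqP: Q0; apply: poly_nat_eq0 => c.
  by apply: contrapT => /eqP /h.
exists c%:R => z z1; apply/eqP => Fc.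
have l0 : lev n F z c%:R = 0 by rewrite /lev Fc mulr0.
have r1 : 1 <= Num.max 1 `|c%:R : R| by rewrite le_max lexx.
have [U U0 UP] := psd_bezout_bound d0 sF pF r1.
have := UP z c%:R z1 _ (psdV_zero_deriv pF z1 l0).
rewrite le_max lexx orbT => /(_ isT); rewrite l0 /nr normr0 mulr0 => h.
have /eqP : (resultant F F^`()).[z] = 0.
  apply/eqP; rewrite -normr_eq0 -nrE (inj_eq (@complexI R)).
  by rewrite eq_le nr_ge0 andbT.
rewrite rE hornerM mulf_eq0 (negPf (q00 z z1)) orbF => zL.
have {}zL : z \in L by rewrite -root_prod_XsubC.
case/eqP: Qc; rewrite /Q horner_prod (big_rem z zL) /=.
by move: Fc; rewrite rmorph_nat => ->; rewrite mul0r.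
Qed.

(** The factor [(y - c) ^ (2 d)] clears the denominators of squares of polynomials of degree at most
    [d] in [1 / (y - c)]; at [y = c] the identity follows because both sides are polynomials in
    [y]. *)
Lemma sosd_mobius d n c F g : (size F <= d.*2.+1)%N -> sosd d g ->
  (forall z y, `|z| = 1 -> y != c ->
    lev n F z y = ((y - c) ^+ d.*2)%:C * g z (y - c)^-1) ->
  sosd d (lev n F).
Proof.
move=> sF [s [sd gs]] Fg; pose tr G := shiftp (- c%:C) (revp d G).
exists [seq tr G | G <- s]; split.
  by move=> _ /mapP[G _ ->]; rewrite size_shiftp; apply: size_poly.
move=> z y z1; rewrite big_map.
pose q := z ^- n *: fib F z.
pose r := \sum_(G <- s) fib (tr G) z * map_poly Num.conj (fib (tr G) z).
have rE x : r.[x%:C] = \sum_(G <- s) `|(fib (tr G) z).[x%:C]| ^+ 2.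
  by rewrite horner_sum; apply: eq_bigr => G _; rewrite hornerM horner_conj normCK.
rewrite -rE; suff <- : q = r by rewrite hornerZ.
apply: (@poly_real_eq _ [:: c]) => x; rewrite inE => xc.
have xc0 : x - c != 0 by rewrite subr_eq0.
rewrite rE hornerZ -/(lev n F z x) Fg // gs // mulr_sumr big_seq [RHS]big_seq.
apply: eq_bigr => G /sd sG; rewrite fib_shiftp -rmorphB fib_revp //; last first.
  by rewrite (inj_eq (@complexI R)).
rewrite fmorphV normrM exprMn; congr (_ * _).
by rewrite normrX normRC exprAC -rmorphXn /= real_normK ?num_real // -rmorphXn /= -exprM mul2n.
Qed.

Lemma factor_sosd n d F : (0 < d)%N -> psdV n F -> (size F <= d.*2.+1)%N -> F != 0 ->
  resultant F F^`() = 0 ->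
  (forall e m H, (e < d)%N -> (size H <= e.*2.+1)%N -> degz m H -> psdV m H ->
     sosd e (lev m H)) ->
  sosd d (lev n F).
Proof.
move=> d0 pF sF F0 /eqP; rewrite resultant_eq0 => res IH.
have [p [H [m [p1 sH dH pH FE]]]] := factor_step pF F0 res.
apply: (@sosd_ext _ _ (fun z y => `|(fib p z).[y%:C]| ^+ 2 * lev m H z y)).
  by move=> z y z1; rewrite FE.
case sp: (size p) p1 sH => [|[|e]] //= _ sH.
have {}sH := leq_trans sH sF.
have ed : (e.+1 <= d)%N.
  by have := half_leq (leq_trans (leq_addl _ _) sH); rewrite doubleK /= uphalf_double.
rewrite -(subnKC ed); apply: sosdMnorm; [by rewrite sp | apply: IH => //].
  by rewrite ltn_subrL.
by rewrite -(leq_add2r e.+1.*2) addSn doubleB subnK ?leq_double.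
Qed.

Lemma primitive_sosd n d F : (size F <= d.*2.+1)%N -> degz n F -> psdV n F ->
  (forall z, `|z| = 1 -> fib F z != 0) ->
  (forall e m H, (e < d)%N -> (size H <= e.*2.+1)%N -> degz m H -> psdV m H ->
     sosd e (lev m H)) ->
  sosd d (lev n F).
Proof.
(* For [d = 0], [F] depends on [z] alone and has no zero on the circle, so [strict_sos] applies at
   once. *)
case: d => [|d] sF dF pF fF IH.
  have FE : F = (F`_0)%:P by apply: size1_polyC.
  have [z /fF|c c0 cP] := @circ_lower _ F`_0.
    by rewrite {1}FE fibC polyC_eq0.
  apply: (strict_sos c0) => // z y z1.
  rewrite expr0 mulr1 -[lev n F z y]ger0_norm ?pF // -nrE lecR /lev nrM nr_V nrX nr_circ //.
  by rewrite expr1n invr1 mul1r FE fibC hornerC cP.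
move: sF; rewrite leq_eqVlt => /predU1P[sF|sF]; last first.
  apply: (@sosd_leq d) => //; apply: IH => //.
  exact: (psdV_size_odd pF).
have F0 : F != 0 by rewrite -size_poly_gt0 sF.
have [res0|res0] := eqVneq (resultant F F^`()) 0.
  by apply: factor_sosd => //; rewrite sF.
have [c cP] := good_shift (ltn0Sn d) sF pF res0 fF.
pose Fr := revp d.+1.*2 (shiftp c%:C F).
have sFr : (size Fr <= d.+1.*2.+1)%N by apply: size_poly.
have dFr : degz n Fr by apply: zle_revp; apply: zle_shiftp.
have FrE z y : y != 0 -> lev n Fr z y = (y ^+ d.+1.*2)%:C * lev n F z (y^-1 + c).
  move=> y0; rewrite /lev fib_revp ?size_shiftp ?sF //; last by rewrite (inj_eq (@complexI R)).
  by rewrite fib_shiftp mulrCA -fmorphV -rmorphD rmorphXn.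
have pFr : psdV n Fr.
  move=> z y z1.
  have -> : lev n Fr z y = (z ^- n *: fib Fr z).[y%:C] by rewrite hornerZ.
  apply: (@poly_nonneg_except _ [:: 0]) => x; rewrite inE => x0.
  rewrite hornerZ -/(lev n Fr z x) FrE // mulr_ge0 ?pF //.
  by rewrite ler0c -mul2n exprM exprn_ge0 // sqr_ge0.
have leadFr z : `|z| = 1 -> (Fr`_d.+1.*2).[z] != 0.
  move=> z1; rewrite coef_poly ltnSn subnn -coef_fib -horner_coef0 fib_shiftp add0r.
  exact: cP.
have eFr : size Fr = d.+1.*2.+1.
  apply/eqP; rewrite eqn_leq sFr ltnNge; apply/negP => h.
  by have := leadFr 1 (normr1 _); rewrite nth_default // horner0 eqxx.
have sosFr : sosd d.+1 (lev n Fr).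
  (* Separability is not transported from [F] to [Fr]: if the resultant of [Fr] vanishes, a repeated
     factor is divided out once more. *)
  have [resr|resr] := eqVneq (resultant Fr Fr^`()) 0; last exact: psd_sosd_separable.
  by apply: factor_sosd => //; rewrite -size_poly_gt0 eFr.
apply: (@sosd_mobius _ _ c _ _ _ sosFr); first by rewrite sF.
move=> z y z1 yc; have yc0 : y - c != 0 by rewrite subr_eq0.
rewrite FrE ?invr_eq0 // invrK subrK mulrA -rmorphM -exprMn mulfV // expr1n mul1r.
by [].
Qed.

(** The outer induction is on the degree in [y]. The inner one is on the exponent [n], which drops
    by one for each circle zero common to all coefficients. *)
Theorem psd_sosd n d F : (size F <= d.*2.+1)%N -> degz n F -> psdV n F ->
  sosd d (lev n F).
Proof.
elim/ltn_ind: d n F => d IHd; elim=> [|n IHn] F sF dF pF.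
all: have [->|F0] := eqVneq F 0; first by exists [::]; split=> // z y _;
  rewrite big_nil /lev fib0 horner0 mulr0.
all: have [[P [P1 FP]]|/forallNP FP] := pselect (exists P, `|P| = 1 /\ fib F P = 0).
- by rewrite (fib_eq0_degz0 dF FP) eqxx in F0.
- apply: primitive_sosd => // [z z1|e m H ed]; last exact: IHd.
  by apply/eqP => Fz; case: (FP z).
- have [H [sH dH pH FE]] := circle_zero_step P1 dF pF FP.
  apply: (@sosd_ext _ _ (fun z y => `|(fib ('X - P%:P)%:P z).[y%:C]| ^+ 2 * lev n H z y)).
    by move=> z y z1; rewrite FE // fibC hornerC hornerXsubC.
  apply: (@sosdMnorm _ d 0); first exact: size_polyC_leq1.
  by apply: IHn => //; apply: leq_trans sF.
- apply: primitive_sosd => // [z z1|e m H ed]; last exact: IHd.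
  by apply/eqP => Fz; case: (FP z).
Qed.

End Main.

(** * The coordinate ring of the cylinder *)

Lemma mpoly_ring_ind (n : nat) (K : comNzRingType) (P : {mpoly K[n]} -> Prop) :
  (forall c, P c%:MP) -> (forall i, P 'X_i) ->
  (forall f g, P f -> P g -> P (f + g)) -> (forall f g, P f -> P g -> P (f * g)) ->
  forall f, P f.
Proof.
move=> PC PX PD PM; elim/mpolyind => [|c m f _ _ Pf]; first by rewrite -mpolyC0.
have P1 : P 1 by rewrite -mpolyC1.
apply: (PD _ _ _ Pf); rewrite -mul_mpolyC mpolyXE_id; apply: (PM _ _ (PC c)).
apply: (big_ind P P1 PM) => i _; elim: (m i) => [|k IH]; first by rewrite expr0.
by rewrite exprS; apply: PM.
Qed.

Lemma poly_small_eq0 (R : realFieldType) (p : {poly R}) :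
  (forall a, `|a| < 1 -> p.[a] = 0) -> p = 0.
Proof.
move=> hp; apply/eqP; apply: contraT => p0.
pose s : seq R := [seq i.+2%:R^-1 | i <- iota 0 (size p)].
have := @max_poly_roots _ p s p0; rewrite size_map size_iota ltnn => -> //.
  apply/allP => _ /mapP[i _ ->]; apply/rootP/hp.
  by rewrite ger0_norm ?invr_ge0 ?ler0n // invf_lt1 ?ltr0n // ltr1n.
rewrite map_inj_uniq ?iota_uniq // => i j /invr_inj /eqP.
by rewrite eqr_nat !eqSS => /eqP.
Qed.

Section CircleIdeal.
Variable R : realType.
Implicit Types (f g h : {mpoly R[3]}) (A B : {poly {poly R}}) (v : 'I_3 -> R).

Definition point3 (a b y : R) (i : 'I_3) : R := nth 0 [:: a; b; y] i.

Definition bimpoly A : {mpoly R[3]} := (map_poly (horner_alg ('X_(0 : 'I_3) : {mpoly R[3]})) A).['X_(2 : 'I_3)].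

Lemma bimpolyD A B : bimpoly (A + B) = bimpoly A + bimpoly B. Proof. by rewrite /bimpoly rmorphD hornerD. Qed.
Lemma bimpolyM A B : bimpoly (A * B) = bimpoly A * bimpoly B. Proof. by rewrite /bimpoly rmorphM hornerM. Qed.
Lemma bimpolyC (p : {poly R}) : bimpoly p%:P = horner_alg 'X_(0 : 'I_3) p.
Proof. by rewrite /bimpoly map_polyC hornerC. Qed.

Lemma meval_bimpoly A v : (bimpoly A).@[v] = (fib A (v 0)).[v 2].
Proof.
rewrite /bimpoly -horner_map /= mevalXU -map_poly_comp; congr (_.[_]).
apply: eq_map_poly => p /=; rewrite /horner_alg /horner_morph -horner_map /= mevalXU.
rewrite -map_poly_comp /horner_eval; congr (_.[_]).
rewrite -[RHS](@map_poly_id _ id) //; apply: eq_map_poly => c /=.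
by rewrite mevalZ meval1 mulr1.
Qed.

(** Modulo the circle equation [x2 ^ 2] is [1 - x1 ^ 2], so every polynomial reduces to degree at
    most 1 in [x2]; such forms contain the generators and are closed under sums and products. *)
Lemma circ_normal_form f : exists h A B,
  f = h * circ_eq R + bimpoly A + 'X_(1 : 'I_3) * bimpoly B.
Proof.
have mp0 : bimpoly 0 = 0 by rewrite /bimpoly rmorph0 horner0.
have mp1 : bimpoly 1 = 1 by rewrite /bimpoly rmorph1 hornerC.
elim/mpoly_ring_ind: f => [c|i|_ _ [h [A [B ->]]] [h' [A' [B' ->]]]|_ _ [h [A [B ->]]] [h' [A' [B' ->]]]].
- exists 0, c%:P%:P, 0; rewrite mul0r add0r mp0 mulr0 addr0 bimpolyC.
  by rewrite /horner_alg /horner_morph map_polyC hornerC /= -alg_mpolyC.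
- case: i => [[|[|[|//]]] hi].
  + exists 0, ('X)%:P, 0; rewrite mul0r add0r mp0 mulr0 addr0 bimpolyC horner_algX.
    by congr ('X_ _); apply/val_inj.
  + exists 0, 0, 1; rewrite mul0r add0r mp0 mp1 mulr1 add0r.
    by congr ('X_ _); apply/val_inj.
  + exists 0, 'X, 0; rewrite mul0r add0r mp0 mulr0 addr0 /bimpoly map_polyX hornerX.
    by congr ('X_ _); apply/val_inj.
- exists (h + h'), (A + A'), (B + B'); rewrite !bimpolyD; ring.
have mpX : bimpoly ('X%:P) = 'X_(0 : 'I_3) by rewrite bimpolyC horner_algX.
pose U := bimpoly A; pose U' := bimpoly A'; pose V := bimpoly B; pose V' := bimpoly B'.
exists (h * h' * circ_eq R + h * (U' + 'X_(1 : 'I_3) * V') + h' * (U + 'X_(1 : 'I_3) * V) + V * V'),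
  (A * A' + (1 + (- 1%:P%:P) * ('X%:P * 'X%:P)) * (B * B')), (A * B' + A' * B).
have mpN1 : bimpoly (- 1%:P%:P) = -1.
  by rewrite -[RHS]mulN1r mulr1 -[in RHS]mp1 /bimpoly rmorphN hornerN.
rewrite !(bimpolyD, bimpolyM) mp1 mpN1 mpX -/U -/V -/U' -/V' /circ_eq; ring.
Qed.

(** In the normal form [A + x2 B], evaluation at the two real points above each [a] with [|a| < 1]
    gives [A + b B = A - b B = 0] with [b] nonzero, so [A] and [B] vanish at infinitely many [a],
    for every [y]. *)
Lemma circ_ideal g : (forall v, V_real_point v -> g.@[v] = 0) -> exists h, g = h * circ_eq R.
Proof.
have [h [A [B ->]]] := circ_normal_form g => gV; exists h.
have AB a y : `|a| < 1 -> (fib A a).[y] = 0 /\ (fib B a).[y] = 0.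
  move=> a1; have a2 : 0 < 1 - a ^+ 2.
    by rewrite subr_gt0 -(real_normK (num_real a)) exprn_ilt1.
  pose b := Num.sqrt (1 - a ^+ 2).
  have b0 : b != 0 by rewrite sqrtr_eq0 -ltNge.
  have b2 : b ^+ 2 = 1 - a ^+ 2 by rewrite sqr_sqrtr // ltW.
  have E c : c ^+ 2 = 1 - a ^+ 2 -> (fib A a).[y] + c * (fib B a).[y] = 0.
    move=> c2; have vV : V_real_point (point3 a c y) by rewrite /V_real_point /point3 /= c2 addrC subrK.
    have := gV _ vV; rewrite !mevalD !mevalM !meval_bimpoly mevalXU /circ_eq mevalB mevalD.
    by rewrite !rmorphXn /= !mevalXU meval1 vV subrr mulr0 add0r.
  have := E b b2; have := E (- b); rewrite sqrrN => /(_ b2).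
  set s := _.[y]; set t := _.[y] => e1 e2.
  have bt : b * t = 0 by lra.
  have t0 : t = 0 by move/eqP: bt; rewrite mulf_eq0 (negPf b0) => /eqP.
  by move: e2; rewrite t0 mulr0 addr0.
have Z (D : {poly {poly R}}) : (forall a y, `|a| < 1 -> (fib D a).[y] = 0) -> D = 0.
  move=> hD; apply/polyP => i; rewrite coef0; apply: (@poly_small_eq0 R) => a a1.
  have : fib D a = 0 by apply: poly_nat_eq0 => k; apply: hD.
  by move/(congr1 (fun q : {poly R} => q`_i)); rewrite coef_map coef0.
have -> : A = 0 by apply: Z => a y /(AB a y)[].
have -> : B = 0 by apply: Z => a y /(AB a y)[].
by rewrite /bimpoly rmorph0 horner0 mulr0 !addr0.
Qed.

End CircleIdeal.

(** * Real polynomials on the cylinder as Laurent polynomials *)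

Section Translation.
Variable R : realType.
Notation C := R[i].
Local Open Scope complex_scope.
Implicit Types (f g h : {mpoly R[3]}) (G : {poly {poly C}}) (z : C) (y : R).

Definition circ_point z y : 'I_3 -> R := point3 (complex.Re z) (complex.Im z) y.

Lemma circ_Re_Im z : `|z| = 1 -> complex.Re z ^+ 2 + complex.Im z ^+ 2 = 1.
Proof.
move=> z1; have := normCK z; rewrite z1 expr1n; case: z {z1} => a b /= /(congr1 (@complex.Re R)) /=.
by move=> e; rewrite [RHS]e; ring.
Qed.

Lemma circ_inv z : `|z| = 1 -> z^-1 = complex.Re z -i* complex.Im z.
Proof. by move=> z1; rewrite -(circ_conj z1); case: z {z1}. Qed.

(** On the circle [x1 = (z + 1/z) / 2] and [x2 = (z - 1/z) / (2 i)]; the constant [0 -i* 2^-1] below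
    is [1 / (2 i)]. *)
Lemma reg_meval f : exists d, reg d.*2 (fun z y => (f.@[circ_point z y])%:C).
Proof.
suff [k rf] : exists k, reg k (fun z y => (f.@[circ_point z y])%:C).
  by exists k; apply: reg_leq rf; rewrite -addnn leq_addr.
have reg_z : reg 0 (fun z _ => z).
  exists 1%N, ('X^2)%:P; split; first exact: size_polyC_leq1.
    by apply: (@zle_polyC _ 2); rewrite size_polyXn.
  move=> z y z1; rewrite /lev fibC hornerC hornerXn expr1 expr2 mulKf //.
  exact: circ_neq0.
have reg_zV : reg 0 (fun z _ => z^-1).
  exists 1%N, 1%:P; split; first exact: size_polyC_leq1.
    by apply: (@zle_polyC _ 2); rewrite size_poly1.
  by move=> z y z1; rewrite /lev fibC !hornerC expr1 mulr1.
elim/mpoly_ring_ind: f => [c|i|f g [k rf] [l rg]|f g [k rf] [l rg]].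
- by exists 0%N; apply: reg_ext (reg_const 0 c%:C) => z y _; rewrite mevalC.
- case: i => [[|[|[|//]]] hi].
  + exists 0%N; apply: reg_ext (regM (reg_const 0 (2^-1)%:C) (regD reg_z reg_zV)) => z y z1.
    rewrite mevalXU /circ_point /point3 /= circ_inv //; case: z z1 => a b _ /=.
    by apply/eqP; rewrite eq_complex /=; apply/andP; split; apply/eqP; field.
  + exists 0%N; apply: reg_ext (regM (reg_const 0 (0 -i* 2^-1)) (regD reg_z (regN reg_zV))) => z y z1.
    rewrite mevalXU /circ_point /point3 /= circ_inv //; case: z z1 => a b _ /=.
    by apply/eqP; rewrite eq_complex /=; apply/andP; split; apply/eqP; field.
  + exists 1%N, 0%N, 'X; split; first by rewrite size_polyX.
      by rewrite -[X in degz _ X](map_polyX polyC); apply: zle_map.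
    by move=> z y z1; rewrite mevalXU /lev fibXX hornerX invr1 mul1r.
- exists (maxn k l); apply: reg_ext (regD (reg_leq (leq_maxl k l) rf) (reg_leq (leq_maxr k l) rg)).
  by move=> z y _; rewrite mevalD rmorphD.
- by exists (k + l)%N; apply: reg_ext (regM rf rg) => z y _; rewrite mevalM rmorphM.
Qed.

Definition re_im_mpoly (g : C -> R -> C) := exists A B : {mpoly R[3]}, forall z y, `|z| = 1 ->
  g z y = A.@[circ_point z y] +i* B.@[circ_point z y].

(** Real and imaginary parts are followed through the ring operations; they turn each [|G| ^ 2] into
    a sum of two squares of real polynomials. *)
Lemma re_im_mpoly_fib G : re_im_mpoly (fun z y => (fib G z).[y%:C]).
Proof.
have dC (c : C) : re_im_mpoly (fun _ _ => c).
  by case: c => a b; exists a%:MP, b%:MP => z y _; rewrite !mevalC.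
have dz : re_im_mpoly (fun z _ => z).
  by exists 'X_(0 : 'I_3), 'X_(1 : 'I_3) => z y _; rewrite !mevalXU; case: z.
have dy : re_im_mpoly (fun _ y => y%:C).
  by exists 'X_(2 : 'I_3), 0 => z y _; rewrite mevalXU meval0.
have dD (g h : C -> R -> C) : re_im_mpoly g -> re_im_mpoly h -> re_im_mpoly (fun z y => g z y + h z y).
  move=> [A [B gE]] [A' [B' hE]]; exists (A + A'), (B + B') => z y z1.
  by rewrite gE // hE // !mevalD.
have dM (g h : C -> R -> C) : re_im_mpoly g -> re_im_mpoly h -> re_im_mpoly (fun z y => g z y * h z y).
  move=> [A [B gE]] [A' [B' hE]]; exists (A * A' - B * B'), (A * B' + B * A') => z y z1.
  by rewrite gE // hE // mevalB mevalD !mevalM.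
have dext (g h : C -> R -> C) : (forall z y, g z y = h z y) -> re_im_mpoly g -> re_im_mpoly h.
  by move=> e [A [B gE]]; exists A, B => z y z1; rewrite -e gE.
have dp (p : {poly C}) : re_im_mpoly (fun z _ => p.[z]).
  elim/poly_ind: p => [|p c IH]; first by apply: dext (dC 0) => z y; rewrite horner0.
  by apply: dext (dD _ _ (dM _ _ IH dz) (dC c)) => z y; rewrite !hornerE.
elim/poly_ind: G => [|G p IH].
  by apply: dext (dC 0) => z y; rewrite fib0 horner0.
apply: dext (dD _ _ (dM _ _ IH dy) (dp p)) => z y.
by rewrite fibD fibM fibXX fibC !hornerE.
Qed.

Lemma norm_complex_sqr (a b : R) : `|a +i* b| ^+ 2 = (a ^+ 2 + b ^+ 2)%:C.
Proof. by rewrite normCK; apply/eqP; rewrite eq_complex /=; apply/andP; split; apply/eqP; ring. Qed.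

End Translation.

Theorem theorem2 (R : realType) (f : {mpoly R[3]}) :
  nonneg_on_V f -> sos_in_RV f.
Proof.
move=> f0; have [d [n [F [sF dF fE]]]] := reg_meval f.
have pF : psdV n F.
  move=> z y z1; rewrite -fE // ler0c; apply: f0; exact: circ_Re_Im.
have [s [_ sE]] := psd_sosd sF dF pF.
suff [t tE] : exists t : seq {mpoly R[3]}, forall z y, `|z| = 1 ->
    \sum_(G <- s) `|(fib G z).[(real_complex R y)]| ^+ 2 =
    real_complex R (\sum_(g <- t) g.@[circ_point z y] ^+ 2).
  (* The equality with the sum of squares is only one of functions on the real points; [circ_ideal]
     lifts it to an equality modulo the circle equation. *)
  have [v vV|h hE] := @circ_ideal R (f - \sum_(g <- t) g ^+ 2); last first.
    by exists t, h; rewrite -hE addrC subrK.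
  pose z := Complex (v 0) (v 1).
  have z1 : `|z| = 1.
    apply/eqP; rewrite -(@eqrXn2 _ 2) // expr1n norm_complex_sqr.
    by move: vV; rewrite /V_real_point => ->.
  have vE : v =1 circ_point z (v 2).
    by case=> [[|[|[|//]]] hi]; rewrite /circ_point /point3 /=; congr v; apply/val_inj.
  rewrite (meval_eq _ vE) mevalB; apply/eqP; rewrite subr_eq0; apply/eqP.
  apply: (@complexI R); rewrite -[LHS]/(real_complex R _) fE // sE // tE //; congr (real_complex R _).
  by rewrite rmorph_sum; apply: eq_bigr => g _; rewrite rmorphXn.
elim: s {sE} => [|G s [t tE]]; first by exists [::] => z y _; rewrite !big_nil.
have [A [B ABE]] := re_im_mpoly_fib G.
exists [:: A, B & t] => z y z1; rewrite big_cons tE // ABE // norm_complex_sqr !big_cons.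
by rewrite addrA [RHS]rmorphD.
Qed.
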